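(* Let $k\ge1$ be an integer, $\mathbf{x},\mathbf{y}\in\mathbb{C}^k$, $\mathbf{c},\mathbf{d}\in\mathbb{C}^k$ and $a,b\in\mathbb{C}$ with $\Re(\mathbf{c}-\mathbf{1})>\mathbf{0}$, $\Re(a)+k>\Re(\langle\mathbf{c}\rangle)$, $\Re(\mathbf{d}-\mathbf{1})>\mathbf{0}$ and $\Re(b)+k>\Re(\langle\mathbf{d}\rangle)$. Then the following two formulas hold. (1) For all $g,h\in\mathbb{C}$ with $\Re(g)>\Re(h)>0$, $$\Psi_2^{(k)}\big[a;\mathbf{c};\mathbf{x}\big]\,\Psi_2^{(k)}\big[b;\mathbf{d};\mathbf{y}\big]=\int_{\mathcal{L}^k\times\mathcal{L}^k}\int_0^1{}_1F_1\left[\begin{matrix}g\\ h\end{matrix};t\left\langle\frac{\mathbf{x}}{\mathbf{u}}+\frac{\mathbf{y}}{\mathbf{w}}\right\rangle\right]\mathrm{d}\widetilde{\mu}_{(\mathbf{c}-\mathbf{1},\,a+k-\langle\mathbf{c}\rangle)}(\mathbf{u})\,\mathrm{d}\widetilde{\mu}_{(\mathbf{d}-\mathbf{1},\,b+k-\langle\mathbf{d}\rangle)}(\mathbf{w})\,\mathrm{d}\mu_{h,g-h}(t).$$ (2) For all $g\in\mathbb{C}$ and $\mathbf{h}\in\mathbb{C}^k$ with $\Re(\mathbf{h})>\mathbf{0}$ and $\Re(g)>\Re(\langle\mathbf{h}\rangle)$, $$\Psi_2^{(k)}\big[a;\mathbf{c};\mathbf{x}\big]\,\Psi_2^{(k)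}\big[b;\mathbf{d};\mathbf{y}\big]=\int_{\mathcal{L}^k\times\mathcal{L}^k}\int_{E_k}\Psi_2^{(k)}\left[g;\mathbf{h};\frac{\mathbf{x}}{\mathbf{u}}\circ\mathbf{t}+\frac{\mathbf{y}}{\mathbf{w}}\circ\mathbf{t}\right]\mathrm{d}\widetilde{\mu}_{(\mathbf{c}-\mathbf{1},\,a+k-\langle\mathbf{c}\rangle)}(\mathbf{u})\,\mathrm{d}\widetilde{\mu}_{(\mathbf{d}-\mathbf{1},\,b+k-\langle\mathbf{d}\rangle)}(\mathbf{w})\,\mathrm{d}\mu_{(\mathbf{h},g-\langle\mathbf{h}\rangle)}(\mathbf{t}).$$
   Context: Boldface letters denote vectors of dimension $k$; $\mathbf{1}=(1,\dots,1)$. For $\mathbf{x},\mathbf{y}\in\mathbb{C}^k$ and $\mathbf{m}\in\mathbb{Z}_{\ge0}^k$: $\langle\mathbf{x}\rangle:=x_1+\cdots+x_k$, $\mathbf{x}\circ\mathbf{y}:=(x_1y_1,\dots,x_ky_k)$, $\frac{\mathbf{x}}{\mathbf{y}}:=(x_1/y_1,\dots,x_k/y_k)$, $\mathbf{x}^{\mathbf{m}}:=x_1^{m_1}\cdots x_k^{m_k}$, $\mathbf{m}!:=m_1!\cdots m_k!$; $\Re(\mathbf{a})>\mathbf{0}$ means $\Re(a_i)>0$ for all $i$. $(a)_n=a(a+1)\cdots(a+n-1)$, $(a)_0=1$. Functions (lower parameters not in $\mathbb{Z}_{\le0}$, arguments in $\mathbb{C}$ or $\mathbb{C}^k$): $${}_{1}F_{1}\left[\begin{matrix}a\\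 c\end{matrix};x\right]=\sum_{n=0}^\infty\frac{(a)_n}{(c)_n}\frac{x^n}{n!},\qquad \Psi_2^{(k)}[a;\mathbf{c};\mathbf{x}]=\sum_{\mathbf{m}\in\mathbb{Z}_{\ge0}^k}\frac{(a)_{\langle\mathbf{m}\rangle}}{(c_1)_{m_1}\cdots(c_k)_{m_k}}\frac{\mathbf{x}^{\mathbf{m}}}{\mathbf{m}!}.$$ Measures: for $\Re(\alpha),\Re(\beta)>0$, on $[0,1]$, $$\mathrm{d}\mu_{\alpha,\beta}(t)=\frac{\Gamma(\alpha+\beta)}{\Gamma(\alpha)\Gamma(\beta)}t^{\alpha-1}(1-t)^{\beta-1}\,\mathrm{d}t.$$ For $\Re(\boldsymbol{\lambda})>\mathbf{0}$, $\Re(\alpha)>0$, the (complex) Dirichlet measure on the standard simplex $E_k=\{\mathbf{s}\in\mathbb{R}^k: s_i\ge0,\ s_1+\cdots+s_k\le1\}$ is $$\mathrm{d}\mu_{(\boldsymbol{\lambda},\alpha)}(\mathbf{s})=\frac{\Gamma(\langle\boldsymbol{\lambda}\rangle+\alpha)}{\Gamma(\lambda_1)\cdots\Gamma(\lambda_k)\Gamma(\alpha)}\,s_1^{\lambda_1-1}\cdots s_k^{\lambda_k-1}(1-\langle\mathbf{s}\rangle)^{\alpha-1}\,\mathrm{d}\mathbf{s}.$$ $\mathcal{L}$ is the vertical line in $\mathbb{C}$ from $\frac{1}{k+1}-\mathrm{i}\infty$ to $\frac{1}{k+1}+\mathrm{i}\infty$ and $\mathcal{L}^k=\mathcal{L}\times\cdots\times\mathcal{L}$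 ($k$ factors). For $\Re(\mathbf{a})>\mathbf{0}$, $\Re(c)>0$, on $\mathcal{L}^k$, $$\mathrm{d}\widetilde{\mu}_{(\mathbf{a},c)}(\mathbf{t})=\frac{\Gamma(a_1+1)\cdots\Gamma(a_k+1)\Gamma(c)}{(2\pi\mathrm{i})^k\,\Gamma(\langle\mathbf{a}\rangle+c)}\,t_1^{-a_1-1}\cdots t_k^{-a_k-1}(1-\langle\mathbf{t}\rangle)^{-c}\,\mathrm{d}t_1\cdots\mathrm{d}t_k,$$ with principal branches of the powers (on $\mathcal{L}^k$ all $t_i$ and $1-\langle\mathbf{t}\rangle$ have real part $\frac1{k+1}>0$). *)

(* Defs.v *)
From HB Require Import structures.
From mathcomp Require Import all_boot all_order all_algebra.
From mathcomp Require Import all_classical all_reals all_analysis.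
From mathcomp Require Import complex.

Set Implicit Arguments.
Unset Strict Implicit.
Unset Printing Implicit Defensive.

Import Order.TTheory GRing.Theory Num.Theory.
Import numFieldNormedType.Exports.

Local Open Scope classical_set_scope.
Local Open Scope complex_scope.
Local Open Scope ring_scope.

(* Lebesgue measure on R^k, with R^k = k.-tuple R carrying the product
   sigma-algebra: the point mass for k = 0, and the image of
   lebesgue_measure \x lebesgue_tuple k under (x, t) |-> x :: t for k.+1. *)
Section lebesgue_tuple.
Context {R : realType}.
Local Notation RT := (measurableTypeR R).

Definition tuple_cons (k : nat) (p : RT * k.-tuple RT) : k.+1.-tuple RT :=
  [tuple of p.1 :: p.2].

Lemma measurable_tuple_cons (k : nat) :
  measurable_fun [set: (RT * k.-tuple RT)%type] (@tuple_cons k).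
Proof. exact: measurable_cons. Qed.

Section image.
Variables (k : nat) (m : {sigma_finite_measure set (k.-tuple RT) -> \bar R}).
Let prod_measure : {measure set (RT * k.-tuple RT)%type -> \bar R} :=
  (lebesgue_measure \x m)%E.

Definition tuple_cons_image : set (k.+1.-tuple RT) -> \bar R :=
  pushforward (lebesgue_measure \x m)%E (@tuple_cons k).

Let image_measure :=
  measure_function_pushforward__canonical__measure_function_Measure
    prod_measure (@measurable_tuple_cons k).

HB.instance Definition _ := isMeasure.Build _ _ _ tuple_cons_image
  (@measure0 _ _ _ image_measure)
  (@measure_ge0 _ _ _ image_measure)
  (@measure_semi_sigma_additive _ _ _ image_measure).

Let tuple_cons_image_sigma_finite :
  sigma_finite [set: k.+1.-tuple RT] tuple_cons_image.
Proof.
have /sigma_finiteP[F [FT ndF Foo]] := sigma_finiteT (@lebesgue_measure R).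
have /sigma_finiteP[G [GT ndG Goo]] := sigma_finiteT m.
pose unc (t : k.+1.-tuple RT) : RT * k.-tuple RT :=
  (thead t, [tuple of behead t]).
have consK p : unc (tuple_cons p) = p.
  by case: p => x t; congr pair; exact/val_inj.
have munc : measurable_fun setT unc.
  by apply/measurable_fun_pairP; split;
    [exact: measurable_tnth|exact: measurable_behead].
exists (fun n => unc @^-1` (F n `*` G n)).
  rewrite -preimage_bigcup (_ : \bigcup_n _ = setT) ?preimage_setT//.
  rewrite -subTset => -[u t] _.
  have [i _ Fi] : (\bigcup_i F i) u by rewrite -FT.
  have [j _ Gj] : (\bigcup_i G i) t by rewrite -GT.
  exists (maxn i j) => //; split.
  - by move: u Fi; exact/subsetPset/ndF/leq_maxl.
  - by move: t Gj; exact/subsetPset/ndG/leq_maxr.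
move=> n; have [mF Fn] := Foo n; have [mG Gn] := Goo n.
have mFG : measurable (F n `*` G n) by exact: measurableX.
split; first by rewrite -[X in measurable X]setTI; exact: munc.
rewrite /tuple_cons_image /pushforward (_ : _ @^-1` _ = F n `*` G n); last first.
  by rewrite -comp_preimage (_ : unc \o _ = id)//; apply/funext => p; exact: consK.
by rewrite product_measure1E// lte_mul_pinfty// ge0_fin_numE.
Qed.

HB.instance Definition _ := Measure_isSigmaFinite.Build _ _ _
  tuple_cons_image tuple_cons_image_sigma_finite.
End image.

Fixpoint lebesgue_tuple (k : nat) :
    {sigma_finite_measure set (k.-tuple RT) -> \bar R} :=
  match k with
  | 0 => \d_([tuple] : 0.-tuple RT)
  | k'.+1 => tuple_cons_image (lebesgue_tuple k')
  end.

End lebesgue_tuple.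
Arguments lebesgue_tuple : clear implicits.

Section complex_functions.
Context {R : realType}.
Local Notation C := R[i].

Definition cexp (z : C) : C :=
  (expR (complex.Re z) * cos (complex.Im z))
  +i* (expR (complex.Re z) * sin (complex.Im z)).

(* Principal argument, in ]-pi, pi] for z != 0. *)
Definition carg (z : C) : R :=
  let r := acos (complex.Re z / Normc.normc z) in
  if 0 <= complex.Im z then r else - r.

Definition clog (z : C) : C := ln (Normc.normc z) +i* carg z.

(* Principal branch of z ^ w; the value at z = 0 is a dummy. *)
Definition cpow (z w : C) : C := cexp (w * clog z).

Definition cintegrable d (T : measurableType d)
    (mu : {measure set T -> \bar R}) (D : set T) (f : T -> C) : Prop :=
  mu.-integrable D (fun x => (complex.Re (f x))%:E) /\
  mu.-integrable D (fun x => (complex.Im (f x))%:E).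

Definition cintegral d (T : measurableType d)
    (mu : {measure set T -> \bar R}) (D : set T) (f : T -> C) : C :=
  (\int[mu]_(x in D) complex.Re (f x)) +i* (\int[mu]_(x in D) complex.Im (f x)).

(* Euler's integral, i.e. the Gamma function on the half-plane Re z > 0. *)
Definition cGamma (z : C) : C :=
  cintegral lebesgue_measure `]0, +oo[
    (fun t : R => cpow t%:C (z - 1) * (expR (- t))%:C).

Definition cseries_sum (f : nat -> C) : C :=
  limn (series (fun n => complex.Re (f n)))
  +i* limn (series (fun n => complex.Im (f n))).

(* Unordered sums, meant for absolutely summable families. *)
Definition unordered_sum (I : choiceType) (f : I -> R) : R :=
  let g i := (f i)%:E in
  fine (\esum_(i in [set: I]) (g^\+ i)%E) - fine (\esum_(i in [set: I]) (g^\- i)%E).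

Definition cunordered_sum (I : choiceType) (f : I -> C) : C :=
  unordered_sum (fun i => complex.Re (f i))
  +i* unordered_sum (fun i => complex.Im (f i)).

Definition poch (a : C) (n : nat) : C := \prod_(j < n) (a + j%:R).

Definition hyp1F1 (a c x : C) : C :=
  cseries_sum (fun n => poch a n / poch c n * (x ^+ n / n`!%:R)).

Section vectors.
Variable k : nat.
Implicit Types x y a c : 'rV[C]_k.

Definition vsum x : C := \sum_j x 0 j.
Definition vmul x y : 'rV[C]_k := \row_j (x 0 j * y 0 j).
Definition vdiv x y : 'rV[C]_k := \row_j (x 0 j / y 0 j).
Definition vRe_gt0 x : Prop := forall j, 0 < complex.Re (x 0 j).
Definition vreal (s : k.-tuple R) : 'rV[C]_k := \row_j (tnth s j)%:C.

Definition Psi2 (a : C) c x : C :=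
  cunordered_sum (fun m : {ffun 'I_k -> nat} =>
    poch a (\sum_j m j)%N / (\prod_j poch (c 0 j) (m j))
    * ((\prod_j x 0 j ^+ m j) / (\prod_j (m j)`!)%N%:R)).

Definition simplex : set (k.-tuple R) :=
  [set s | (forall j, 0 <= tnth s j) /\ \sum_j tnth s j <= 1].

Definition dirichlet_density (lambda : 'rV[C]_k) (alpha : C)
    (s : k.-tuple R) : C :=
  cGamma (vsum lambda + alpha)
  / ((\prod_j cGamma (lambda 0 j)) * cGamma alpha)
  * (\prod_j cpow (vreal s 0 j) (lambda 0 j - 1))
  * cpow (1 - vsum (vreal s)) (alpha - 1).

Definition mutilde_density a (c : C) (t : 'rV[C]_k) : C :=
  (\prod_j cGamma (a 0 j + 1)) * cGamma c
  / ((2 * pi%:C * 'i%C) ^+ k * cGamma (vsum a + c))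
  * (\prod_j cpow (t 0 j) (- a 0 j - 1))
  * cpow (1 - vsum t) (- c).

(* L^k is parametrized by s in R^k through t_j = 1/(k+1) + i s_j, so that
   dt_1 ... dt_k = i^k ds_1 ... ds_k. *)
Definition line_pt (s : k.-tuple R) : 'rV[C]_k :=
  \row_j ((k.+1%:R)^-1 +i* tnth s j).

Definition line_density a (c : C) (s : k.-tuple R) : C :=
  mutilde_density a c (line_pt s) * 'i%C ^+ k.

End vectors.

Definition beta_density (alpha beta : C) (t : R) : C :=
  cGamma (alpha + beta) / (cGamma alpha * cGamma beta)
  * cpow t%:C (alpha - 1) * cpow (1 - t%:C) (beta - 1).

End complex_functions.
Arguments simplex : clear implicits.

(* Main.v *)
(* Expand the kernel at <x/u> + <y/w> (resp. x/u o t + y/w o t) as a power series in x/u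
   and y/w, a sum over pairs (m, p) of multi-indices.  Against the beta (resp. Dirichlet)
   density the power of t in the (m, p)-term integrates to exactly the inverse of the
   coefficient of the kernel, so that only (x/u)^m/m! * (y/w)^p/p! is left, and the two line
   integrals of these monomials are the terms (a)_<m>/(c)_m x^m/m! and
   (b)_<p>/(d)_p y^p/p! of the two factors.
   Termwise integration is legitimate since |1/u_j| <= k+1 on the line and the
   coefficients grow at most geometrically.

   The moments over L^k come from the Laplace inversion formula
     Gamma(al) * int (sigma + it)^-al e^((sigma + it)s) dt = 2 pi s^(al-1),
   after writing (1 - <u>)^-ga as a Gamma integral, which decouples the k variables.
   The inversion formula is proved by damping with e^(-eps|t|), which turns it into a
   convolution with the Poisson kernel. *)

Require Import Defs.
From HB Require Import structures.
From mathcomp Require Import all_boot all_order all_algebra.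
From mathcomp Require Import all_classical all_reals all_analysis.
From mathcomp Require Import complex.
From mathcomp Require Import ring lra measurable_realfun.

Set Implicit Arguments.
Unset Strict Implicit.
Unset Printing Implicit Defensive.

Import Order.TTheory GRing.Theory Num.Theory.
Import numFieldNormedType.Exports.

Local Open Scope classical_set_scope.
Local Open Scope complex_scope.
Local Open Scope ring_scope.

Local Notation Re := (@complex.Re _).
Local Notation Im := (@complex.Im _).
Local Notation normc := (@Normc.normc _).

(** * Complex-valued integrals *)

Section complex_algebra.
Context {R : realType}.
Implicit Types (x y z w : R[i]) (r t : R).

(** The hypotheses are exactly those of absolute convergence. Re c_j > 1 makes u_j^(-c_j-m_j)
    integrable along its line, and Re a + k > Re <c> is the condition for the Gamma integral that
    represents (1 - <u>)^-ga, where ga = a + k - <c>. The abscissa 1/(k+1) is the one for which 1 -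
    <u> has the same real part as every u_j, so e^(-r(1 - <u>)) decays in r at a rate independent of
    u and Fubini applies at once. No contour is shifted and no holomorphy is used: complex functions
    are differentiated only in a real variable. All facts about Gamma come from the Laplace
    transform of s^(al-1). Integration by parts gives the functional equation and, through a
    differential equation along a vertical line, the value Gamma(al) z^-al off the real axis; the
    inversion formula itself shows that Gamma has no zero in the half-plane, which justifies the
    later divisions. Densities are extended by zero to the whole space, so that Fubini, substitution
    and convolution need no domains. Both formulas are instances of one statement in which the
    kernel, the density and the coefficients are parameters. *)

Lemma ReD z w : Re (z + w) = Re z + Re w. Proof. by case: z; case: w. Qed.
Lemma ImD z w : Im (z + w) = Im z + Im w. Proof. by case: z; case: w. Qed.
Lemma ReN z : Re (- z) = - Re z. Proof. by case: z. Qed.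
Lemma ImN z : Im (- z) = - Im z. Proof. by case: z. Qed.
Lemma ReM z w : Re (z * w) = Re z * Re w - Im z * Im w.
Proof. by case: z; case: w. Qed.
Lemma ImM z w : Im (z * w) = Re z * Im w + Im z * Re w.
Proof. by case: z; case: w. Qed.

Lemma complex_eqP z w : Re z = Re w -> Im z = Im w -> z = w.
Proof. by case: z; case: w => /= ? ? ? ? -> ->. Qed.

Lemma Re_sum (I : Type) (s : seq I) (P : pred I) (F : I -> R[i]) :
  Re (\sum_(i <- s | P i) F i) = \sum_(i <- s | P i) Re (F i).
Proof. by apply: (big_morph _ ReD). Qed.

Lemma Im_sum (I : Type) (s : seq I) (P : pred I) (F : I -> R[i]) :
  Im (\sum_(i <- s | P i) F i) = \sum_(i <- s | P i) Im (F i).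
Proof. by apply: (big_morph _ ImD). Qed.

Lemma normc_sqrt z : normc z = Num.sqrt (Re z ^+ 2 + Im z ^+ 2).
Proof. by case: z. Qed.

Lemma normc_ge0 z : 0 <= normc z.
Proof. by rewrite normc_sqrt sqrtr_ge0. Qed.

Lemma normc_sqr z : normc z ^+ 2 = Re z ^+ 2 + Im z ^+ 2.
Proof. by rewrite normc_sqrt sqr_sqrtr// addr_ge0 ?sqr_ge0. Qed.

Lemma normc_real r : normc r%:C = `|r|.
Proof. by rewrite normc_sqrt/= expr0n/= addr0 sqrtr_sqr. Qed.

Lemma normc_real_ge0 r : 0 <= r -> normc r%:C = r.
Proof. by move=> r0; rewrite normc_real ger0_norm. Qed.

Lemma le_Re_normc z : `|Re z| <= normc z.
Proof.
by rewrite -(ler_pXn2r (ltn0Sn 1)) ?nnegrE ?normc_ge0// normc_sqr real_normK ?num_real// lerDl sqr_ge0.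
Qed.

Lemma le_Im_normc z : `|Im z| <= normc z.
Proof.
by rewrite -(ler_pXn2r (ltn0Sn 1)) ?nnegrE ?normc_ge0// normc_sqr real_normK ?num_real// lerDr sqr_ge0.
Qed.

Lemma normc_le_ReIm z : normc z <= `|Re z| + `|Im z|.
Proof.
rewrite -(ler_pXn2r (ltn0Sn 1)) ?nnegrE ?normc_ge0 ?addr_ge0//.
rewrite normc_sqr sqrrD !real_normK ?num_real//.
by have := mulr_ge0 (normr_ge0 (Re z)) (normr_ge0 (Im z)); lra.
Qed.

Lemma normc_gt0 z : (0 < normc z) = (z != 0).
Proof.
apply/idP/idP => [|z0].
  by apply: contraTneq => ->; rewrite Normc.normc0 ltxx.
by rewrite lt_neqAle normc_ge0 andbT eq_sym; apply: contra_neq z0; exact: Normc.eq0_normc.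
Qed.

Lemma normc_prod (I : Type) (s : seq I) (P : pred I) (F : I -> R[i]) :
  normc (\prod_(i <- s | P i) F i) = \prod_(i <- s | P i) normc (F i).
Proof. by apply: (big_morph _ (@Normc.normcM R)); exact: Normc.normc1. Qed.

Lemma normcX z n : normc (z ^+ n) = normc z ^+ n.
Proof. by elim: n => [|n IH]; rewrite ?Normc.normc1// !exprS Normc.normcM IH. Qed.

Lemma natc n : (n%:R : R[i]) = (n%:R : R)%:C.
Proof. by rewrite rmorph_nat. Qed.

Lemma Re_nat n : Re (n%:R : R[i]) = n%:R. Proof. by rewrite natc. Qed.
Lemma normc_nat n : normc (n%:R : R[i]) = n%:R.
Proof. by rewrite natc normc_real_ge0. Qed.

Lemma Re_gt0_neq0 z : 0 < Re z -> z != 0.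
Proof. by apply: contraTneq => ->; rewrite /= ltxx. Qed.

End complex_algebra.

Section complex_measurable.
Context d (T : measurableType d) {R : realType}.
Implicit Types (D : set T) (f g : T -> R[i]).

Definition cmeasurable D f :=
  measurable_fun D (fun x => Re (f x)) /\ measurable_fun D (fun x => Im (f x)).

Lemma cmeasurable_cst D (c : R[i]) : cmeasurable D (fun=> c).
Proof. by split; exact: measurable_cst. Qed.

Lemma cmeasurable_real D (r : T -> R) :
  measurable_fun D r -> cmeasurable D (fun x => (r x)%:C).
Proof. by move=> mr; split => //=; exact: measurable_cst. Qed.

Lemma cmeasurableN D f : cmeasurable D f -> cmeasurable D (fun x => - f x).
Proof.
move=> [fr fi]; split.
  by under eq_fun do rewrite ReN; exact: measurableT_comp.
by under eq_fun do rewrite ImN; exact: measurableT_comp.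
Qed.

Lemma cmeasurableM D f g :
  cmeasurable D f -> cmeasurable D g -> cmeasurable D (fun x => f x * g x).
Proof.
move=> [fr fi] [gr gi]; split.
  under eq_fun do rewrite ReM.
  by apply: measurable_funB; exact: measurable_funM.
under eq_fun do rewrite ImM.
by apply: measurable_funD; exact: measurable_funM.
Qed.

Lemma cmeasurable_prod D (I : Type) (s : seq I) (P : pred I) (F : I -> T -> R[i]) :
  (forall i, cmeasurable D (F i)) ->
  cmeasurable D (fun x => \prod_(i <- s | P i) F i x).
Proof.
move=> mF; elim: s => [|i s IH].
  by under eq_fun do rewrite big_nil; exact: cmeasurable_cst.
under eq_fun do rewrite big_cons.
by case: (P i) => //; exact: cmeasurableM.
Qed.

Lemma cmeasurableX D f n :
  cmeasurable D f -> cmeasurable D (fun x => f x ^+ n).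
Proof.
move=> mf; elim: n => [|n IH].
  by under eq_fun do rewrite expr0; exact: cmeasurable_cst.
by under eq_fun do rewrite exprS; exact: cmeasurableM.
Qed.

Lemma measurable_normc D f :
  cmeasurable D f -> measurable_fun D (fun x => normc (f x)).
Proof.
move=> [fr fi]; under eq_fun do rewrite normc_sqrt.
apply: (measurableT_comp (f := @Num.sqrt R)); first exact: continuous_measurable_fun (@sqrt_continuous R).
by apply: measurable_funD; exact: measurable_funX.
Qed.

Lemma measurable_cexp D f : cmeasurable D f -> cmeasurable D (fun x => cexp (f x)).
Proof.
move=> [fr fi]; split => /=; apply: measurable_funM => //.
- exact: measurableT_comp.
- by apply: (measurableT_comp (f := @cos R)) => //; exact: continuous_measurable_fun (@continuous_cos R).
- exact: measurableT_comp.
- by apply: (measurableT_comp (f := @sin R)) => //; exact: continuous_measurable_fun (@continuous_sin R).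
Qed.

Lemma cmeasurable_if (b : T -> bool) f g :
  measurable_fun setT b -> cmeasurable setT f -> cmeasurable setT g ->
  cmeasurable setT (fun x => if b x then f x else g x).
Proof.
move=> mb [fr fi] [gr gi]; split.
  rewrite (_ : (fun _ => _) = fun x => if b x then Re (f x) else Re (g x)).
    by apply: measurable_fun_ifT => //.
  by apply/funext => x; case: (b x).
rewrite (_ : (fun _ => _) = fun x => if b x then Im (f x) else Im (g x)).
  by apply: measurable_fun_ifT => //.
by apply/funext => x; case: (b x).
Qed.

End complex_measurable.

Lemma cmeasurable_comp d d' (T : measurableType d) (T' : measurableType d')
    {R : realType} (h : T' -> T) (f : T -> R[i]) :
  cmeasurable setT f -> measurable_fun setT h ->
  cmeasurable setT (fun x => f (h x)).
Proof.
move=> [fr fi] mh; split.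
  exact: (measurableT_comp (f := fun x => Re (f x)) fr mh).
exact: (measurableT_comp (f := fun x => Im (f x)) fi mh).
Qed.

Section complex_integral.
Context d (T : measurableType d) {R : realType}.
Variable mu : {measure set T -> \bar R}.
Implicit Types (D : set T) (f g : T -> R[i]).

Lemma cintegrable_cmeasurable D f : cintegrable mu D f -> cmeasurable D f.
Proof. by move=> [fr fi]; split; exact/measurable_EFinP/(measurable_int mu). Qed.

Lemma cintegrable_normc D f : measurable D ->
  cintegrable mu D f -> mu.-integrable D (fun x => (normc (f x))%:E).
Proof.
move=> mD If; have mf := cintegrable_cmeasurable If; case: If => fr fi.
apply: (@le_integrable _ _ _ mu D mD _
  (fun x => (`|Re (f x)| + `|Im (f x)|)%:E)) => //.
- exact/measurable_EFinP/measurable_normc.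
- by move=> x Dx; rewrite lee_fin/= (ger0_norm (normc_ge0 _)) (le_trans (normc_le_ReIm _))// ler_norm.
- under eq_fun do rewrite EFinD.
  by apply: integrableD => //; exact: integrable_norm.
Qed.

Lemma le_cintegrable D f (g : T -> R) : measurable D -> cmeasurable D f ->
  (forall x, D x -> normc (f x) <= g x) -> mu.-integrable D (EFin \o g) ->
  cintegrable mu D f.
Proof.
move=> mD [fr fi] fg Ig; split; apply: (le_integrable mD _ _ Ig) => /=;
  try exact/measurable_EFinP; move=> x Dx; rewrite lee_fin;
  apply: (le_trans _ (le_trans (fg x Dx) (ler_norm _))).
- exact: le_Re_normc.
- exact: le_Im_normc.
Qed.

Lemma cintegrableP D f : measurable D ->
  cintegrable mu D f <->
  cmeasurable D f /\ (\int[mu]_(x in D) (normc (f x))%:E < +oo)%E.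
Proof.
move=> mD; have E : (\int[mu]_(x in D) `|(normc (f x))%:E| =
    \int[mu]_(x in D) (normc (f x))%:E)%E.
  by apply: eq_integral => x _; rewrite /= ger0_norm ?normc_ge0.
split=> [If|[mf foo]].
  split; first exact: cintegrable_cmeasurable.
  by have /integrableP[_] := cintegrable_normc mD If; rewrite E.
apply: (@le_cintegrable D f (fun x => normc (f x))) => //.
apply/integrableP; split; first exact/measurable_EFinP/measurable_normc.
by rewrite E.
Qed.

Lemma eq_cintegral D f g : (forall x, D x -> f x = g x) ->
  cintegral mu D f = cintegral mu D g.
Proof.
by move=> fg; rewrite /cintegral; congr (_ +i* _); apply: eq_Rintegral => x /[!inE] /fg ->.
Qed.

Lemma eq_cintegrable D f g : measurable D -> (forall x, D x -> f x = g x) ->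
  cintegrable mu D f -> cintegrable mu D g.
Proof.
move=> mD fg [fr fi]; split.
  by apply: (@eq_integrable _ _ _ mu D mD (fun x => (Re (f x))%:E)) => // x /[!inE] /fg ->.
by apply: (@eq_integrable _ _ _ mu D mD (fun x => (Im (f x))%:E)) => // x /[!inE] /fg ->.
Qed.

Lemma cintegrableD D f g : measurable D ->
  cintegrable mu D f -> cintegrable mu D g -> cintegrable mu D (fun x => f x + g x).
Proof.
move=> mD [fr fi] [gr gi]; split.
  by under eq_fun do rewrite ReD EFinD; exact: integrableD.
by under eq_fun do rewrite ImD EFinD; exact: integrableD.
Qed.

Lemma cintegralD D f g : measurable D ->
  cintegrable mu D f -> cintegrable mu D g ->
  cintegral mu D (fun x => f x + g x) = cintegral mu D f + cintegral mu D g.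
Proof.
move=> mD [fr fi] [gr gi]; apply: complex_eqP; rewrite ?ReD ?ImD/=.
  by rewrite -RintegralD//; apply: eq_Rintegral => x _; rewrite ReD.
by rewrite -RintegralD//; apply: eq_Rintegral => x _; rewrite ImD.
Qed.

Lemma cintegrableZl D (c : R[i]) f : measurable D ->
  cintegrable mu D f -> cintegrable mu D (fun x => c * f x).
Proof.
move=> mD [fr fi]; split.
  under eq_fun do rewrite ReM EFinB !EFinM.
  by apply: integrableB => //; exact: integrableZl.
under eq_fun do rewrite ImM EFinD !EFinM.
by apply: integrableD => //; exact: integrableZl.
Qed.

Lemma cintegralZl D (c : R[i]) f : measurable D ->
  cintegrable mu D f -> cintegral mu D (fun x => c * f x) = c * cintegral mu D f.
Proof.
move=> mD [fr fi]; have rZ (r : R) (h : T -> R) : mu.-integrable D (EFin \o h) ->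
    mu.-integrable D (EFin \o (fun x => r * h x)).
  by move=> hi; exact: (integrableZl mD r hi).
apply: complex_eqP; rewrite ?ReM ?ImM/=.
  rewrite -!RintegralZl// -RintegralB ?rZ//.
  by apply: eq_Rintegral => x _; rewrite ReM.
rewrite -!RintegralZl// -RintegralD ?rZ//.
by apply: eq_Rintegral => x _; rewrite ImM.
Qed.

Lemma cintegral_mkcond D f :
  cintegral mu D f = cintegral mu setT (fun x => if x \in D then f x else 0).
Proof.
apply: complex_eqP => /=; rewrite Rintegral_mkcond; apply: eq_Rintegral => x _;
  by rewrite patchE; case: ifP.
Qed.

Lemma cintegrable_mkcond D f : measurable D ->
  cintegrable mu setT (fun x => if x \in D then f x else 0) <->
  cintegrable mu D f.
Proof.
move=> mD; have E (h : R[i] -> R) : h 0 = 0 ->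
    (fun x => (h (if x \in D then f x else 0))%:E) =
    (fun x => (h (f x))%:E) \_ D.
  by move=> h0; apply/funext => x; rewrite patchE; case: ifP => // _; rewrite h0.
rewrite /cintegrable (E (@complex.Re R))// (E (@complex.Im R))//.
by split=> -[fr fi]; split; apply/(integrable_mkcond _ mD).
Qed.

Lemma cintegral0 D : cintegral mu D (fun=> 0) = 0.
Proof. by rewrite /cintegral/= /Rintegral integral0. Qed.

Lemma cintegrable_real D (r : T -> R) :
  mu.-integrable D (EFin \o r) -> cintegrable mu D (fun x => (r x)%:C).
Proof. by move=> ri; split => //=; exact: integrable0. Qed.

Lemma cintegral_real D (r : T -> R) :
  cintegral mu D (fun x => (r x)%:C) = (\int[mu]_(x in D) r x)%:C.
Proof. by apply: complex_eqP => //=; rewrite /Rintegral integral0. Qed.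

Lemma ae_eq_cintegral D f g : measurable D -> cmeasurable D f -> cmeasurable D g ->
  {ae mu, forall x, D x -> f x = g x} -> cintegral mu D f = cintegral mu D g.
Proof.
move=> mD [fr fi] [gr gi] fg; apply: complex_eqP => /=; congr fine;
  apply: ae_eq_integral => //; try exact/measurable_EFinP;
  by apply: filterS fg => x /[apply] ->.
Qed.

Lemma ae_eq_cintegrable D f g : measurable D -> cmeasurable D f -> cmeasurable D g ->
  {ae mu, forall x, D x -> f x = g x} -> cintegrable mu D f -> cintegrable mu D g.
Proof.
move=> mD [fr fi] [gr gi] fg [Ir Ii].
have key (h : R[i] -> R) : measurable_fun D (fun x => h (f x)) ->
    measurable_fun D (fun x => h (g x)) ->
    mu.-integrable D (fun x => (h (f x))%:E) ->
    mu.-integrable D (fun x => (h (g x))%:E).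
  move=> mf mg /integrableP[_ foo]; apply/integrableP; split.
    exact/measurable_EFinP.
  rewrite (@ae_eq_integral _ _ _ mu D (fun x => `|(h (g x))%:E|)%E
    (fun x => `|(h (f x))%:E|)%E mD) in foo *; first exact: foo.
  - by apply: measurableT_comp => //; exact/measurable_EFinP.
  - by apply: measurableT_comp => //; exact/measurable_EFinP.
  - by apply: filterS fg => x /[apply] ->.
by split; apply: key.
Qed.

(** Limits of complex quantities are taken by components, so that only real convergence occurs; a
    single bound on the modulus dominates both components. *)
Lemma cdominated_convergence D (F : nat -> T -> R[i]) f (g : T -> R) :
  measurable D -> (forall n, cmeasurable D (F n)) -> cmeasurable D f ->
  (forall x, D x -> Re (F n x) @[n --> \oo] --> Re (f x)) ->
  (forall x, D x -> Im (F n x) @[n --> \oo] --> Im (f x)) ->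
  mu.-integrable D (EFin \o g) ->
  (forall n x, D x -> normc (F n x) <= g x) ->
  Re (cintegral mu D (F n)) @[n --> \oo] --> Re (cintegral mu D f) /\
  Im (cintegral mu D (F n)) @[n --> \oo] --> Im (cintegral mu D f).
Proof.
move=> mD mF [mfr mfi] cr ci gi Fg.
have key (h : R[i] -> R) : (forall z, `|h z| <= normc z) ->
    (forall n, measurable_fun D (fun x => h (F n x))) ->
    measurable_fun D (fun x => h (f x)) ->
    (forall x, D x -> h (F n x) @[n --> \oo] --> h (f x)) ->
    \int[mu]_(x in D) h (F n x) @[n --> \oo] --> \int[mu]_(x in D) h (f x).
  move=> hle mhF mhf hc.
  have [|||||If _ cvg] := @dominated_convergence _ _ _ mu D mD
      (fun n x => (h (F n x))%:E) (fun x => (h (f x))%:E) (EFin \o g).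
  - by move=> n; exact/measurable_EFinP.
  - exact/measurable_EFinP.
  - by apply: aeW => x Dx; apply/cvg_EFin; [exact: nearW|exact: hc].
  - exact: gi.
  - by apply: aeW => x n Dx; rewrite lee_fin (le_trans (hle _))// Fg.
  apply: fine_cvg; rewrite fineK//; exact: integrable_fin_num.
split; apply: key => //; [exact: le_Re_normc|by move=> n; case: (mF n)
  |exact: le_Im_normc|by move=> n; case: (mF n)].
Qed.

End complex_integral.

Section complex_fubini.
Context d1 d2 (T1 : measurableType d1) (T2 : measurableType d2) {R : realType}.
Variable m1 : {sigma_finite_measure set T1 -> \bar R}.
Variable m2 : {sigma_finite_measure set T2 -> \bar R}.
Let mx : {measure set (T1 * T2) -> \bar R} := (m1 \x m2)%E.

(** For x in a null set the section of [f] may fail to be integrable; there the real-valued inner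
    integral takes a default value and may differ from [fubini_F]. The two are therefore compared
    almost everywhere. *)
Let Rfubini1 (f : T1 * T2 -> R) : mx.-integrable setT (EFin \o f) ->
  m1.-integrable setT (EFin \o (fun x => \int[m2]_y f (x, y))) /\
  \int[m1]_x \int[m2]_y f (x, y) = \int[mx]_z f z.
Proof.
move=> fi; have mF := measurable_fubini_F fi.
have IF := integrable_fubini_F fi.
have ae1 := ae_integrable1 fi.
have E : ae_eq m1 setT (fubini_F m2 (EFin \o f)) (EFin \o (fun x => \int[m2]_y f (x, y))).
  apply: filterS ae1 => x fx _ /=; rewrite /Rintegral fineK//.
  exact: integrable_fin_num fx.
have mG : measurable_fun setT (EFin \o (fun x => \int[m2]_y f (x, y))).
  apply/measurable_EFinP.
  exact: (measurableT_comp (f := fine)) mF.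
have I1 : m1.-integrable setT (EFin \o (fun x => \int[m2]_y f (x, y))).
  apply/integrableP; split => //; move/integrableP : IF => [_].
  rewrite (@ae_eq_integral _ _ _ m1 setT (abse \o fubini_F m2 (EFin \o f))
     (abse \o (EFin \o (fun x => \int[m2]_y f (x, y)))))//.
  - exact: measurableT_comp.
  - exact: measurableT_comp.
  - by apply: filterS E => x /[apply] /= ->.
split => //.
rewrite /Rintegral; congr fine; rewrite -integral12_prod_meas1//.
by apply: ae_eq_integral => //; apply: filterS E => x /[apply] ->.
Qed.

Let Rfubini2 (f : T1 * T2 -> R) : mx.-integrable setT (EFin \o f) ->
  m2.-integrable setT (EFin \o (fun y => \int[m1]_x f (x, y))) /\
  \int[m2]_y \int[m1]_x f (x, y) = \int[mx]_z f z.
Proof.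
move=> fi; have mF := measurable_fubini_G fi.
have mf : measurable_fun setT (EFin \o f) by exact: measurable_int fi.
have IF : m2.-integrable setT (fubini_G m1 (EFin \o f)).
  apply/integrableP; split => //.
  apply: le_lt_trans ((integrable21ltyP m1 m2 mf).1 fi).
  apply: ge0_le_integral => //.
  - exact: measurableT_comp.
  - apply: (measurable_fun_fubini_tonelli_G (abse \o (EFin \o f))) => //=.
    exact: measurableT_comp.
  - move=> y _; apply: le_abse_integral => //.
    exact: (measurableT_comp mf (measurable_pair2 y)).
have ae1 := ae_integrable2 fi.
have E : ae_eq m2 setT (fubini_G m1 (EFin \o f)) (EFin \o (fun y => \int[m1]_x f (x, y))).
  apply: filterS ae1 => x fx _ /=; rewrite /Rintegral fineK//.
  exact: integrable_fin_num fx.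
have mG : measurable_fun setT (EFin \o (fun y => \int[m1]_x f (x, y))).
  apply/measurable_EFinP.
  exact: (measurableT_comp (f := fine)) mF.
have I1 : m2.-integrable setT (EFin \o (fun y => \int[m1]_x f (x, y))).
  apply/integrableP; split => //; move/integrableP : IF => [_].
  rewrite (@ae_eq_integral _ _ _ m2 setT (abse \o fubini_G m1 (EFin \o f))
     (abse \o (EFin \o (fun y => \int[m1]_x f (x, y)))))//.
  - exact: measurableT_comp.
  - exact: measurableT_comp.
  - by apply: filterS E => x /[apply] /= ->.
split => //.
rewrite /Rintegral; congr fine; rewrite -integral21_prod_meas1//.
by apply: ae_eq_integral => //; apply: filterS E => x /[apply] ->.
Qed.

Lemma cintegral_fubini1 (f : T1 * T2 -> R[i]) : cintegrable mx setT f ->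
  cintegral m1 setT (fun x => cintegral m2 setT (fun y => f (x, y))) =
  cintegral mx setT f.
Proof.
move=> [fr fi]; apply: complex_eqP => /=.
  exact: (Rfubini1 fr).2.
exact: (Rfubini1 fi).2.
Qed.

Lemma cintegral_fubini2 (f : T1 * T2 -> R[i]) : cintegrable mx setT f ->
  cintegral m2 setT (fun y => cintegral m1 setT (fun x => f (x, y))) =
  cintegral mx setT f.
Proof.
move=> [fr fi]; apply: complex_eqP => /=.
  exact: (Rfubini2 fr).2.
exact: (Rfubini2 fi).2.
Qed.

Lemma cintegrable_fubini2 (f : T1 * T2 -> R[i]) : cintegrable mx setT f ->
  cintegrable m2 setT (fun y => cintegral m1 setT (fun x => f (x, y))).
Proof.
by move=> [fr fi]; split => /=; [exact: (Rfubini2 fr).1|exact: (Rfubini2 fi).1].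
Qed.

Lemma cintegrable_tonelli1 (f : T1 * T2 -> R[i]) : cmeasurable setT f ->
  (\int[m1]_x \int[m2]_y (normc (f (x, y)))%:E < +oo)%E ->
  cintegrable mx setT f.
Proof.
move=> mf foo; apply: (@le_cintegrable _ _ _ mx _ _ (fun z => normc (f z))) => //.
have mn : measurable_fun setT (EFin \o (fun z => normc (f z))).
  exact/measurable_EFinP/measurable_normc.
apply/(integrable12ltyP _ _ mn).
suff -> : (fun x => \int[m2]_y `|(EFin \o (fun z => normc (f z))) (x, y)|)%E =
          (fun x => \int[m2]_y (normc (f (x, y)))%:E)%E by [].
apply/funext => x; apply: eq_integral => y _ /=.
by rewrite ger0_norm// normc_ge0.
Qed.

Lemma integrable_prodM (g : T1 -> R) (h : T2 -> R) :
  m1.-integrable setT (EFin \o g) -> m2.-integrable setT (EFin \o h) ->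
  mx.-integrable setT (EFin \o (fun p => g p.1 * h p.2)).
Proof.
move=> Ig Ih.
have mg : measurable_fun setT g by exact/measurable_EFinP/(measurable_int m1).
have mh : measurable_fun setT h by exact/measurable_EFinP/(measurable_int m2).
have mg' : measurable_fun setT (fun x => `|(g x)%:E|%E).
  by apply: measurableT_comp => //; exact/measurable_EFinP.
have mh' : measurable_fun setT (fun x => `|(h x)%:E|%E).
  by apply: measurableT_comp => //; exact/measurable_EFinP.
have mgh : measurable_fun setT (EFin \o (fun p : T1 * T2 => g p.1 * h p.2)).
  by apply/measurable_EFinP; apply: measurable_funM; exact: measurableT_comp.
apply/(integrable12ltyP _ _ mgh).
have -> : (fun x => \int[m2]_y `|(EFin \o (fun p : T1 * T2 => g p.1 * h p.2)%R) (x, y)|)%E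
    = (fun x => `|g x|%:E * \int[m2]_y `|(h y)%:E|)%E.
  apply/funext => x; rewrite -ge0_integralZl//.
  by apply: eq_integral => y _; rewrite /= normrM EFinM.
have /integrableP[_ ho] := Ih; have /integrableP[_ go] := Ig.
have hfin : (\int[m2]_y `|(h y)%:E| \is a fin_num)%E.
  by rewrite ge0_fin_numE// integral_ge0.
rewrite -(fineK hfin) ge0_integralZr//.
  by apply: lte_mul_pinfty; rewrite ?ltry// ?ge0_fin_numE//; exact: integral_ge0.
by rewrite lee_fin fine_ge0// integral_ge0.
Qed.

Lemma cintegrable_prodM (f : T1 -> R[i]) (g : T2 -> R[i]) :
  cintegrable m1 setT f -> cintegrable m2 setT g ->
  cintegrable mx setT (fun p => f p.1 * g p.2).
Proof.
move=> If Ig; apply: (@le_cintegrable _ _ _ mx _ _ (fun p => normc (f p.1) * normc (g p.2))) => //.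
- apply: cmeasurableM.
    exact: (cmeasurable_comp (h := fst) (cintegrable_cmeasurable If)).
  exact: (cmeasurable_comp (h := snd) (cintegrable_cmeasurable Ig)).
- by move=> x _; rewrite Normc.normcM.
- apply: (integrable_prodM (g := fun z => normc (f z)) (h := fun z => normc (g z)));
  exact: cintegrable_normc.
Qed.

Lemma cintegral_prodM (f : T1 -> R[i]) (g : T2 -> R[i]) :
  cintegrable m1 setT f -> cintegrable m2 setT g ->
  cintegral mx setT (fun p => f p.1 * g p.2) =
  cintegral m1 setT f * cintegral m2 setT g.
Proof.
move=> If Ig; rewrite -cintegral_fubini1/=; last exact: cintegrable_prodM.
under eq_fun do rewrite cintegralZl//.
rewrite (mulrC (cintegral m1 setT f)) -cintegralZl//.
by apply: eq_cintegral => x _; rewrite mulrC.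
Qed.

End complex_fubini.

(** * Affine substitutions and Lebesgue measure on tuples *)

Section affine_change.
Context {R : realType}.
Local Notation mu := (@lebesgue_measure R).

Lemma measurable_affine (a b : R) :
  measurable_fun setT (fun x => a * x + b : measurableTypeR R).
Proof. by apply: measurable_funD => //; exact: measurable_funM. Qed.

(** Uniqueness of Lebesgue measure: the right-hand side is a measure in [A], and it has the correct
    value on half-open intervals. *)
Lemma lebesgue_measure_affine (a b : R) (A : set R) : a != 0 -> measurable A ->
  mu A = (`|a|%:E * mu ((fun x => (a * x + b)%R) @^-1` A))%E.
Proof.
move=> a0 mA.
pose phi x : measurableTypeR R := a * x + b.
have mphi : measurable_fun [set: measurableTypeR R] phi by exact: measurable_affine.
pose P : {measure set (measurableTypeR R) -> \bar R} :=
  measure_function_pushforward__canonical__measure_function_Measure mu mphi.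
pose a' : {nonneg R} := NngNum (normr_ge0 a).
apply: (lebesgue_measure_unique (mu := mscale a' P)) => // _ [[u v]] _ <-.
change (mu `]u, v]%classic = (`|a|%:E * mu (phi @^-1` `]u, v]%classic))%E).
have [a_gt0|a_lt0|/eqP] := ltgtP a 0; last by rewrite (negbTE a0).
(* In this case [a] is negative: the endpoints are exchanged and the preimage is closed on the left,
   open on the right. *)
- have -> : phi @^-1` `]u, v] = `[(v - b) / a, (u - b) / a[%classic.
    apply/seteqP; split => x /=; rewrite !in_itv/= /phi => /andP[H1 H2];
    by rewrite ler_ndivrMr// ltr_ndivlMr// in H1 H2 *; apply/andP; split; lra.
  rewrite !lebesgue_measure_itv/= !lte_fin ltr_nM2r ?invr_lt0// ltrD2r.
  case: ifP => _; rewrite ?mule0// -!EFinB -EFinM; congr EFin.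
  by rewrite ltr0_norm//; field.
- have -> : phi @^-1` `]u, v] = `](u - b) / a, (v - b) / a]%classic.
    apply/seteqP; split => x /=; rewrite !in_itv/= /phi => /andP[H1 H2];
    by rewrite ltr_pdivrMr// ler_pdivlMr// in H1 H2 *; apply/andP; split; lra.
  rewrite !lebesgue_measure_itv/= !lte_fin ltr_pM2r ?invr_gt0// ltrD2r.
  case: ifP => _; rewrite ?mule0// -!EFinB -EFinM; congr EFin.
  by rewrite gtr0_norm//; field.
Qed.

Lemma ge0_integral_affine (a b : R) (f : R -> \bar R) : a != 0 ->
  measurable_fun setT f -> (forall x, 0 <= f x)%E ->
  (\int[mu]_x f x = `|a|%:E * \int[mu]_x f (a * x + b)%R)%E.
Proof.
move=> a0 mf f0.
pose phi x : measurableTypeR R := a * x + b.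
have mphi : measurable_fun [set: measurableTypeR R] phi by exact: measurable_affine.
pose P : {measure set (measurableTypeR R) -> \bar R} :=
  measure_function_pushforward__canonical__measure_function_Measure mu mphi.
pose a' : {nonneg R} := NngNum (normr_ge0 a).
transitivity (\int[mscale a' P]_x f x)%E.
  by apply: eq_measure_integral => A mA _; exact: (lebesgue_measure_affine b a0 mA).
rewrite ge0_integral_mscale//; congr (_ * _)%E.
by rewrite [LHS](ge0_integral_pushforward mphi)// preimage_setT.
Qed.

Lemma cintegrable_affine (a b : R) (f : R -> R[i]) : a != 0 ->
  cintegrable mu setT f -> cintegrable mu setT (fun x => f (a * x + b)).
Proof.
move=> a0 If; have mf := cintegrable_cmeasurable If.
have mfa : cmeasurable setT (fun x : measurableTypeR R => f (a * x + b)).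
  exact: (cmeasurable_comp mf (measurable_affine a b)).
apply/cintegrableP => //; split => //.
have [_] := (cintegrableP _ _ measurableT).1 If.
rewrite (ge0_integral_affine b a0)//; last 2 first.
- exact/measurable_EFinP/measurable_normc.
- by move=> x; rewrite lee_fin normc_ge0.
apply: contraTT; rewrite -!leNgt !leye_eq => /eqP ->.
by rewrite gt0_muley// lte_fin normr_gt0.
Qed.

Lemma cintegral_affine (a b : R) (f : R -> R[i]) : a != 0 ->
  cintegrable mu setT f ->
  cintegral mu setT f = `|a|%:C * cintegral mu setT (fun x => f (a * x + b)).
Proof.
move=> a0 If; have [mr mi] := cintegrable_cmeasurable If.
have [Ir Ii] := cintegrable_affine b a0 If.
have key (h : R -> R) : measurable_fun setT h ->
    mu.-integrable setT (EFin \o h) ->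
    mu.-integrable setT (fun x => (h (a * x + b))%:E) ->
    \int[mu]_x h x = `|a| * \int[mu]_x h (a * x + b).
  move=> mh Ih Iha.
  rewrite /Rintegral [X in _ = _ * fine X](integralE) [X in fine X](integralE).
  have meh : measurable_fun setT (EFin \o h) by exact/measurable_EFinP.
  rewrite (ge0_integral_affine b a0 (measurable_funepos meh))//.
  rewrite (ge0_integral_affine b a0 (measurable_funeneg meh))//.
  have -> : (fun x => (EFin \o h)^\+ (a * x + b)%R)%E =
      ((fun x => (h (a * x + b))%:E)^\+)%E.
    by apply/funext => x; rewrite !funeposE.
  have -> : (fun x => (EFin \o h)^\- (a * x + b)%R)%E =
      ((fun x => (h (a * x + b))%:E)^\-)%E.
    by apply/funext => x; rewrite !funenegE.
  rewrite -(fineK (integrable_pos_fin_num measurableT Iha)).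
  by rewrite -(fineK (integrable_neg_fin_num measurableT Iha)) /= mulrBr.
apply: complex_eqP; rewrite ?ReM ?ImM/= mul0r ?subr0 ?addr0.
  by rewrite -(key (fun x => Re (f x)))//; case: If.
by rewrite -(key (fun x => Im (f x)))//; case: If.
Qed.

End affine_change.

Section tuple_integral.
Context {R : realType}.
Local Notation RT := (measurableTypeR R).
Local Notation lam := (@lebesgue_measure R).

Lemma cintegrable_tupleS k (f : k.+1.-tuple RT -> R[i]) : cmeasurable setT f ->
  cintegrable (lam \x lebesgue_tuple R k)%E setT (fun p => f (tuple_cons p)) ->
  cintegrable (lebesgue_tuple R k.+1) setT f.
Proof.
move=> [mr mi] [Ir Ii]; split; apply: (integrable_pushforward (phi := @tuple_cons R k)) => //.
- exact: measurable_tuple_cons.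
- exact/measurable_EFinP.
- exact: measurable_tuple_cons.
- exact/measurable_EFinP.
Qed.

Lemma cintegral_tupleS k (f : k.+1.-tuple RT -> R[i]) : cmeasurable setT f ->
  cintegrable (lam \x lebesgue_tuple R k)%E setT (fun p => f (tuple_cons p)) ->
  cintegral (lebesgue_tuple R k.+1) setT f =
  cintegral (lam \x lebesgue_tuple R k)%E setT (fun p => f (tuple_cons p)).
Proof.
move=> [mr mi] [Ir Ii]; apply: complex_eqP => /=; congr fine.
  by rewrite [LHS](integral_pushforward (measurable_tuple_cons (k := k)) (mu := (lam \x lebesgue_tuple R k)%E)) ?preimage_setT//; exact/measurable_EFinP.
by rewrite [LHS](integral_pushforward (measurable_tuple_cons (k := k)) (mu := (lam \x lebesgue_tuple R k)%E)) ?preimage_setT//; exact/measurable_EFinP.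
Qed.

Lemma cintegral_tuple0 (f : 0.-tuple RT -> R[i]) : cmeasurable setT f ->
  cintegrable (lebesgue_tuple R 0) setT f /\
  cintegral (lebesgue_tuple R 0) setT f = f [tuple].
Proof.
move=> [mr mi]; split.
  split; apply/integrableP; (split; first exact/measurable_EFinP);
  by rewrite integral_dirac//= ?diracT ?mul1e ?ltry//;
    do 2 apply: measurableT_comp => //.
apply: complex_eqP => /=; rewrite /Rintegral integral_dirac ?diracT ?mul1e//;
  exact/measurable_EFinP.
Qed.

Lemma cmeasurable_tuple_prod k (f : 'I_k -> R -> R[i]) :
  (forall j, cmeasurable setT (f j : RT -> _)) ->
  cmeasurable setT (fun s : k.-tuple RT => \prod_j f j (tnth s j)).
Proof.
move=> mf; apply: cmeasurable_prod => j.
exact: (cmeasurable_comp (mf j) (measurable_tnth j)).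
Qed.

(** Induction on [k] by Fubini, the first coordinate against the others; the unit mass at the empty
    tuple matches the empty product. *)
Lemma cintegral_tuple_prod k (f : 'I_k -> R -> R[i]) :
  (forall j, cintegrable lam setT (f j)) ->
  cintegrable (lebesgue_tuple R k) setT (fun s => \prod_j f j (tnth s j)) /\
  cintegral (lebesgue_tuple R k) setT (fun s => \prod_j f j (tnth s j)) =
  \prod_j cintegral lam setT (f j).
Proof.
elim: k f => [|k IH] f If.
  have [|I0 ->] := @cintegral_tuple0 (fun s => \prod_(j < 0) f j (tnth s j)).
    by apply: cmeasurable_tuple_prod => j; exact: cintegrable_cmeasurable (If j).
  by rewrite !big_ord0.
have mf : cmeasurable setT (fun s : k.+1.-tuple RT => \prod_j f j (tnth s j)).
  by apply: cmeasurable_tuple_prod => j; exact: cintegrable_cmeasurable (If j).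
have [Ik Ek] := IH (fun j => f (lift ord0 j)) (fun j => If _).
have E : (fun p : RT * k.-tuple RT => \prod_(j < k.+1) f j (tnth (tuple_cons p) j)) =
    (fun p => f ord0 p.1 * (\prod_(j < k) f (lift ord0 j) (tnth p.2 j))).
  apply/funext => p; rewrite big_ord_recl; congr (_ * _).
  by apply: eq_bigr => j _; rewrite tnthS.
have Ip : cintegrable (lam \x lebesgue_tuple R k)%E setT
    (fun p => f ord0 p.1 * (\prod_(j < k) f (lift ord0 j) (tnth p.2 j))).
  exact: (cintegrable_prodM (If ord0) Ik).
split; first by apply: cintegrable_tupleS => //; rewrite E.
rewrite cintegral_tupleS//; last by rewrite E.
by rewrite E (cintegral_prodM (If ord0) Ik) Ek big_ord_recl.
Qed.

End tuple_integral.

(** * Complex powers and derivatives *)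

Section complex_power.
Context {R : realType}.
Implicit Types (z w : R[i]) (r s t : R).

Lemma cexpD z w : cexp (z + w) = cexp z * cexp w.
Proof.
rewrite /cexp ReD ImD expRD cosD sinD.
by apply: complex_eqP => /=; ring.
Qed.

Lemma cexp0 : cexp (0 : R[i]) = 1.
Proof. by rewrite /cexp/= expR0 cos0 sin0 mulr1 mulr0. Qed.

Lemma normc_cexp z : normc (cexp z) = expR (Re z).
Proof.
rewrite normc_sqrt/= !exprMn -mulrDr cos2Dsin2 mulr1 sqrtr_sqr.
by rewrite ger0_norm ?expR_ge0.
Qed.

Lemma cexp_neq0 z : cexp z != 0.
Proof. by rewrite -normc_gt0 normc_cexp expR_gt0. Qed.

Lemma cexpN z : cexp (- z) = (cexp z)^-1.
Proof.
by apply: (mulfI (cexp_neq0 z)); rewrite -cexpD subrr cexp0 divff ?cexp_neq0.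
Qed.

Lemma cexp_real r : cexp r%:C = (expR r)%:C.
Proof. by rewrite /cexp/= cos0 sin0 mulr1 mulr0. Qed.

Lemma cexp_sum (I : Type) (s : seq I) (P : pred I) (F : I -> R[i]) :
  cexp (\sum_(i <- s | P i) F i) = \prod_(i <- s | P i) cexp (F i).
Proof. by apply: big_morph; [exact: cexpD|exact: cexp0]. Qed.

Lemma cexp_natM n z : cexp (n%:R * z) = cexp z ^+ n.
Proof.
elim: n => [|n IH]; first by rewrite mul0r cexp0.
by rewrite -natr1 mulrDl mul1r cexpD IH exprSr.
Qed.

Lemma clog_posreal t : 0 < t -> clog t%:C = (ln t)%:C.
Proof.
move=> t0; rewrite /clog normc_real_ge0 ?ltW//; apply: complex_eqP => //=.
by rewrite /carg (normc_real_ge0 (ltW t0)) /= lexx divff ?gt_eqF// acos1.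
Qed.

Lemma cos_atan_Re z : 0 < Re z -> Re z / normc z = cos (atan (Im z / Re z)).
Proof.
move=> z0; have nz : 0 < normc z by rewrite normc_gt0 Re_gt0_neq0.
rewrite cos_atan; apply: (canLR (mulfK _)); first by rewrite gt_eqF.
have -> : 1 + (Im z / Re z) ^+ 2 = (normc z / Re z) ^+ 2.
  by rewrite !expr_div_n normc_sqr; field; rewrite gt_eqF.
rewrite sqrtr_sqr ger0_norm ?divr_ge0 ?ltW// invf_div divfK//.
by rewrite gt_eqF.
Qed.

(** On the right half-plane the two branches in the definition of [carg] merge into one smooth
    formula, which serves to differentiate [clog] along vertical lines and to prove it measurable
    there. *)
Lemma carg_atan z : 0 < Re z -> carg z = atan (Im z / Re z).
Proof.
move=> z0; have nz : 0 < normc z by rewrite normc_gt0 Re_gt0_neq0.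
have E := cos_atan_Re z0.
rewrite /carg E; have := atan_gtNpi2 (Im z / Re z); have := atan_ltpi2 (Im z / Re z).
have pi0 := pi_ge0 R.
case: ifPn => [Iz|]; last rewrite -ltNge => Iz.
  have a0 : 0 <= atan (Im z / Re z) by rewrite -atan0 le_atan// divr_ge0// ltW.
  by move=> h1 h2; rewrite cosK// in_itv/=; apply/andP; split; lra.
have a0 : atan (Im z / Re z) <= 0 by rewrite -atan0 le_atan// nmulr_rle0// invr_ge0 ltW.
by move=> h1 h2; rewrite cosKN ?opprK//; apply/andP; split; lra.
Qed.

Lemma cexp_clog z : 0 < Re z -> cexp (clog z) = z.
Proof.
move=> z0; have nz : 0 < normc z by rewrite normc_gt0 Re_gt0_neq0.
have E := cos_atan_Re z0.
have c0 : cos (atan (Im z / Re z)) != 0 by rewrite -E mulf_neq0 ?invr_neq0// gt_eqF.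
have T : sin (atan (Im z / Re z)) = Im z / normc z.
  have := atanK (Im z / Re z); rewrite /tan => /(canRL (divfK c0)) ->.
  by rewrite -E; field; rewrite !gt_eqF.
rewrite /cexp /clog/= carg_atan// lnK// -E T.
by apply: complex_eqP => /=; field; rewrite gt_eqF.
Qed.

Lemma cpowD z w1 w2 : cpow z (w1 + w2) = cpow z w1 * cpow z w2.
Proof. by rewrite /cpow mulrDl cexpD. Qed.

Lemma cpowN z w : cpow z (- w) = (cpow z w)^-1.
Proof. by rewrite /cpow mulNr cexpN. Qed.

Lemma cpow_nat z n : 0 < Re z -> cpow z n%:R = z ^+ n.
Proof. by move=> z0; rewrite /cpow cexp_natM cexp_clog. Qed.

Lemma cpow_neq0 z w : cpow z w != 0. Proof. exact: cexp_neq0. Qed.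

Lemma cpow_real t w : 0 < t -> cpow t%:C w = cexp (w * (ln t)%:C).
Proof. by move=> t0; rewrite /cpow clog_posreal. Qed.

Lemma normc_cpow_real t w : 0 < t -> normc (cpow t%:C w) = expR (Re w * ln t).
Proof. by move=> t0; rewrite cpow_real// normc_cexp ReM/= mulr0 subr0. Qed.

Lemma cpow_realM s t w : 0 < s -> 0 < t ->
  cpow (s * t)%:C w = cpow s%:C w * cpow t%:C w.
Proof.
move=> s0 t0; rewrite !cpow_real ?mulr_gt0// lnM ?posrE// rmorphD mulrDr.
exact: cexpD.
Qed.

(** The argument contributes e^(-Im w arg z), and |arg z| < pi/2 here. The cruder factor with pi is
    enough, since all that matters is that it does not depend on [z]. *)
Lemma normc_cpow_le z w : 0 < Re z ->
  normc (cpow z w) <= expR (Re w * ln (normc z)) * expR (`|Im w| * pi).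
Proof.
move=> z0; rewrite /cpow normc_cexp ReM/= -expRD ler_expR lerD2l.
rewrite -mulrN (le_trans (ler_norm _))// normrM normrN ler_wpM2l//.
rewrite carg_atan// ler_norml.
have := atan_gtNpi2 (Im z / Re z); have := atan_ltpi2 (Im z / Re z).
by have := pi_ge0 R => ? ? ?; apply/andP; split; lra.
Qed.

End complex_power.

Section complex_derivative.
Context {R : realType}.
Implicit Types (f g : R -> R[i]) (t : R).

Lemma is_derive_funM (u v : R -> R) t du dv :
  is_derive t 1 u du -> is_derive t 1 v dv ->
  is_derive t 1 (fun s => u s * v s) (u t * dv + v t * du).
Proof. by move=> hu hv; exact: (is_deriveM (f := u) (g := v)). Qed.

Lemma is_derive_funD (u v : R -> R) t du dv :
  is_derive t 1 u du -> is_derive t 1 v dv ->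
  is_derive t 1 (fun s => u s + v s) (du + dv).
Proof. by move=> hu hv; exact: (is_deriveD (f := u) (g := v)). Qed.

(** Derivative of a complex-valued function of a real variable, by components. *)
Definition cderive f t (df : R[i]) : Prop :=
  is_derive t 1 (fun s => Re (f s)) (Re df) /\
  is_derive t 1 (fun s => Im (f s)) (Im df).

Lemma cderive_eq f t df df' : cderive f t df -> df = df' -> cderive f t df'.
Proof. by move=> + <-. Qed.

Lemma cderive_cst (c : R[i]) t : cderive (fun=> c) t 0.
Proof. by split; exact: is_derive_cst. Qed.

Lemma cderive_real (h : R -> R) t dh :
  is_derive t 1 h dh -> cderive (fun s => (h s)%:C) t dh%:C.
Proof. by move=> hd; split => //=; exact: is_derive_cst. Qed.

Lemma cderiveD f g t df dg : cderive f t df -> cderive g t dg ->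
  cderive (fun s => f s + g s) t (df + dg).
Proof.
move=> [fr fi] [gr gi]; split.
  by under eq_fun do rewrite ReD; rewrite ReD; exact: is_derive_funD.
by under eq_fun do rewrite ImD; rewrite ImD; exact: is_derive_funD.
Qed.

Lemma cderiveM f g t df dg : cderive f t df -> cderive g t dg ->
  cderive (fun s => f s * g s) t (df * g t + f t * dg).
Proof.
move=> [fr fi] [gr gi]; split.
  under eq_fun do rewrite ReM.
  by apply: is_derive_eq; rewrite ReD !ReM /GRing.scale/=; ring.
under eq_fun do rewrite ImM.
by apply: is_derive_eq; rewrite ImD !ImM /GRing.scale/=; ring.
Qed.

Lemma cderiveZ (c : R[i]) f t df : cderive f t df ->
  cderive (fun s => c * f s) t (c * df).
Proof.
by move=> fd; apply: cderive_eq (cderiveM (cderive_cst c t) fd) _; rewrite mul0r add0r.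
Qed.

Lemma cderive_cexp f t df : cderive f t df ->
  cderive (fun s => cexp (f s)) t (df * cexp (f t)).
Proof.
move=> [fr fi].
have de := is_derive1_comp (f := expR) (g := fun s => Re (f s)).
have dc := is_derive1_comp (f := cos) (g := fun s => Im (f s)).
have ds := is_derive1_comp (f := sin) (g := fun s => Im (f s)).
split => /=.
  apply: is_derive_eq (is_derive_funM (de _ _ _ _ fr) (dc _ _ _ _ fi)) _.
  by rewrite ReM /=; ring.
apply: is_derive_eq (is_derive_funM (de _ _ _ _ fr) (ds _ _ _ _ fi)) _.
by rewrite ImM /=; ring.
Qed.

Lemma cderive_id t : cderive (fun s => s%:C) t 1.
Proof. by apply: cderive_real; exact: is_derive_id. Qed.

(** Along the line, ln |z| is half of ln (sigma^2 + t^2) and the argument is atan (t / sigma); the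
    two derivatives are the components of i / z. *)
Lemma cderive_clog_line (sigma tau : R) : 0 < sigma ->
  cderive (fun t => clog (sigma +i* t)) tau ('i%C / (sigma +i* tau)).
Proof.
move=> s0.
have n0 t : 0 < sigma ^+ 2 + t ^+ 2 by rewrite ltr_wpDr ?sqr_ge0 ?exprn_gt0.
have lnE t : ln (normc (sigma +i* t)) = 2^-1 * ln (sigma ^+ 2 + t ^+ 2).
  rewrite normc_sqrt/=; have := sqr_sqrtr (ltW (n0 t)).
  set u := Num.sqrt _ => u2; have u0 : 0 < u by rewrite sqrtr_gt0.
  by rewrite -u2 lnXn// -[X in _ = _ * X]mulr_natl mulKf// pnatr_eq0.
have dsq : is_derive tau 1 (fun t : R => sigma ^+ 2 + t ^+ 2) (2 * tau).
  by apply: is_derive_eq; rewrite /GRing.scale/=; ring.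
have dln := is_derive1_ln (n0 tau).
split => /=.
  under eq_fun do rewrite lnE.
  apply: is_derive_eq (is_derive_funM (is_derive_cst (2^-1 : R) tau 1)
    (is_derive1_comp (f := @ln R) (g := fun t => sigma ^+ 2 + t ^+ 2) dln dsq)) _.
  by rewrite /=; field; rewrite gt_eqF.
under eq_fun => t do rewrite carg_atan//=.
have dq : is_derive tau 1 (fun t : R => t / sigma) sigma^-1.
  by apply: is_derive_eq; rewrite /GRing.scale/=; ring.
apply: is_derive_eq (is_derive1_comp (f := @atan R) (g := fun t => t / sigma)
  (is_derive1_atan _) dq) _.
rewrite /=.
by field; rewrite !gt_eqF.
Qed.

End complex_derivative.

(** * The Gamma integral *)

Lemma patch_pos {R : realType} (T : Type) (f g : R -> T) :
  (fun s => if s \in (`]0, +oo[%classic : set R) then f s else g s) =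
  (fun s => if 0 < s then f s else g s).
Proof.
apply/funext => s; congr (if _ then _ else _).
by apply/idP/idP; rewrite inE/= in_itv/= andbT.
Qed.

(** * The fundamental theorem of calculus on the half-line *)

Section improper_FTC.
Context {R : realType}.
Local Notation mu := (@lebesgue_measure R).
Variables (F f : R -> R).
Hypothesis dF : forall t : R, 0 < t -> is_derive t 1 F (f t).
Hypothesis cf : forall t : R, 0 < t -> {for t, continuous f}.

Let P : set R := `]0, +oo[%classic.
(** The intervals [1/(n+2), n+2] exhaust the open half-line without touching 0, so [F] and [f] may
    be singular there. The shift by 2 keeps the endpoints strictly ordered for every [n], including
    n = 0. *)
Let lo n : R := n.+2%:R^-1.
Let hi n : R := n.+2%:R.
Let I n := `[lo n, hi n]%classic.

Let lo_gt0 n : 0 < lo n. Proof. by rewrite invr_gt0. Qed.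
Let lo_lt_hi n : lo n < hi n.
Proof. by rewrite (@lt_trans _ _ 1)// ?ltr1n// invf_lt1// ltr1n. Qed.

Let I_pos n x : I n x -> 0 < x.
Proof. by rewrite /I/= in_itv/= => /andP[+ _]; apply: lt_le_trans. Qed.

Let PE x : P x = (0 < x) :> Prop.
Proof. by rewrite /P/= in_itv/= andbT. Qed.

Let eventually_I x : 0 < x -> exists N, forall n, (N <= n)%N -> I n x.
Proof.
move=> x0; exists (maxn (Num.Def.archi_bound x) (Num.Def.archi_bound x^-1)).
move=> n; rewrite geq_max => /andP[xn xVn]; rewrite /I/= in_itv/=.
have le m : (m <= n)%N -> (m%:R <= n.+2%:R :> R).
  by move=> mn; rewrite ler_nat (leq_trans mn)// -addn2 leq_addr.
apply/andP; split; last exact: le_trans (ltW (unstable.ltr_bound x)) (le _ xn).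
rewrite /lo invf_ple ?posrE//.
exact: le_trans (ltW (unstable.ltr_bound _)) (le _ xVn).
Qed.

Let I_mono m n : (m <= n)%N -> I m `<=` I n.
Proof.
move=> mn x; rewrite /I/= !in_itv/= => /andP[l h]; apply/andP; split.
  by rewrite (le_trans _ l)// lef_pV2 ?posrE// ler_nat.
by rewrite (le_trans h)// ler_nat.
Qed.

Let continuousF x : 0 < x -> {for x, continuous F}.
Proof.
move=> x0; apply/differentiable_continuous/derivable1_diffP.
by have := dF x0; case.
Qed.

Let FTC_I n : (\int[mu]_(x in I n) (f x)%:E = (F (hi n) - F (lo n))%:E)%E.
Proof.
rewrite EFinB; apply: (continuous_FTC2 (lo_lt_hi n)) => //.
- apply: continuous_in_subspaceT => x; rewrite inE => Ix.
  exact/cf/(@I_pos n).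
- split.
  + move=> x; rewrite in_itv/= => /andP[lx _]; have := dF (lt_trans (lo_gt0 n) lx).
    by case.
  + exact/cvg_at_right_filter/continuousF.
  + by apply/cvg_at_left_filter/continuousF; rewrite (lt_trans (lo_gt0 n)).
- move=> x; rewrite in_itv/= => /andP[lx _].
  by rewrite derive1E; have := dF (lt_trans (lo_gt0 n) lx); case.
Qed.

Let mf : measurable_fun P f.
Proof.
apply: open_continuous_measurable_fun; first exact: interval_open.
by move=> x; rewrite inE PE; exact: cf.
Qed.

Let mG : measurable_fun setT (EFin \o (f \_ P)).
Proof.
apply/measurable_EFinP; apply/(measurable_restrictT f) => //.
exact: measurable_itv.
Qed.

Let mGn n : measurable_fun setT (EFin \o (f \_ (I n))).
Proof.
apply/measurable_EFinP; apply/(measurable_restrictT f) => //.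
  exact: measurable_itv.
apply: (@measurable_funS _ _ _ _ P); last exact: mf.
  exact: measurable_itv.
by move=> x /I_pos; rewrite PE.
Qed.

Let int_Gn n : (\int[mu]_x (EFin \o (f \_ (I n))) x = (F (hi n) - F (lo n))%:E)%E.
Proof.
rewrite -FTC_I [RHS]integral_mkcond; apply: eq_integral => x _.
by rewrite restrict_EFin.
Qed.

Let cvgGn x : (EFin \o (f \_ (I n))) x @[n --> \oo] --> (EFin \o (f \_ P)) x.
Proof.
apply: cvg_near_cst; have [x0|x0] := ltP 0 x.
  have [N HN] := eventually_I x0; exists N => // n /= Nn.
  rewrite !patchE mem_set; last exact: HN.
  by rewrite mem_set// PE.
apply: nearW => n /=; rewrite !patchE !memNset//.
  by rewrite PE; apply/negP; rewrite -leNgt.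
by move/I_pos; apply/negP; rewrite -leNgt.
Qed.

(** Monotone convergence along the exhausting intervals, on each of which the integral is an
    increment of [F], hence at most 2M. A nonnegative function with a bounded primitive is thus
    integrable. *)
Lemma integrable_improper_FTC (M : R) : (forall t, 0 < t -> 0 <= f t) ->
  (forall t, 0 < t -> `|F t| <= M) ->
  mu.-integrable setT (EFin \o (fun s => if 0 < s then f s else 0)).
Proof.
move=> f0 FM; rewrite -patch_pos.
have G0 x : 0 <= (f \_ P) x.
  by rewrite patchE; case: ifPn => //; rewrite inE PE => /f0.
have Gn0 n x : 0 <= (f \_ (I n)) x.
  by rewrite patchE; case: ifPn => //; rewrite inE => /I_pos/f0.
apply/integrableP; split; first exact: mG.
have -> : (\int[mu]_x `|(EFin \o (f \_ P)) x| =
           \int[mu]_x limn (fun n => (EFin \o (f \_ (I n))) x))%E.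
  apply: eq_integral => x _; rewrite gee0_abs ?lee_fin//.
  by apply/esym/cvg_lim => //; exact: cvgGn.
have C := @cvg_monotone_convergence _ _ _ mu setT measurableT
  (fun n => EFin \o (f \_ (I n))).
have {}C : (\int[mu]_x (EFin \o (f \_ (I n))) x @[n --> \oo] -->
    \int[mu]_x limn (fun n => (EFin \o (f \_ (I n))) x))%E.
  apply: C => // [n x _|x _ m n mn]; first by rewrite lee_fin.
  rewrite lee_fin !patchE; case: ifPn => [/[!inE] Im|_].
    by rewrite mem_set//; exact: I_mono Im.
  by case: ifPn => // /[!inE] /I_pos/f0.
rewrite -(cvg_lim _ C)//; apply: le_lt_trans (ltry (M + M)).
apply: lime_le; first by apply/cvg_ex; eexists; exact: C.
apply: nearW => n; rewrite int_Gn lee_fin (le_trans (ler_norm _))//.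
rewrite (le_trans (ler_normB _ _))// lerD// FM//.
Qed.

(** The truncations of [f] are dominated by |f| itself, so their integrals, which are increments of
    [F], converge to the full integral. *)
Lemma Rintegral_improper_FTC (l0 l1 : R) :
  mu.-integrable setT (EFin \o (fun s => if 0 < s then f s else 0)) ->
  F (n.+2%:R^-1) @[n --> \oo] --> l0 -> F n.+2%:R @[n --> \oo] --> l1 ->
  \int[mu]_s (if 0 < s then f s else 0) = l1 - l0.
Proof.
rewrite -patch_pos => IG c0 c1.
have [|||||_ _ cvg] := @dominated_convergence _ _ _ mu setT measurableT
   (fun n => EFin \o (f \_ (I n))) (EFin \o (f \_ P))
   (fun x => `|(EFin \o (f \_ P)) x|)%E.
- exact: mGn.
- exact: mG.
- by apply: aeW => x _; exact: cvgGn.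
- exact: integrable_abse.
- apply: aeW => x n _ /=; rewrite lee_fin !patchE; case: ifPn => [/[!inE] /I_pos x0|_].
    by rewrite mem_set// PE.
  by rewrite normr0.
move: cvg; rewrite (_ : (fun n => _) = (fun n => (F (hi n) - F (lo n))%:E)); last first.
  by apply/funext => n; exact: int_Gn.
move=> cvg.
have /cvg_lim E : (fun n => (F (hi n) - F (lo n))%:E) @ \oo --> (l1 - l0)%:E.
  by apply: cvg_EFin; [exact: nearW|exact: cvgB].
have := cvg_lim _ cvg; rewrite E//.
by rewrite /Rintegral => <-.
Qed.

End improper_FTC.

Section complex_FTC.
Context {R : realType}.
Local Notation mu := (@lebesgue_measure R).

Lemma cvg_normc_ReIm (u : nat -> R[i]) (l : R[i]) :
  normc (u n - l) @[n --> \oo] --> (0 : R) ->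
  Re (u n) @[n --> \oo] --> Re l /\ Im (u n) @[n --> \oo] --> Im l.
Proof.
move=> h; split; apply/subr_cvg0; apply: norm_cvg0;
  apply: (squeeze_cvgr _ (cvg_cst 0) h); apply: nearW => n;
  rewrite normr_ge0/=.
  by rewrite -ReN -ReD le_Re_normc.
by rewrite -ImN -ImD le_Im_normc.
Qed.

Lemma cderive_continuous (f : R -> R[i]) t df : cderive f t df ->
  {for t, continuous (fun s => Re (f s))} /\
  {for t, continuous (fun s => Im (f s))}.
Proof.
by move=> [[fr _] [fi _]]; split; apply/differentiable_continuous/derivable1_diffP.
Qed.

(** The derivative [g] of the integrand supplies the continuity of [f] that the real statement asks
    for. *)
Lemma cintegral_improper_FTC (F f g : R -> R[i]) (l0 l1 : R[i]) :
  (forall t : R, 0 < t -> cderive F t (f t)) ->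
  (forall t : R, 0 < t -> cderive f t (g t)) ->
  cintegrable mu setT (fun s => if 0 < s then f s else 0) ->
  normc (F (n.+2%:R^-1) - l0) @[n --> \oo] --> (0 : R) ->
  normc (F n.+2%:R - l1) @[n --> \oo] --> (0 : R) ->
  cintegral mu setT (fun s => if 0 < s then f s else 0) = l1 - l0.
Proof.
move=> dF df [Ir Ii] /cvg_normc_ReIm[c0r c0i] /cvg_normc_ReIm[c1r c1i].
have Er : (fun s => Re (if 0 < s then f s else 0)) =
    (fun s => if 0 < s then Re (f s) else 0).
  by apply/funext => s; case: ifP.
have Ei : (fun s => Im (if 0 < s then f s else 0)) =
    (fun s => if 0 < s then Im (f s) else 0).
  by apply/funext => s; case: ifP.
apply: complex_eqP; rewrite ?ReD ?ImD ?ReN ?ImN/=.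
  rewrite Er; apply: (@Rintegral_improper_FTC _ (fun s => Re (F s)) (fun s => Re (f s))) => //.
  - by move=> t /dF [].
  - by move=> t t0; have [] := cderive_continuous (df _ t0).
  - by apply: eq_integrable Ir => // s _ /=; case: ifP.
rewrite Ei; apply: (@Rintegral_improper_FTC _ (fun s => Im (F s)) (fun s => Im (f s))) => //.
- by move=> t /dF [].
- by move=> t t0; have [] := cderive_continuous (df _ t0).
- by apply: eq_integrable Ii => // s _ /=; case: ifP.
Qed.

End complex_FTC.

(** * Powers on the half-line and their Laplace integrands *)

Section power_kernel.
Context {R : realType}.
Local Notation mu := (@lebesgue_measure R).
Local Notation RT := (measurableTypeR R).
Implicit Types (al z : R[i]) (s t : R).

(* Extended by 0 to s <= 0, so that Beta and Dirichlet integrals become convolutions on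
   the whole line, without constraints on the domain. *)
Definition qpow al s : R[i] := if 0 < s then cpow s%:C (al - 1) else 0.

(** Integrand of the Laplace transform of s^(al-1) at the point [z]; at z = 1 it is the integrand of
    Gamma. *)
Definition gam al z s : R[i] := qpow al s * cexp (- (s%:C * z)).

Lemma qpowE al s : 0 < s -> qpow al s = cexp ((al - 1) * (ln s)%:C).
Proof. by move=> s0; rewrite /qpow s0 cpow_real. Qed.

Lemma qpow_le0 al s : s <= 0 -> qpow al s = 0.
Proof. by move=> s0; rewrite /qpow ltNge s0. Qed.

Lemma qpow_cexpE al : qpow al =
  (fun s => if 0 < s then cexp ((al - 1) * (ln s)%:C) else 0).
Proof.
by apply/funext => s; case: ifPn => [/qpowE//|]; rewrite -leNgt => /qpow_le0.
Qed.

Lemma measurable_gt0 : measurable_fun setT (fun s : RT => 0 < s).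
Proof. exact: measurable_fun_ltr. Qed.

Lemma cmeasurable_qpow al : cmeasurable setT (qpow al : RT -> R[i]).
Proof.
rewrite qpow_cexpE; apply: cmeasurable_if.
- exact: measurable_gt0.
- apply: measurable_cexp; apply: cmeasurableM; first exact: cmeasurable_cst.
  exact: cmeasurable_real.
- exact: cmeasurable_cst.
Qed.

Lemma cmeasurable_gam al z : cmeasurable setT (gam al z : RT -> R[i]).
Proof.
apply: cmeasurableM; first exact: cmeasurable_qpow.
apply: measurable_cexp; apply: cmeasurableN; apply: cmeasurableM.
  exact: cmeasurable_real.
exact: cmeasurable_cst.
Qed.

Lemma normc_qpow al s : normc (qpow al s) =
  if 0 < s then expR ((Re al - 1) * ln s) else 0.
Proof.
rewrite /qpow; case: ifPn => s0; last exact: Normc.normc0.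
by rewrite normc_cpow_real// ReD ReN.
Qed.

Lemma normc_gam al z s : normc (gam al z s) =
  if 0 < s then expR ((Re al - 1) * ln s - s * Re z) else 0.
Proof.
rewrite /gam Normc.normcM normc_qpow normc_cexp ReN ReM/= mul0r subr0.
by case: ifPn => _; rewrite ?mul0r// expRD.
Qed.

Lemma gamE al z s : 0 < s ->
  gam al z s = cexp ((al - 1) * (ln s)%:C - s%:C * z).
Proof. by move=> s0; rewrite /gam qpowE// -cexpD. Qed.

Lemma gam_le0 al z s : s <= 0 -> gam al z s = 0.
Proof. by move=> s0; rewrite /gam qpow_le0// mul0r. Qed.

Lemma qpow_real (a : R) s : qpow a%:C s = (normc (qpow a%:C s))%:C.
Proof.
rewrite normc_qpow qpow_cexpE; case: ifPn => // s0.
by rewrite -[1]/(1%:C) -rmorphB -rmorphM cexp_real.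
Qed.

Lemma normc_qpow_Re al s : normc (qpow al s) = normc (qpow (Re al)%:C s).
Proof. by rewrite !normc_qpow. Qed.

Lemma qpowDn al n s : qpow (al + n%:R) s = s%:C ^+ n * qpow al s.
Proof.
have [s0|s0] := ltP 0 s; last by rewrite !qpow_le0// mulr0.
rewrite /qpow s0 (_ : al + n%:R - 1 = n%:R + (al - 1)); last by ring.
by rewrite [LHS]cpowD cpow_nat.
Qed.

Lemma qpow_scale al s t : 0 < s ->
  qpow al (s * t) = cpow s%:C (al - 1) * qpow al t.
Proof.
move=> s0; rewrite /qpow pmulr_rgt0//; case: ifPn => t0; last by rewrite mulr0.
exact: cpow_realM.
Qed.

(** From ln y <= y - 1 at y = (1 + s) / K. The scale K = a / sigma makes the slope in [s] exactly
    [sigma]. *)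
Lemma ln_le_linear (a sigma : R) : 0 < a -> 0 < sigma ->
  exists C, forall s, 0 < s -> a * ln (1 + s) <= sigma * s + C.
Proof.
move=> a0 s0; pose K := a / sigma; have K0 : 0 < K by rewrite divr_gt0.
exists (sigma - a + a * ln K) => s sp.
have h : ln ((1 + s) / K) <= (1 + s) / K - 1.
  have := @le_ln1Dx R ((1 + s) / K - 1); rewrite [X in ln X]addrC subrK; apply.
  by rewrite ltrBrDr addNr divr_gt0// addr_gt0.
rewrite lnM ?posrE ?invr_gt0 ?addr_gt0// lnV ?posrE// in h.
have E : a * ((1 + s) / K - 1) = sigma + sigma * s - a.
  by rewrite /K; field; rewrite !gt_eqF.
have := ler_wpM2l (ltW a0) h; rewrite E; lra.
Qed.

(** The function s^p (1+s)^q, against which Gamma integrands are compared. *)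
Let ref (p q s : R) := expR (p * ln s + q * ln (1 + s)).

Let dref p q s : 0 < s ->
  is_derive s 1 (ref p q) (ref p q s * (p / s + q / (1 + s))).
Proof.
move=> s0; have s1 : 0 < 1 + s by rewrite addr_gt0.
have d0 := is_derive1_ln s0.
have h1 : is_derive s 1 (fun s : R => 1 + s) 1.
  by apply: is_derive_eq (is_derive_funD (is_derive_cst (1 : R) s 1) (is_derive_id s 1)) _; rewrite add0r.
have d1 := is_derive1_comp (f := @ln R) (g := fun s => 1 + s) (is_derive1_ln s1) h1.
have d2 := is_derive_funD (is_derive_funM (is_derive_cst p s 1) d0)
  (is_derive_funM (is_derive_cst q s 1) d1).
apply: is_derive_eq (is_derive1_comp (f := expR)
  (g := fun s => p * ln s + q * ln (1 + s)) (is_derive_expR _) d2) _.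
by rewrite /ref /=; field; rewrite !gt_eqF.
Qed.

(** The function s^(a-1) (1+s)^(-a-1) is the derivative of (s / (1+s))^a / a, which stays between 0
    and 1/a. *)
Let integrable_ref (a : R) : 0 < a ->
  mu.-integrable setT (EFin \o (fun s => if 0 < s then ref (a - 1) (- (a + 1)) s else 0)).
Proof.
move=> a0.
pose F (s : R) := ref a (- a) s * a^-1.
have dF (s : R) : 0 < s -> is_derive s 1 F (ref (a - 1) (- (a + 1)) s).
  move=> s0; have s1 : 0 < 1 + s by rewrite addr_gt0.
  apply: is_derive_eq (is_derive_funM (dref a (- a) s0) (is_derive_cst a^-1 s 1)) _.
  have -> : ref (a - 1) (- (a + 1)) s = ref a (- a) s * (s^-1 * (1 + s)^-1).
    have -> : s^-1 = expR (- ln s) by rewrite expRN lnK.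
    have -> : (1 + s)^-1 = expR (- ln (1 + s)) by rewrite expRN lnK.
    by rewrite /ref -!expRD; congr expR; ring.
  by rewrite /=; field; rewrite !gt_eqF.
apply: (@integrable_improper_FTC _ F _ dF _ a^-1) => t t0.
- apply/differentiable_continuous/derivable1_diffP.
  by have [] := dref (a - 1) (- (a + 1)) t0.
- exact: expR_ge0.
- have aV : 0 <= a^-1 by rewrite invr_ge0 ltW.
  rewrite ger0_norm ?mulr_ge0 ?expR_ge0// /F ler_piMl//.
  rewrite /ref -[leRHS]expR0 ler_expR mulNr subr_le0 ler_wpM2l ?(ltW a0)//.
  by apply: ltW; rewrite ltr_ln ?posrE ?addr_gt0// ltrDr.
Qed.

(** By [ln_le_linear], e^(-s Re z) is at most e^C (1+s)^(-Re al - 1), which turns the modulus into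
    the comparison function with an explicit primitive. *)
Lemma cintegrable_gam al z : 0 < Re al -> 0 < Re z -> cintegrable mu setT (gam al z).
Proof.
move=> al0 z0; have a1 : 0 < Re al + 1 by rewrite addr_gt0.
have [C hC] := ln_le_linear a1 z0.
apply: (@le_cintegrable _ _ _ mu setT _ (fun s => expR C *
   (if 0 < s then ref (Re al - 1) (- (Re al + 1)) s else 0))) => //.
- exact: cmeasurable_gam.
- move=> s _; rewrite normc_gam; case: ifPn => s0; last by rewrite mulr0.
  rewrite /ref -expRD ler_expR; have := hC s s0; lra.
- exact: (integrableZl measurableT _ (integrable_ref al0)).
Qed.

End power_kernel.

Section under_integral.
Context d (Y : measurableType d) {R : realType}.
Variable mu : {measure set Y -> \bar R}.

Lemma cderive_under_integral (f f' : R -> Y -> R[i]) (G : Y -> R) (u v a : R) :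
  u < a < v ->
  (forall x, u < x < v -> cintegrable mu setT (f x)) ->
  (forall x y, u < x < v -> cderive (f ^~ y) x (f' x y)) ->
  (forall x y, u < x < v -> normc (f' x y) <= G y) ->
  (forall y, 0 <= G y) ->
  mu.-integrable setT (EFin \o G) ->
  cderive (fun x => cintegral mu setT (f x)) a (cintegral mu setT (f' a)).
Proof.
move=> uav If df f'G G0 IG.
have key (h : R[i] -> R) : (forall z, `|h z| <= normc z) ->
    (forall x, u < x < v -> mu.-integrable setT (EFin \o (fun y => h (f x y)))) ->
    (forall x y, u < x < v -> is_derive x 1 (fun x => h (f x y)) (h (f' x y))) ->
    is_derive a 1 (fun x => \int[mu]_(y in setT) h (f x y))
      (\int[mu]_(y in setT) h (f' a y)).
  move=> hle hI hd.
  have H x : (`]u, v[%classic : set R) x -> u < x < v by rewrite /= in_itv.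
  have Ia : (`]u, v[%classic : set R) a by rewrite /= in_itv.
  have d1E x y : (`]u, v[%classic : set R) x ->
      partial1of2 (fun x y => h (f x y)) x y = h (f' x y).
    by move=> /H xuv; rewrite partial1of2E; have [] := hd x y xuv.
  have der x y : (`]u, v[%classic : set R) x -> setT y -> derivable (fun x => h (f x y)) x 1.
    by move=> /H xuv _; have [] := hd x y xuv.
  have ub x y : (`]u, v[%classic : set R) x -> setT y ->
      `|partial1of2 (fun x y => h (f x y)) x y| <= G y.
    by move=> xI _; rewrite d1E// (le_trans (hle _))// f'G//; exact: H.
  apply: DeriveDef.
    exact: (derivable_under_integral measurableT Ia (fun x xI => hI x (H x xI)) der G0 IG ub).
  rewrite -derive1E.
  rewrite (differentiation_under_integral measurableT Ia (fun x xI => hI x (H x xI)) der G0 IG ub).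
  by apply: eq_Rintegral => y _; rewrite d1E.
split => /=.
  apply: (key Re) => [z|x /If[]//|x y /df-/(_ y)[]//]; exact: le_Re_normc.
apply: (key Im) => [z|x /If[]//|x y /df-/(_ y)[]//]; exact: le_Im_normc.
Qed.

Lemma cderive0_cst (f : R -> R[i]) (s t : R) : (forall x, cderive f x 0) -> f s = f t.
Proof.
move=> df; apply: complex_eqP.
  by apply: (is_derive_0_is_cst (f := fun s => Re (f s))) => x; case: (df x).
by apply: (is_derive_0_is_cst (f := fun s => Im (f s))) => x; case: (df x).
Qed.

End under_integral.

Section gamma_integral.
Context {R : realType}.
Local Notation mu := (@lebesgue_measure R).
Implicit Types (al z : R[i]) (s t : R).

Definition Gint al z : R[i] := cintegral mu setT (gam al z).

Lemma cGammaE al : cGamma al = Gint al 1.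
Proof.
rewrite /cGamma cintegral_mkcond /Gint; congr cintegral.
rewrite patch_pos; apply/funext => s; rewrite /gam /qpow; case: ifPn => // _.
  by rewrite -cexp_real rmorphN mulr1.
by rewrite mul0r.
Qed.

(** This is (n+2)^-a -> 0; the threshold in the proof is the number [e] raised to the power -1/a. *)
Lemma cvg_expRN_ln (a : R) : 0 < a -> expR (- (a * ln n.+2%:R)) @[n --> \oo] --> (0 : R).
Proof.
move=> a0; apply/cvgrPdist_le => /= e e0.
exists (Num.Def.archi_bound (expR (- ln e / a))) => // n /= Nn.
rewrite sub0r normrN ger0_norm ?expR_ge0// -[leRHS]lnK ?posrE// ler_expR.
rewrite lerNl -ler_pdivrMl// mulrC -[leLHS]expRK ler_ln ?posrE ?expR_gt0//.
apply: le_trans (ltW (unstable.ltr_bound _)) _.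
by rewrite ler_nat (leq_trans Nn)// -addn2 leq_addr.
Qed.

Lemma cderive_powexp (be z : R[i]) s : 0 < s ->
  cderive (fun s => cexp (be * (ln s)%:C - s%:C * z)) s
    ((be / s%:C - z) * cexp (be * (ln s)%:C - s%:C * z)).
Proof.
move=> s0; apply: cderive_cexp.
have dl := cderiveZ be (cderive_real (is_derive1_ln s0)).
have di := cderiveZ (- z) (cderive_id s).
have := cderiveD dl di.
rewrite fmorphV mulr1 (_ : (fun x => _) = (fun x => be * (ln x)%:C - x%:C * z))//.
by apply/funext => x; rewrite mulNr (mulrC z).
Qed.

(** Integration by parts: the left-hand side is the integral of the derivative of s^al e^(-sz),
    which vanishes at both ends because Re al > 0 and Re z > 0. *)
Lemma Gint_step al z : 0 < Re al -> 0 < Re z ->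
  al * Gint al z - z * Gint (al + 1) z = 0.
Proof.
move=> al0 z0; have al1 : 0 < Re (al + 1) by rewrite ReD addr_gt0.
have I0 := cintegrable_gam al0 z0; have I1 := cintegrable_gam al1 z0.
pose pe (be : R[i]) s := cexp (be * (ln s)%:C - s%:C * z).
have E : (fun s => if 0 < s then al * pe (al - 1) s + (- z) * pe al s else 0) =
    (fun s => al * gam al z s + (- z) * gam (al + 1) z s).
  apply/funext => s; case: ifPn => s0; first by rewrite !gamE// addrK.
  by rewrite !gam_le0 ?mulr0 ?addr0// leNgt.
rewrite -mulNr -!cintegralZl// -cintegralD//; try exact: cintegrableZl.
rewrite -E -[RHS](subrr 0).
have dpe be s : 0 < s -> cderive (pe be) s ((be / s%:C - z) * pe be s).
  exact: cderive_powexp.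
apply: (@cintegral_improper_FTC _ (pe al) _ (fun s =>
  al * (((al - 1) / s%:C - z) * pe (al - 1) s) + (- z) * ((al / s%:C - z) * pe al s))).
- move=> s s0; apply: cderive_eq (dpe _ _ s0) _.
  have -> : pe al s = s%:C * pe (al - 1) s.
    have sE : s%:C = cexp (ln s)%:C by rewrite cexp_real lnK.
    by rewrite /pe [X in _ = X * _]sE -cexpD; congr cexp; ring.
  have sC : s%:C != 0 :> R[i] by rewrite (fmorph_eq0 (real_complex R)) gt_eqF.
  by field.
- by move=> s s0; apply: cderiveD; apply: cderiveZ; exact: dpe.
- by rewrite E; apply: cintegrableD => //; exact: cintegrableZl.
- apply: (squeeze_cvgr _ (cvg_cst 0) (cvg_expRN_ln al0)); apply: nearW => n.
  apply/andP; split; first exact: normc_ge0.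
  rewrite subr0 /pe normc_cexp ler_expR ReD ReN !ReM/= mulr0 mul0r !subr0.
  by rewrite lnV ?posrE// mulrN lerBlDr lerDl mulr_ge0 ?invr_ge0 ?ltW.
(* Half of the decay rate Re z absorbs the power s^al; the other half, with ln s <= s, leaves a
   negative power of s = n+2. *)
- have [C hC] := ln_le_linear al0 (divr_gt0 z0 (ltr0n R 2)).
  have z2 : 0 < Re z / 2 by rewrite divr_gt0.
  have h : expR C * expR (- (Re z / 2 * ln n.+2%:R)) @[n --> \oo] --> (0 : R).
    rewrite -(mulr0 (expR C)); apply: cvgM; first exact: cvg_cst.
    exact: cvg_expRN_ln.
  apply: (squeeze_cvgr _ (cvg_cst 0) h); apply: nearW => n.
  apply/andP; split; first exact: normc_ge0.
  rewrite subr0 /pe normc_cexp -expRD ler_expR ReD ReN !ReM/= mulr0 mul0r !subr0.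
  have n0 : (0 : R) < n.+2%:R by [].
  have := hC _ n0.
  have : ln n.+2%:R <= n.+2%:R :> R by rewrite ltW// ln_sublinear.
  move=> /(ler_wpM2l (ltW z2)).
  have : Re al * ln n.+2%:R <= Re al * ln (1 + n.+2%:R).
    by rewrite ler_wpM2l ?(ltW al0)// ler_ln ?posrE// lerDr.
  lra.
Qed.

End gamma_integral.

Section gamma_laplace.
Context {R : realType}.
Local Notation mu := (@lebesgue_measure R).
Implicit Types (al z : R[i]) (s t : R).

Lemma Gint_scale al z s : 0 < s -> 0 < Re al -> 0 < Re z ->
  Gint al z = cpow s%:C al * Gint al (s%:C * z).
Proof.
move=> s0 al0 z0.
have z1 : 0 < Re (s%:C * z) by rewrite ReM/= mul0r subr0 mulr_gt0.
rewrite /Gint (cintegral_affine 0 (lt0r_neq0 s0) (cintegrable_gam al0 z0)).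
rewrite (_ : (fun x => _) = fun x => cpow s%:C (al - 1) * gam al (s%:C * z) x); last first.
  apply/funext => x; rewrite addr0 /gam qpow_scale// rmorphM -mulrA.
  by congr (_ * (_ * cexp (- _))); ring.
rewrite cintegralZl//; last exact: cintegrable_gam.
rewrite mulrA gtr0_norm//; congr (_ * _).
have c1 : cpow s%:C 1 = s%:C by rewrite -[1]/(1%:R) cpow_nat.
by rewrite -[X in X * _]c1 -cpowD addrC subrK.
Qed.

(* By Gint_step, the derivative of z^al * Gint al z along the line vanishes. *)
Lemma Gint_line al (sigma tau : R) : 0 < Re al -> 0 < sigma ->
  cpow (sigma +i* tau) al * Gint al (sigma +i* tau) =
  cpow sigma%:C al * Gint al sigma%:C.
Proof.
move=> al0 s0; have al1 : 0 < Re (al + 1) by rewrite ReD addr_gt0.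
pose z (t : R) : R[i] := sigma +i* t.
have z0 t : 0 < Re (z t) by [].
pose f t s := cpow (z t) al * gam al (z t) s.
pose f' t s := 'i%C / z t * cpow (z t) al *
  (al * gam al (z t) s + (- z t) * gam (al + 1) (z t) s).
suff d0 t : cderive (fun t => cintegral mu setT (f t)) t 0.
  have := cderive0_cst tau 0 d0.
  by rewrite /f !cintegralZl//; exact: cintegrable_gam.
have -> : 0 = cintegral mu setT (f' t).
  rewrite /f' cintegralZl//; last first.
    by apply: cintegrableD => //; apply: cintegrableZl => //; exact: cintegrable_gam.
  rewrite cintegralD//; [|by apply: cintegrableZl => //; exact: cintegrable_gam..].
  rewrite !cintegralZl//; try exact: cintegrable_gam.
  by rewrite mulNr Gint_step// mulr0.
(* For t-1 < x < t+1 one has sigma <= |z x| <= M. This bounds 1/z by sigma^-1, z^al by [K] and the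
   factor z by [M]; the moduli of [gam] depend only on Re z = sigma. Hence the dominating function
   [G]. *)
pose M := sigma + `|t| + 1.
have M0 : 0 < M by rewrite ltr_wpDl// addr_ge0// ltW.
pose K := expR (Re al * ln M) * expR (`|Im al| * pi).
pose G s := sigma^-1 * K * (normc al * normc (gam al sigma%:C s) +
  M * normc (gam (al + 1) sigma%:C s)).
apply: (@cderive_under_integral _ _ _ mu f f' G (t - 1) (t + 1)).
- by rewrite gtrBl ltrDl ltr01.
- by move=> x _; apply: cintegrableZl => //; exact: cintegrable_gam.
- move=> x s _; rewrite /f /f'; have [s1|s1] := ltP 0 s; last first.
    rewrite (_ : (fun _ => _) = fun=> 0); last first.
      by apply/funext => y; rewrite gam_le0// mulr0.
    by rewrite !gam_le0// !mulr0 addr0 mulr0; exact: cderive_cst.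
  have E : (fun x => cpow (z x) al * gam al (z x) s) =
      (fun x => cexp (al * clog (z x) + ((al - 1) * (ln s)%:C + (- s%:C) * z x))).
    apply/funext => y; rewrite gamE// /cpow -cexpD; congr cexp.
    by rewrite mulNr.
  rewrite E.
  have dz : cderive z x 'i%C.
    split => /=; first exact: is_derive_cst.
    exact: is_derive_id.
  have dl := cderiveZ al (cderive_clog_line x s0).
  have d2 := cderiveD (cderive_cst ((al - 1) * (ln s)%:C) x) (cderiveZ (- s%:C) dz).
  apply: cderive_eq (cderive_cexp (cderiveD dl d2)) _.
  have := congr1 (fun f => f x) E => /= <-.
  rewrite -/(z x) (_ : gam (al + 1) (z x) s = s%:C * gam al (z x) s); last first.
    by rewrite /gam -[1]/(1%:R) qpowDn expr1 mulrA.
  by field; rewrite Re_gt0_neq0.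
- move=> x s /andP[x1 x2]; rewrite /f' (Normc.normcM (_ * _)) (Normc.normcM (_ / _)) Normc.normcM Normc.normcV.
  have zM : normc (z x) <= M.
    apply: le_trans (normc_le_ReIm _) _ => /=; rewrite gtr0_norm// /M -addrA lerD2l.
    have := ler_norm t; have := ler_norm (- t); rewrite normrN => h1 h2.
    by rewrite ler_norml; apply/andP; split; lra.
  have zs : sigma <= normc (z x).
    by apply: le_trans (le_Re_normc _); rewrite /= ler_norm.
  have zp : 0 < normc (z x) by exact: lt_le_trans zs.
  have i1 : normc 'i%C = 1 :> R by rewrite normc_sqrt/= expr0n expr1n/= add0r sqrtr1.
  rewrite i1 mul1r; apply: ler_pM; rewrite ?mulr_ge0 ?invr_ge0 ?normc_ge0//.
    apply: ler_pM; rewrite ?invr_ge0 ?normc_ge0// ?lef_pV2 ?posrE//.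
    apply: le_trans (normc_cpow_le _ _) _ => //.
    rewrite ler_wpM2r ?expR_ge0// ler_expR ler_wpM2l ?(ltW al0)//.
    by rewrite ler_ln ?posrE.
  apply: le_trans (le_normcD _ _) _; rewrite (Normc.normcM al) (Normc.normcM (- z x)) normcN.
  rewrite !normc_gam/= lerD2l ler_wpM2r//.
  by case: ifP => // _; exact: expR_ge0.
- move=> s; rewrite /G !mulr_ge0 ?addr_ge0 ?mulr_ge0 ?expR_ge0 ?invr_ge0 ?normc_ge0//; exact: ltW.
- rewrite /G; have I0 := cintegrable_normc measurableT (cintegrable_gam al0 (z0 0)).
  have I1 := cintegrable_normc measurableT (cintegrable_gam al1 (z0 0)).
  have I2 := integrableD measurableT (integrableZl measurableT (normc al) I0)
    (integrableZl measurableT M I1).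
  exact: (integrableZl measurableT (sigma^-1 * K) I2).
Qed.

(** [Gint_line] moves [z] to its real part, and a real scaling of the variable moves that to 1. *)
Lemma GintE al z : 0 < Re al -> 0 < Re z -> Gint al z = cGamma al * cpow z (- al).
Proof.
case: z => sigma tau al0 /= s0; rewrite cGammaE.
have := Gint_line tau al0 s0; rewrite (@Gint_scale al 1 sigma)// mulr1 => <-.
by rewrite cpowN mulrAC mulfV ?mul1r// cpow_neq0.
Qed.

Lemma cGammaS al : 0 < Re al -> cGamma (al + 1) = al * cGamma al.
Proof.
move=> al0; rewrite !cGammaE; have := @Gint_step R al 1 al0 ltr01.
by rewrite mul1r => /eqP; rewrite subr_eq0 => /eqP.
Qed.

Lemma cGamma_poch al n : 0 < Re al -> cGamma (al + n%:R) = poch al n * cGamma al.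
Proof.
move=> al0; elim: n => [|n IH]; first by rewrite addr0 /poch big_ord0 mul1r.
rewrite -natr1 addrA cGammaS; last by rewrite ReD Re_nat ltr_wpDr.
by rewrite IH /poch big_ord_recr/= mulrA [X in X * _]mulrC.
Qed.

End gamma_laplace.

(** * Laplace inversion on a vertical line *)

Lemma cvg_ReIm_normc {R : realType} (u : nat -> R[i]) (l : R[i]) :
  Re (u n) @[n --> \oo] --> Re l /\ Im (u n) @[n --> \oo] --> Im l ->
  normc (u n - l) @[n --> \oo] --> (0 : R).
Proof.
move=> [/subr_cvg0/cvg_norm cr /subr_cvg0/cvg_norm ci].
have h : `|Re (u n) - Re l| + `|Im (u n) - Im l| @[n --> \oo] --> (0 : R).
  by rewrite normr0 in cr ci; rewrite -(addr0 (0 : R)); exact: cvgD.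
apply: (squeeze_cvgr _ (cvg_cst 0) h); apply: nearW => n.
rewrite normc_ge0/= (le_trans (normc_le_ReIm _))//.
by rewrite ReD ReN ImD ImN.
Qed.

Section half_lines.
Context {R : realType}.
Local Notation mu := (@lebesgue_measure R).
Local Notation RT := (measurableTypeR R).

Lemma ae_off_point (a : R) (P : R -> Prop) :
  (forall x, x != a -> P x) -> {ae mu, forall x, P x}.
Proof.
move=> aP; exists [set a]; split; [exact: measurable_set1|exact: lebesgue_measure_set1|].
by move=> x /= nPx; apply: contrapT => /eqP /aP.
Qed.

Variable g : R -> R[i].
Hypothesis mg : cmeasurable setT (g : RT -> R[i]).
Let gp s := if 0 < s then g s else 0.
Let gm s := if 0 < s then g (- s) else 0.
Hypotheses (Ip : cintegrable mu setT gp) (Im : cintegrable mu setT gm).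

Let gE : {ae mu, forall x, setT x -> g x = gp x + gm (-1 * x + 0)}.
Proof.
apply: (ae_off_point (a := 0)) => x x0 _.
rewrite /gp /gm mulN1r addr0 opprK oppr_gt0.
by have [x1|x1|x1] := ltgtP x 0; rewrite ?addr0 ?add0r//; rewrite x1 eqxx in x0.
Qed.

Let N1 : -1 != 0 :> R. Proof. by rewrite oppr_eq0 oner_eq0. Qed.
Let Im' := cintegrable_affine 0 N1 Im.
Let Is : cintegrable mu setT (fun x => gp x + gm (-1 * x + 0)).
Proof. exact: cintegrableD Ip Im'. Qed.

(** Reflection of the negative half-line reduces an integral over the line to two over the open
    half-line, where primitives are available; the identity [gE] fails at most at 0, a null set. *)
Lemma cintegrable_half_lines : cintegrable mu setT g.
Proof.
apply: (ae_eq_cintegrable measurableT (cintegrable_cmeasurable Is) mg _ Is).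
apply: (ae_off_point (a := 0)) => x x0 _.
rewrite /gp /gm mulN1r addr0 opprK oppr_gt0.
by have [x1|x1|x1] := ltgtP x 0; rewrite ?addr0 ?add0r//; rewrite x1 eqxx in x0.
Qed.

Lemma cintegral_half_lines :
  cintegral mu setT g = cintegral mu setT gp + cintegral mu setT gm.
Proof.
rewrite (ae_eq_cintegral measurableT mg (cintegrable_cmeasurable Is) gE).
rewrite cintegralD// (cintegral_affine 0 N1 Im) normrN normr1 mul1r//.
Qed.

End half_lines.

Section line_powers.
Context {R : realType}.
Local Notation mu := (@lebesgue_measure R).
Local Notation RT := (measurableTypeR R).

Lemma cmeasurable_cpow_line d (T : measurableType d) (h : T -> R) (sigma : R) w :
  0 < sigma -> measurable_fun setT h ->
  cmeasurable setT (fun x => cpow (sigma +i* h x) w).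
Proof.
move=> s0 mh; apply: measurable_cexp; apply: cmeasurableM; first exact: cmeasurable_cst.
have mz : cmeasurable setT (fun x => sigma +i* h x) by split.
split.
  apply: (measurableT_comp (f := @ln R) (g := fun x => normc (sigma +i* h x))).
    exact: measurable_ln.
  exact: measurable_normc.
rewrite (_ : (fun _ => _) = fun x => atan (h x / sigma)); last first.
  by apply/funext => x; rewrite /= carg_atan.
apply: (measurableT_comp (f := @atan R)).
  exact: continuous_measurable_fun (@continuous_atan R).
by apply: measurable_funM.
Qed.

(** The mean of |Re z| and |Im z| is at most |z|. A bound linear in |t| is wanted because its powers
    have explicit primitives. *)
Lemma normc_line_ge (sigma t : R) : 0 < sigma -> (sigma + `|t|) / 2 <= normc (sigma +i* t).
Proof.
move=> s0; have := le_Re_normc (sigma +i* t); have := le_Im_normc (sigma +i* t).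
by rewrite /= (gtr0_norm s0); lra.
Qed.

(** The modulus is at most a constant times ((sigma + |t|) / 2)^(-Re al); since Re al > 1, the
    primitive [F] of this power is bounded on the half-line. *)
Lemma cintegrable_cpow_line (sigma : R) al : 0 < sigma -> 1 < Re al ->
  cintegrable mu setT (fun t => cpow (sigma +i* t) (- al)).
Proof.
move=> s0 al1.
set K := expR (`|Im al| * pi).
pose f (t : R) := expR (- Re al * ln ((sigma + t) / 2)).
pose F (t : R) := expR ((1 - Re al) * ln ((sigma + t) / 2)) * (2 / (1 - Re al)).
have p0 t : 0 <= t -> 0 < (sigma + t) / 2 by move=> t0; rewrite divr_gt0// ltr_pwDl.
have daff (t : R) : is_derive t 1 (fun t : R => (sigma + t) / 2) 2^-1.
  have d1 := is_derive_funD (is_derive_cst sigma t 1) (is_derive_id t 1).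
  apply: is_derive_eq (is_derive_funM d1 (is_derive_cst (2^-1 : R) t 1)) _.
  by rewrite /=; ring.
have dexp (c t : R) : 0 < t -> is_derive t 1 (fun t => expR (c * ln ((sigma + t) / 2)))
    (expR (c * ln ((sigma + t) / 2)) * (c / (sigma + t))).
  move=> t0; have pt := p0 _ (ltW t0).
  have d1 := is_derive1_comp (f := @ln R) (g := fun t => (sigma + t) / 2)
    (is_derive1_ln pt) (daff t).
  have d2 := is_derive_funM (is_derive_cst c t 1) d1.
  apply: is_derive_eq (is_derive1_comp (f := expR)
    (g := fun t => c * ln ((sigma + t) / 2)) (is_derive_expR _) d2) _.
  by rewrite /=; field; rewrite gt_eqF// addr_gt0.
have dF (t : R) : 0 < t -> is_derive t 1 F (f t).
  move=> t0; have pt := p0 _ (ltW t0).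
  apply: is_derive_eq (is_derive_funM (dexp (1 - Re al) t t0)
    (is_derive_cst (2 / (1 - Re al)) t 1)) _.
  have -> : expR ((1 - Re al) * ln ((sigma + t) / 2)) = ((sigma + t) / 2) * f t.
    by rewrite /f -{2}[(sigma + t) / 2]lnK ?posrE// -expRD; congr expR; ring.
  have c1 : 1 - Re al != 0 by rewrite subr_eq0 lt_eqF.
  have c2 : sigma + t != 0 by rewrite gt_eqF ?addr_gt0.
  by rewrite /=; field; apply/andP.
have If : mu.-integrable setT (EFin \o (fun s => if 0 < s then f s else 0)).
  apply: (@integrable_improper_FTC _ F f dF _
    (expR ((1 - Re al) * ln (sigma / 2)) * `|2 / (1 - Re al)|)) => t t0.
  - by apply/differentiable_continuous/derivable1_diffP; have [] := dexp (- Re al) t t0.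
  - exact: expR_ge0.
  - rewrite normrM (ger0_norm (expR_ge0 _)) ler_wpM2r// ler_expR ler_wnM2l ?subr_le0 ?ltW//.
    by rewrite ltr_ln ?posrE ?divr_gt0 ?addr_gt0// ltr_pM2r ?invr_gt0// ltrDl.
have mg : cmeasurable setT (fun t : RT => cpow (sigma +i* t) (- al)).
  exact: cmeasurable_cpow_line.
have bound (t : R) : normc (cpow (sigma +i* t) (- al)) <= K * f `|t|.
  apply: le_trans (normc_cpow_le _ _) _ => //.
  rewrite ReN ImN normrN mulrC ler_wpM2l ?expR_ge0// ler_expR !mulNr lerN2.
  rewrite ler_wpM2l ?(ltW (lt_trans ltr01 al1))// ler_ln ?posrE ?p0//; last first.
    by rewrite normc_gt0 Re_gt0_neq0.
  exact: normc_line_ge.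
have IKf := integrableZl measurableT K If.
apply: cintegrable_half_lines => //.
- apply: (@le_cintegrable _ _ _ mu setT _ (fun s => K * (if 0 < s then f s else 0))) => //.
    by apply: cmeasurable_if; [exact: measurable_gt0| |exact: cmeasurable_cst].
  move=> s _; case: ifPn => s1; last by rewrite Normc.normc0 mulr0.
  by have := bound s; rewrite gtr0_norm.
- apply: (@le_cintegrable _ _ _ mu setT _ (fun s => K * (if 0 < s then f s else 0))) => //.
    apply: cmeasurable_if; [exact: measurable_gt0| |exact: cmeasurable_cst].
    exact: (cmeasurable_comp mg).
  move=> s _; case: ifPn => s1; last by rewrite Normc.normc0 mulr0.
  by have := bound (- s); rewrite normrN gtr0_norm.
Qed.

End line_powers.

Section poisson.
Context {R : realType}.
Local Notation mu := (@lebesgue_measure R).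
Local Notation RT := (measurableTypeR R).

Lemma gam1E (z : R[i]) s : gam 1 z s = if 0 < s then cexp (- (s%:C * z)) else 0.
Proof.
case: ifPn => [s0|]; last by rewrite -leNgt => /gam_le0.
by rewrite gamE// subrr mul0r add0r.
Qed.

Lemma Gint1 (z : R[i]) : 0 < Re z -> Gint 1 z = z^-1.
Proof.
move=> z0; have zn0 := Re_gt0_neq0 z0.
have I1 := @cintegrable_gam R 1 z ltr01 z0.
have E : gam 1 z = fun s => if 0 < s then cexp (- (s%:C * z)) else 0.
  by apply/funext => s; exact: gam1E.
have d1 s : cderive (fun s => cexp (- (s%:C * z))) s (- z * cexp (- (s%:C * z))).
  apply: cderive_cexp; have := cderiveZ (- z) (cderive_id s).
  by rewrite mulr1 (_ : (fun x => _) = (fun x => - (x%:C * z)))//;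
    apply/funext => x; rewrite mulNr mulrC.
rewrite /Gint E (@cintegral_improper_FTC _ (fun s => - z^-1 * cexp (- (s%:C * z))) _
  (fun s => - z * cexp (- (s%:C * z))) (- z^-1) 0).
- by rewrite sub0r opprK.
- move=> s _; apply: cderive_eq (cderiveZ (- z^-1) (d1 s)) _.
  by field.
- by move=> s _; exact: d1.
- by rewrite -E.
- apply: cvg_ReIm_normc.
  have [cr ci] := cderive_continuous (cderiveZ (- z^-1) (d1 0)).
  have h0 : n.+2%:R^-1 @[n --> \oo] --> (0 : R).
    have h := @cvg_harmonic R; rewrite -(cvg_shiftS (@harmonic R)) in h.
    exact: h.
  have F0 : - z^-1 = - z^-1 * cexp (- ((0 : R)%:C * z)).
    by rewrite mul0r oppr0 cexp0 mulr1.
  rewrite [in Re _]F0 [in Im _]F0.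
  split; [exact: (cvg_comp _ _ h0 cr)|exact: (cvg_comp _ _ h0 ci)].
- have h : normc z^-1 * expR (- (Re z * ln n.+2%:R)) @[n --> \oo] --> (0 : R).
    rewrite -(mulr0 (normc z^-1)); apply: cvgM; first exact: cvg_cst.
    exact: cvg_expRN_ln.
  apply: (squeeze_cvgr _ (cvg_cst 0) h); apply: nearW => n.
  apply/andP; split; first exact: normc_ge0.
  rewrite subr0 (Normc.normcM (- z^-1)) normcN ler_wpM2l ?normc_ge0// normc_cexp.
  rewrite ler_expR ReN ReM/= mul0r subr0 lerN2 mulrC ler_wpM2r ?(ltW z0)//.
  by rewrite ltW// ln_sublinear.
Qed.

End poisson.

Section poisson_kernel.
Context {R : realType}.
Local Notation mu := (@lebesgue_measure R).
Local Notation RT := (measurableTypeR R).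

Definition damped (eps v t : R) : R[i] :=
  cexp ((t * v)%:C * 'i%C) * (expR (- (eps * `|t|)))%:C.

Lemma cmeasurable_damped d (T : measurableType d) (eps : R) (h k : T -> R) :
  measurable_fun setT h -> measurable_fun setT k ->
  cmeasurable setT (fun x => damped eps (h x) (k x)).
Proof.
move=> mh mk; apply: cmeasurableM.
  apply: measurable_cexp; apply: cmeasurableM; last exact: cmeasurable_cst.
  by apply: cmeasurable_real; exact: measurable_funM.
apply: cmeasurable_real; apply: (measurableT_comp (f := expR)) => //.
apply: measurable_funN.
apply: measurable_funM; first exact: measurable_cst.
exact: (measurableT_comp (f := @Num.norm R R)).
Qed.

Lemma normc_damped eps v t : normc (damped eps v t) = expR (- (eps * `|t|)).
Proof.
by rewrite Normc.normcM normc_cexp normc_real_ge0 ?expR_ge0// ReM/= mulr0 mul0r subr0 expR0 mul1r.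
Qed.

(** The two half-lines contribute 1/(eps - iv) and 1/(eps + iv). Their sum is the Poisson kernel, up
    to the factor 2 pi. *)
Lemma cintegral_damped (eps v : R) : 0 < eps ->
  cintegrable mu setT (damped eps v) /\
  cintegral mu setT (damped eps v) = (2 * eps / (eps ^+ 2 + v ^+ 2))%:C.
Proof.
move=> e0.
have mg : cmeasurable setT (damped eps v : RT -> R[i]).
  exact: cmeasurable_damped.
have pE : (fun s => if 0 < s then damped eps v s else 0) = gam 1 (eps -i* v).
  apply/funext => s; rewrite gam1E; case: ifPn => // s0.
  rewrite /damped -cexp_real -cexpD gtr0_norm//; congr cexp.
  by apply: complex_eqP => /=; ring.
have mE : (fun s => if 0 < s then damped eps v (- s) else 0) = gam 1 (eps +i* v).
  apply/funext => s; rewrite gam1E; case: ifPn => // s0.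
  rewrite /damped -cexp_real -cexpD normrN gtr0_norm//; congr cexp.
  by apply: complex_eqP => /=; ring.
have Ip : cintegrable mu setT (gam 1 (eps -i* v)) by exact: cintegrable_gam.
have Im : cintegrable mu setT (gam 1 (eps +i* v)) by exact: cintegrable_gam.
split; first by apply: cintegrable_half_lines; rewrite ?pE ?mE.
rewrite cintegral_half_lines ?pE ?mE//.
rewrite -[X in X + _]/(Gint _ _) -[X in _ + X]/(Gint _ _) !Gint1//.
have n0 : eps ^+ 2 + v ^+ 2 != 0 by rewrite gt_eqF// ltr_wpDr ?sqr_ge0 ?exprn_gt0.
by apply: complex_eqP => /=; rewrite ?sqrrN; field.
Qed.

(** The mass of the rescaled Poisson kernel, and the origin of the factor 2 pi in the inversion
    formula. *)
Lemma integral_cauchy :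
  cintegrable mu setT (fun v => (2 / (1 + v ^+ 2))%:C) /\
  cintegral mu setT (fun v => (2 / (1 + v ^+ 2))%:C) = (2 * pi)%:C :> R[i].
Proof.
have n0 (t : R) : 0 < 1 + t ^+ 2 by rewrite ltr_wpDr ?sqr_ge0.
pose F (t : R) : R := 2 * atan t.
pose f (t : R) : R := 2 / (1 + t ^+ 2).
have dF (t : R) : is_derive t 1 F (f t).
  apply: is_derive_eq (is_derive_funM (is_derive_cst (2 : R) t 1) (is_derive1_atan t)) _.
  by rewrite /= mulr0 addr0.
have cf : continuous f.
  move=> t; apply: cvgM; first exact: cvg_cst.
  apply: cvgV; first by rewrite gt_eqF.
  by apply: cvgD; [exact: cvg_cst|exact: exprn_continuous].
have If : mu.-integrable setT (EFin \o (fun s => if 0 < s then f s else 0)).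
  apply: (@integrable_improper_FTC _ F f (fun t _ => dF t) (fun t _ => cf t) (2 * pi)) => t t0.
    by rewrite divr_ge0// ltW.
  rewrite normrM ger0_norm// ler_wpM2l//.
  have := atan_gtNpi2 t; have := atan_ltpi2 t; have := pi_ge0 R => p0 h1 h2.
  by rewrite ler_norml; apply/andP; split; lra.
have E : \int[mu]_s (if 0 < s then f s else 0) = pi - 0.
  apply: (@Rintegral_improper_FTC _ F f (fun t _ => dF t) (fun t _ => cf t) _ _ If).
    have h := @cvg_harmonic R; rewrite -(cvg_shiftS (@harmonic R)) in h.
    have a0 : F x @[x --> (0 : R)] --> F 0.
      by apply: cvgM; [exact: cvg_cst|exact: continuous_atan].
    have F0 : F 0 = 0 by rewrite /F atan0 mulr0.
    rewrite -[X in _ --> X]F0; exact: (cvg_comp _ _ h a0).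
  rewrite (_ : pi = 2 * (pi / 2)); last by field.
  apply: cvgM; first exact: cvg_cst.
  have h := @cvgr_idn R; rewrite -(cvg_shiftS (fun n => n%:R : R)) in h.
  rewrite -(cvg_shiftS (fun n => n.+1%:R : R)) in h.
  exact: (cvg_comp _ _ h (@cvgy_atan R)).
have mf : measurable_fun setT (f : RT -> R) by exact: continuous_measurable_fun.
have mg : cmeasurable setT (fun v : RT => (f v)%:C) by exact: cmeasurable_real.
have pE : (fun s => if 0 < s then (f s)%:C else 0) = (fun s => (if 0 < s then f s else 0)%:C).
  by apply/funext => s; case: ifP.
have mE : (fun s => if 0 < s then (f (- s))%:C else 0) = (fun s => (if 0 < s then f s else 0)%:C).
  by apply/funext => s; rewrite /f sqrrN; case: ifP.
have Ip := cintegrable_real If.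
split; first by apply: cintegrable_half_lines; rewrite ?pE ?mE.
rewrite (cintegral_half_lines mg) ?pE ?mE//.
by rewrite cintegral_real E -rmorphD subr0 mulr2n mulrDl mul1r.
Qed.

End poisson_kernel.

Section laplace_inversion.
Context {R : realType}.
Local Notation mu := (@lebesgue_measure R).
Local Notation RT := (measurableTypeR R).
Variables (al : R[i]) (sigma s0 : R).
Hypotheses (al1 : 1 < Re al) (sigma0 : 0 < sigma) (s0_gt0 : 0 < s0).

Let al0 : 0 < Re al. Proof. exact: lt_trans al1. Qed.
Let f s := gam al sigma%:C s.
Let If : cintegrable mu setT f. Proof. exact: cintegrable_gam. Qed.
Let mf : cmeasurable setT (f : RT -> R[i]). Proof. exact: cmeasurable_gam. Qed.

(** Re al > 1 keeps s^(al-1) bounded near 0. The constant dominates the Poisson convolution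
    uniformly in the damping parameter. *)
Let f_bounded : exists C, forall s, normc (f s) <= C.
Proof.
have a1 : 0 < Re al - 1 by rewrite subr_gt0.
have [C hC] := ln_le_linear a1 sigma0; exists (expR C) => s.
rewrite normc_gam; case: ifPn => s1; last exact: expR_ge0.
rewrite ler_expR /=; have := hC s s1.
have : (Re al - 1) * ln s <= (Re al - 1) * ln (1 + s).
  by rewrite ler_wpM2l ?(ltW a1)// ler_ln ?posrE ?addr_gt0// lerDr.
by lra.
Qed.

(* Insert the integral defining Gint, exchange the integrals, and substitute
   s = eps * v + s0. *)
Let poisson_identity (eps : R) : 0 < eps ->
  cintegral mu setT (fun t => Gint al (sigma +i* t) * damped eps s0 t) =
  cintegral mu setT (fun v => f (eps * v + s0) * (2 / (1 + v ^+ 2))%:C).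
Proof.
move=> e0.
pose Phi (p : RT * RT) := f p.2 * damped eps (s0 - p.2) p.1.
have mPhi : cmeasurable setT Phi.
  apply: cmeasurableM; first exact: (cmeasurable_comp (h := snd) mf).
  apply: cmeasurable_damped; last exact: measurable_fst.
  by apply: measurable_funB => //; exact: measurable_snd.
have Id : mu.-integrable setT (EFin \o (fun t : R => expR (- (eps * `|t|)))).
  have := cintegrable_normc measurableT (cintegral_damped 0 e0).1.
  by apply: eq_integrable => // x _; rewrite normc_damped.
have IPhi : cintegrable (mu \x mu)%E setT Phi.
  apply: (@le_cintegrable _ _ _ _ setT Phi (fun p : RT * RT => expR (- (eps * `|p.1|)) * normc (f p.2))) => //.
    by move=> p _; rewrite /Phi Normc.normcM normc_damped mulrC.
  exact: (integrable_prodM Id (cintegrable_normc measurableT If)).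
transitivity (cintegral mu setT (fun t => cintegral mu setT (fun s => Phi (t, s)))).
  apply: eq_cintegral => t _; rewrite mulrC /Gint -cintegralZl//; last exact: cintegrable_gam.
  apply: eq_cintegral => s _; rewrite /Phi/= /f /gam /damped.
  rewrite mulrCA -[RHS]mulrA; congr (_ * _).
  rewrite mulrAC mulrA -!cexpD; congr (cexp _ * _).
  by apply: complex_eqP => /=; ring.
rewrite (cintegral_fubini1 IPhi) -(cintegral_fubini2 IPhi).
have E s : cintegral mu setT (fun t => Phi (t, s)) =
    f s * (2 * eps / (eps ^+ 2 + (s0 - s) ^+ 2))%:C.
  have [I1 <-] := cintegral_damped (s0 - s) e0.
  by rewrite -cintegralZl.
have I1 : cintegrable mu setT (fun s => f s * (2 * eps / (eps ^+ 2 + (s0 - s) ^+ 2))%:C).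
  by apply: eq_cintegrable (cintegrable_fubini2 IPhi) => // s _; exact: E.
transitivity (cintegral mu setT (fun s => f s * (2 * eps / (eps ^+ 2 + (s0 - s) ^+ 2))%:C)).
  by apply: eq_cintegral => s _; exact: E.
rewrite (cintegral_affine s0 (lt0r_neq0 e0) I1) -cintegralZl//; last first.
  exact: (cintegrable_affine s0 (lt0r_neq0 e0) I1).
apply: eq_cintegral => v _; rewrite mulrCA -rmorphM gtr0_norm//; congr (_ * _%:C).
have n0 : 1 + v ^+ 2 != 0 by rewrite gt_eqF// ltr_wpDr ?sqr_ge0.
rewrite (_ : s0 - (eps * v + s0) = - (eps * v)); last by ring.
by field; rewrite n0 gt_eqF// ltr_wpDr ?sqr_ge0 ?exprn_gt0.
Qed.

(** Both sides of [poisson_identity] converge as eps -> 0: the left one is dominated by |Gamma(al)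
    z^-al|, integrable since Re al > 1, the right one by C times the Cauchy density, with pointwise
    limit given by continuity at s0 > 0. Gamma(al) stands as a factor and not as a divisor because
    its nonvanishing is deduced from this identity. *)
Lemma laplace_inversion :
  cintegrable mu setT (fun t => cpow (sigma +i* t) (- al) * cexp ((sigma +i* t) * s0%:C)) /\
  cGamma al * cintegral mu setT
    (fun t => cpow (sigma +i* t) (- al) * cexp ((sigma +i* t) * s0%:C)) =
  (2 * pi)%:C * qpow al s0.
Proof.
have Ip := cintegrable_cpow_line sigma0 al1.
have mp := cintegrable_cmeasurable Ip.
have mlin : cmeasurable setT (fun t : RT => (t * s0)%:C * 'i%C).
  apply: cmeasurableM; last exact: cmeasurable_cst.
  by apply: cmeasurable_real; exact: measurable_funM.
pose osc (t : R) : R[i] := cexp ((t * s0)%:C * 'i%C).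
have mosc : cmeasurable setT (osc : RT -> R[i]) by exact: measurable_cexp.
have nosc t : normc (osc t) = 1 by rewrite normc_cexp ReM/= mulr0 mul0r subr0 expR0.
have Iosc : cintegrable mu setT (fun t => cpow (sigma +i* t) (- al) * osc t).
  apply: (@le_cintegrable _ _ _ mu setT _ (fun t => normc (cpow (sigma +i* t) (- al)))) => //.
  - exact: cmeasurableM.
  - by move=> t _; rewrite Normc.normcM nosc mulr1.
  - exact: cintegrable_normc.
have E t : cpow (sigma +i* t) (- al) * cexp ((sigma +i* t) * s0%:C) =
    cexp (sigma * s0)%:C * (cpow (sigma +i* t) (- al) * osc t).
  rewrite mulrCA; congr (_ * _); rewrite -cexpD; congr cexp.
  by apply: complex_eqP => /=; ring.
under [X in cintegrable _ _ X]eq_fun do rewrite E.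
under [X in cintegral _ _ X]eq_fun do rewrite E.
split; first exact: cintegrableZl.
rewrite cintegralZl// mulrCA.
suff -> : cGamma al * cintegral mu setT (fun t => cpow (sigma +i* t) (- al) * osc t) =
    f s0 * (2 * pi)%:C.
  (* The growth e^(sigma s0) taken out of the oscillating integral cancels the damping built into
     [gam], so the result does not depend on [sigma]. *)
  have cc : cexp (sigma * s0)%:C * cexp (- (s0%:C * sigma%:C)) = 1.
    by rewrite -cexpD rmorphM (mulrC s0%:C) subrr cexp0.
  by rewrite /f /gam mulrA (mulrCA (cexp _)) cc mulr1 mulrC.
pose eps n : R := n.+1%:R^-1.
have e0 n : 0 < eps n by rewrite invr_gt0.
have ceps : eps n @[n --> \oo] --> (0 : R) by exact: cvg_harmonic.
pose A n t := Gint al (sigma +i* t) * damped (eps n) s0 t.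
have GE t : Gint al (sigma +i* t) = cGamma al * cpow (sigma +i* t) (- al).
  exact: GintE.
have mG : cmeasurable setT (fun t : RT => Gint al (sigma +i* t)).
  by under eq_fun do rewrite GE; apply: cmeasurableM => //; exact: cmeasurable_cst.
have [Ar Ai] : Re (cintegral mu setT (A n)) @[n --> \oo] -->
    Re (cintegral mu setT (fun t => Gint al (sigma +i* t) * osc t)) /\
    Im (cintegral mu setT (A n)) @[n --> \oo] -->
    Im (cintegral mu setT (fun t => Gint al (sigma +i* t) * osc t)).
  have AE t : Re (A n t) @[n --> \oo] --> Re (Gint al (sigma +i* t) * osc t) /\
      Im (A n t) @[n --> \oo] --> Im (Gint al (sigma +i* t) * osc t).
    apply: cvg_normc_ReIm.
    have h : normc (Gint al (sigma +i* t) * osc t) * `|expR (- (eps n * `|t|)) - 1|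
        @[n --> \oo] --> (0 : R).
      rewrite -(mulr0 (normc (Gint al (sigma +i* t) * osc t))).
      apply: cvgM; first exact: cvg_cst.
      rewrite -(normr0 R); apply: cvg_norm; apply/subr_cvg0.
      rewrite -[X in _ --> X]expR0; apply: continuous_cvg; first exact: continuous_expR.
      rewrite -oppr0 -(mul0r `|t|); apply: cvgN; apply: cvgM; first exact: ceps.
      exact: cvg_cst.
    apply: cvg_trans h; apply: near_eq_cvg; apply: nearW => n.
    rewrite -(normc_real (expR (- (eps n * `|t|)) - 1)) -Normc.normcM; congr normc.
    by rewrite rmorphB mulrBr mulr1 /A /damped mulrA.
  apply: (@cdominated_convergence _ _ _ mu setT A
    (fun t => Gint al (sigma +i* t) * osc t) (fun t => normc (cGamma al * cpow (sigma +i* t) (- al)))) => //.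
  - by move=> n; apply: cmeasurableM => //; exact: cmeasurable_damped.
  - exact: cmeasurableM.
  - by move=> t _; case: (AE t).
  - by move=> t _; case: (AE t).
  - by apply: cintegrable_normc => //; exact: cintegrableZl.
  - move=> n t _; rewrite /A Normc.normcM normc_damped GE ler_piMr ?normc_ge0//.
    by rewrite -[leRHS]expR0 ler_expR oppr_le0 mulr_ge0// ltW.
pose B n v := f (eps n * v + s0) * (2 / (1 + v ^+ 2))%:C.
have [Ic Ec] := @integral_cauchy R.
have [Br Bi] : Re (cintegral mu setT (B n)) @[n --> \oo] -->
    Re (cintegral mu setT (fun v => f s0 * (2 / (1 + v ^+ 2))%:C)) /\
    Im (cintegral mu setT (B n)) @[n --> \oo] -->
    Im (cintegral mu setT (fun v => f s0 * (2 / (1 + v ^+ 2))%:C)).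
  have [C hC] := f_bounded.
  have cf v : Re (f (eps n * v + s0)) @[n --> \oo] --> Re (f s0) /\
     Im (f (eps n * v + s0)) @[n --> \oo] --> Im (f s0).
    pose phi s := cexp ((al - 1) * (ln s)%:C - s%:C * sigma%:C).
    have fphi s : 0 < s -> f s = phi s by move=> s1; rewrite /f gamE.
    have [cr ci] := cderive_continuous (cderive_powexp (al - 1) sigma%:C s0_gt0).
    have x0 : eps n * v + s0 @[n --> \oo] --> s0.
      rewrite -[X in _ --> X]add0r -[X in X + _](mul0r v); apply: cvgD; last exact: cvg_cst.
      by apply: cvgM; [exact: ceps|exact: cvg_cst].
    (* For negative [v] the point may be nonpositive for small [n], where [f] is 0 and no longer
       given by [phi]. *)
    have pos : \forall n \near \oo, 0 < eps n * v + s0.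
      by have := x0; move/cvgr_gt => /(_ _ s0_gt0).
    rewrite fphi//; split.
      apply: cvg_trans (cvg_comp _ _ x0 cr); apply: near_eq_cvg.
      by apply: filterS pos => n /fphi ->.
    apply: cvg_trans (cvg_comp _ _ x0 ci); apply: near_eq_cvg.
    by apply: filterS pos => n /fphi ->.
  have Bc v : Re (B n v) @[n --> \oo] --> Re (f s0 * (2 / (1 + v ^+ 2))%:C) /\
      Im (B n v) @[n --> \oo] --> Im (f s0 * (2 / (1 + v ^+ 2))%:C).
    have [cr ci] := cf v; split.
      rewrite ReM/= mulr0 subr0; under eq_fun do rewrite ReM/= mulr0 subr0.
      by apply: cvgM; [exact: cr|exact: cvg_cst].
    rewrite ImM/= mulr0 add0r; under eq_fun do rewrite ImM/= mulr0 add0r.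
    by apply: cvgM; [exact: ci|exact: cvg_cst].
  have IcC := integrableZl measurableT C (cintegrable_normc measurableT Ic).
  apply: (@cdominated_convergence _ _ _ mu setT B
    (fun v => f s0 * (2 / (1 + v ^+ 2))%:C) (fun v : R => C * normc (2 / (1 + v ^+ 2))%:C)) => //.
  - move=> n; apply: cmeasurableM; last exact: cintegrable_cmeasurable Ic.
    exact: (cmeasurable_comp (h := fun v : RT => eps n * v + s0 : RT) mf (measurable_affine _ _)).
  - by apply: cmeasurableM; [exact: cmeasurable_cst|exact: cintegrable_cmeasurable Ic].
  - by move=> v _; case: (Bc v).
  - by move=> v _; case: (Bc v).
  - by move=> n v _; rewrite /B Normc.normcM ler_wpM2r ?normc_ge0.
have AB n : cintegral mu setT (A n) = cintegral mu setT (B n).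
  exact: poisson_identity.
have {}Ar : (fun n => Re (cintegral mu setT (B n))) @ \oo -->
    Re (cintegral mu setT (fun t => Gint al (sigma +i* t) * osc t)).
  by apply: cvg_trans Ar; apply: near_eq_cvg; apply: nearW => n; rewrite -AB.
have {}Ai : (fun n => Im (cintegral mu setT (B n))) @ \oo -->
    Im (cintegral mu setT (fun t => Gint al (sigma +i* t) * osc t)).
  by apply: cvg_trans Ai; apply: near_eq_cvg; apply: nearW => n; rewrite -AB.
have L : cintegral mu setT (fun t => Gint al (sigma +i* t) * osc t) =
    cintegral mu setT (fun v => f s0 * (2 / (1 + v ^+ 2))%:C).
  by apply: complex_eqP; [exact: cvg_unique Ar Br|exact: cvg_unique Ai Bi].
rewrite cintegralZl// Ec in L; rewrite -L -cintegralZl//.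
by apply: eq_cintegral => t _; rewrite GE mulrA.
Qed.

End laplace_inversion.

Section gamma_neq0.
Context {R : realType}.

(* The right-hand side of the inversion formula does not vanish at s = 1. *)
Lemma cGamma_neq0 (al : R[i]) : 0 < Re al -> cGamma al != 0.
Proof.
move=> al0; have al1 : 1 < Re (al + 1) by rewrite ReD ltrDr.
have [_ E] := laplace_inversion al1 (ltr01 : 0 < (1 : R)) (ltr01 : 0 < (1 : R)).
have : (2 * pi)%:C * qpow (al + 1) 1 != 0 :> R[i].
  rewrite mulf_neq0//; first by rewrite (fmorph_eq0 (real_complex R)) gt_eqF// mulr_gt0// pi_gt0.
  by rewrite qpowE// cexp_neq0.
by rewrite -E cGammaS// -mulrA mulf_eq0 negb_or => /andP[_]; rewrite mulf_eq0 negb_or => /andP[].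
Qed.

End gamma_neq0.

(** * Moments over products of vertical lines *)

Section line_integral.
Context {R : realType}.
Local Notation mu := (@lebesgue_measure R).
Local Notation RT := (measurableTypeR R).
Variables (k : nat) (al : 'I_k -> R[i]) (ga : R[i]).
Hypotheses (al1 : forall j, 1 < Re (al j)) (ga0 : 0 < Re ga).

Let sg : R := k.+1%:R^-1.
Let sg0 : 0 < sg. Proof. by rewrite invr_gt0. Qed.
Let z (t : R) : R[i] := sg +i* t.
Let Z (s : k.-tuple R) : R[i] := 1 - \sum_j z (tnth s j).

(** 1 - k/(k+1) = 1/(k+1): the point 1 - <u> lies on the same vertical line as the u_j, whatever
    their imaginary parts. *)
Let ZE s : Z s = sg +i* (- \sum_j tnth s j).
Proof.
have k0 : k.+1%:R != 0 :> R by rewrite pnatr_eq0.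
apply: complex_eqP; rewrite /Z ?ReD ?ImD ?ReN ?ImN ?Re_sum ?Im_sum/=; last by rewrite add0r.
rewrite sumr_const card_ord -mulr_natr -[X in X - _](mulVf k0) -/sg -mulrBr.
by rewrite -natrB// subSnn mulr1.
Qed.

Let P (s : k.-tuple R) : R[i] := \prod_j cpow (z (tnth s j)) (- al j).

Let IP : cintegrable (lebesgue_tuple R k) setT P.
Proof.
have [] // := @cintegral_tuple_prod R k (fun j t => cpow (z t) (- al j)).
by move=> j; exact: cintegrable_cpow_line.
Qed.

Let cmeasurable_Zpow : cmeasurable setT (fun s : k.-tuple RT => cpow (Z s) (- ga)).
Proof.
under eq_fun do rewrite ZE.
apply: cmeasurable_cpow_line => //; apply: measurable_funN.
by apply: measurable_sum => j; exact: measurable_tnth.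
Qed.

(** |Z| >= 1/(k+1) bounds Z^-ga by a constant, so the decay of the product [P] in the separate
    variables is enough. *)
Lemma cintegrable_line_prod : cintegrable (lebesgue_tuple R k) setT (fun s => P s * cpow (Z s) (- ga)).
Proof.
pose K := expR (- Re ga * ln sg) * expR (`|Im ga| * pi).
apply: (@le_cintegrable _ _ _ (lebesgue_tuple R k) setT (fun s => P s * cpow (Z s) (- ga))
    (fun s : k.-tuple RT => K * normc (P s))) => //.
- exact: cmeasurableM (cintegrable_cmeasurable IP) cmeasurable_Zpow.
- move=> s _; rewrite Normc.normcM mulrC ler_wpM2r ?normc_ge0//.
  have Z0 : 0 < Re (Z s) by rewrite ZE.
  apply: le_trans (normc_cpow_le _ Z0) _.
  rewrite ReN ImN normrN ler_wpM2r ?expR_ge0// ler_expR !mulNr lerN2.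
  rewrite ler_wpM2l ?(ltW ga0)// ler_ln ?posrE//; last by rewrite normc_gt0 Re_gt0_neq0.
  by apply: le_trans (le_Re_normc _); rewrite ZE/= ler_norm.
- exact: (integrableZl measurableT K (cintegrable_normc measurableT IP)).
Qed.

(* Compute the integral of (prod_j z_j^-al_j) r^(ga-1) e^(-r(1-<z>)) over r and z in both
   orders; for fixed r it is a product of k Laplace inversions at the same point r. *)
Lemma cintegral_line_prod :
  cintegral (lebesgue_tuple R k) setT (fun s => P s * cpow (Z s) (- ga)) =
  (2 * pi)%:C ^+ k * cGamma (ga + \sum_j (al j - 1)) / (cGamma ga * \prod_j cGamma (al j)).
Proof.
have G0 : cGamma ga != 0 by exact: cGamma_neq0.
have Gj j : cGamma (al j) != 0 by apply: cGamma_neq0; exact: lt_trans (al1 j).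
pose g j (r t : R) := cpow (z t) (- al j) * cexp (z t * r%:C).
pose Psi (p : k.-tuple RT * RT) := gam ga 1 p.2 * \prod_j g j p.2 (tnth p.1 j).
have PsiE p : Psi p = P p.1 * gam ga (Z p.1) p.2.
  rewrite /Psi big_split/= mulrCA -/(P p.1); congr (_ * _).
  rewrite /gam -mulrA; congr (_ * _); rewrite -cexp_sum -cexpD; congr cexp.
  rewrite /Z mulrBr mulr1 opprB addrC mulr_sumr; congr (_ - _).
  by apply: eq_bigr => j _; rewrite mulrC.
have mPsi : cmeasurable setT Psi.
  apply: cmeasurableM; first exact: (cmeasurable_comp (h := snd) (cmeasurable_gam ga 1)).
  apply: cmeasurable_prod => j.
  have mt : measurable_fun setT (fun p : k.-tuple RT * RT => tnth p.1 j).
    exact: (measurableT_comp (measurable_tnth j) measurable_fst).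
  apply: cmeasurableM; first exact: cmeasurable_cpow_line.
  apply: measurable_cexp; apply: cmeasurableM; first by split.
  by apply: cmeasurable_real; exact: measurable_snd.
(* Re Z is constant, so the modulus splits into a function of the point and a function of r;
   integrability on the product follows at once. *)
have nPsi p : normc (Psi p) = normc (P p.1) * normc (gam ga sg%:C p.2).
  by rewrite PsiE Normc.normcM; congr (_ * _); rewrite !normc_gam ZE.
have IPsi : cintegrable (lebesgue_tuple R k \x mu)%E setT Psi.
  apply: (@le_cintegrable _ _ _ _ setT Psi
    (fun p : k.-tuple RT * RT => normc (P p.1) * normc (gam ga sg%:C p.2))) => //.
    by move=> p _; rewrite nPsi.
  have sgC : 0 < Re sg%:C by [].
  exact: (integrable_prodM (cintegrable_normc measurableT IP)
    (cintegrable_normc measurableT (cintegrable_gam ga0 sgC))).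
have L : cintegral (lebesgue_tuple R k \x mu)%E setT Psi =
    cGamma ga * cintegral (lebesgue_tuple R k) setT (fun s => P s * cpow (Z s) (- ga)).
  rewrite -(cintegral_fubini1 IPsi) -cintegralZl//; last exact: cintegrable_line_prod.
  apply: eq_cintegral => s _; under eq_cintegral => r _ do rewrite PsiE/=.
  have Z0 : 0 < Re (Z s) by rewrite ZE.
  rewrite cintegralZl//; last exact: cintegrable_gam.
  by rewrite -/(Gint _ _) GintE// mulrCA.
have Gs : 0 < Re (ga + \sum_j (al j - 1)).
  rewrite ReD Re_sum ltr_wpDr// sumr_ge0// => j _.
  by rewrite ReD ReN subr_ge0 ltW.
have H : cintegral (lebesgue_tuple R k \x mu)%E setT Psi =
    (2 * pi)%:C ^+ k / (\prod_j cGamma (al j)) * cGamma (ga + \sum_j (al j - 1)).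
  rewrite -(cintegral_fubini2 IPsi) cGammaE /Gint -cintegralZl//; last exact: cintegrable_gam.
  apply: eq_cintegral => r _.
  have [r0|r0] := ltP 0 r; last first.
    rewrite gam_le0// mulr0 (@eq_cintegral _ _ _ _ _ _ (fun=> 0)) ?cintegral0// => s _.
    by rewrite /Psi/= gam_le0// mul0r.
  have [Ir Er] := @cintegral_tuple_prod R k (fun j => g j r)
    (fun j => (laplace_inversion (al1 j) sg0 r0).1).
  transitivity (cintegral (lebesgue_tuple R k) setT
    (fun s => gam ga 1 r * \prod_j g j r (tnth s j))); first by [].
  rewrite cintegralZl// Er.
  have -> : \prod_j cintegral mu setT (g j r) =
      \prod_j ((2 * pi)%:C * (cGamma (al j))^-1 * qpow (al j) r).
    apply: eq_bigr => j _; apply: (mulfI (Gj j)).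
    by rewrite (laplace_inversion (al1 j) sg0 r0).2; field; exact: Gj.
  rewrite big_split/= big_split/= prodr_const card_ord prodfV mulrCA; congr (_ * _).
  (* The inversions leave r^(al_j - 1) for each j; with r^(ga-1) e^-r they form the Gamma integrand
     of exponent ga + sum_j (al_j - 1). *)
  rewrite !gamE//; under eq_bigr do rewrite qpowE//.
  rewrite -cexp_sum -cexpD; congr cexp; rewrite -mulr_suml.
  by ring.
rewrite L in H.
apply: (mulfI G0); rewrite H.
have Gp : \prod_j cGamma (al j) != 0 by apply/prodf_neq0.
by field; rewrite G0 Gp.
Qed.

End line_integral.

Section line_moment.
Context {R : realType} (k : nat).
Local Notation RT := (measurableTypeR R).
Implicit Types (x c : 'rV[R[i]]_k) (m : {ffun 'I_k -> nat}).

(** The divided power x^m / m!, for which the binomial and multinomial theorems carry no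
    coefficients. *)
Definition mono m x : R[i] := (\prod_j x 0 j ^+ m j) / (\prod_j (m j)`!)%N%:R.

(** The factor (x/u)^m only raises the exponents c_j to c_j + m_j and leaves ga = a + k - <c>
    unchanged. The quotients of Gamma values are then Pochhammer symbols, and (2 pi i)^k in the
    density cancels against (2 pi)^k from the inversions and i^k from the parametrization. *)
Lemma line_moment x c a m : vRe_gt0 (c - const_mx 1) ->
  Re (vsum c) < Re a + k%:R ->
  let rho := line_density (c - const_mx 1) (a + k%:R - vsum c) in
  cintegrable (lebesgue_tuple R k) setT (fun s => mono m (vdiv x (line_pt s)) * rho s) /\
  cintegral (lebesgue_tuple R k) setT (fun s => mono m (vdiv x (line_pt s)) * rho s) =
  poch a (\sum_j m j)%N / (\prod_j poch (c 0 j) (m j)) * mono m x.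
Proof.
move=> hc ha rho.
pose ga := a + k%:R - vsum c.
have ga0 : 0 < Re ga by rewrite /ga !ReD ReN Re_nat subr_gt0.
have c1 j : 1 < Re (c 0 j) by have := hc j; rewrite !mxE ReD ReN subr_gt0.
have c0 j : 0 < Re (c 0 j) := lt_trans ltr01 (c1 j).
pose al j := c 0 j + (m j)%:R.
have al1 j : 1 < Re (al j) by rewrite ReD Re_nat ltr_wpDr.
have I1 := cintegrable_line_prod al1 ga0.
have E1 := cintegral_line_prod al1 ga0.
have vs : vsum (c - const_mx 1) = vsum c - k%:R.
  rewrite /vsum; under eq_bigr do rewrite !mxE.
  by rewrite sumrB sumr_const card_ord.
have aE : vsum (c - const_mx 1) + ga = a by rewrite vs /ga; ring.
have a0 : 0 < Re a.
  rewrite -aE ReD ltr_wpDl// /vsum Re_sum sumr_ge0// => j _.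
  exact/ltW/hc.
have ca j : (c - const_mx 1) 0 j + 1 = c 0 j by rewrite !mxE subrK.
pose Kc : R[i] := (\prod_j cGamma (c 0 j)) * cGamma ga /
  ((2 * pi%:C * 'i%C) ^+ k * cGamma a) * 'i%C ^+ k * mono m x.
pose u (s : k.-tuple R) j : R[i] := (k.+1%:R)^-1 +i* tnth s j.
have u0 s j : 0 < Re (u s j) by rewrite /= invr_gt0.
have E s : mono m (vdiv x (line_pt s)) * rho s =
    Kc * (\prod_j cpow (u s j) (- al j) * cpow (1 - \sum_j u s j) (- ga)).
  rewrite /rho /line_density /mutilde_density -/ga aE.
  under eq_bigr do rewrite ca.
  have -> : \prod_j cpow (line_pt s 0 j) (- (c - const_mx 1) 0 j - 1) =
      \prod_j cpow (u s j) (- c 0 j).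
    by apply: eq_bigr => j _; rewrite -opprD ca mxE.
  have -> : vsum (line_pt s) = \sum_j u s j by apply: eq_bigr => j _; rewrite mxE.
  have -> : \prod_j cpow (u s j) (- al j) =
      (\prod_j cpow (u s j) (- c 0 j)) * \prod_j (u s j ^- m j).
    rewrite -big_split; apply: eq_bigr => j _ /=.
    by rewrite /al opprD cpowD [X in _ * X]cpowN cpow_nat.
  have -> : mono m (vdiv x (line_pt s)) = mono m x * \prod_j (u s j ^- m j).
    rewrite /mono mulrAC -big_split; congr (_ / _); apply: eq_bigr => j _ /=.
    by rewrite !mxE expr_div_n.
  by rewrite /Kc; ring.
have -> : (fun s => mono m (vdiv x (line_pt s)) * rho s) = (fun s =>
    Kc * (\prod_j cpow (u s j) (- al j) * cpow (1 - \sum_j u s j) (- ga))).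
  by apply/funext.
split; first exact: cintegrableZl.
rewrite cintegralZl//.
transitivity (Kc * ((2 * pi)%:C ^+ k * cGamma (ga + \sum_j (al j - 1)) /
  (cGamma ga * \prod_j cGamma (al j)))); first by congr (_ * _).
have -> : ga + \sum_j (al j - 1) = a + (\sum_j m j)%:R.
  rewrite /al sumrB big_split/= sumr_const card_ord natr_sum -/(vsum c) /ga.
  by ring.
rewrite cGamma_poch//.
have -> : \prod_j cGamma (al j) = \prod_j poch (c 0 j) (m j) * \prod_j cGamma (c 0 j).
  by rewrite -big_split; apply: eq_bigr => j _; rewrite /= cGamma_poch.
have Ga : cGamma a != 0 by exact: cGamma_neq0.
have Gga : cGamma ga != 0 by exact: cGamma_neq0.
have Gc : \prod_j cGamma (c 0 j) != 0 by apply/prodf_neq0 => j _; exact: cGamma_neq0.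
have Pc : \prod_j poch (c 0 j) (m j) != 0.
  apply/prodf_neq0 => j _; apply/prodf_neq0 => i _.
  by rewrite Re_gt0_neq0// ReD Re_nat ltr_wpDr.
have pik : (2 * pi)%:C ^+ k != 0 :> R[i].
  by rewrite expf_neq0// (fmorph_eq0 (real_complex R)) gt_eqF// mulr_gt0// pi_gt0.
have ik : 'i%C ^+ k != 0 :> R[i].
  by rewrite expf_neq0// -normc_gt0 normc_sqrt/= expr0n expr1n/= add0r sqrtr1.
rewrite /Kc; have -> : (2 * pi%:C * 'i%C) ^+ k = (2 * pi)%:C ^+ k * 'i%C ^+ k :> R[i].
  by rewrite exprMn rmorphM rmorph_nat.
by field; rewrite Ga Gga Gc Pc pik ik.
Qed.

End line_moment.

(** * Beta and Dirichlet moments *)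

Section convolution.
Context {R : realType}.
Local Notation mu := (@lebesgue_measure R).
Local Notation RT := (measurableTypeR R).
Variables (al be : R[i]).
Hypotheses (al0 : 0 < Re al) (be0 : 0 < Re be).

Let ab0 : 0 < Re (al + be). Proof. by rewrite ReD addr_gt0. Qed.

Let qq r s := qpow al s * qpow be (r - s).

Let qq_scale r s : 0 < r -> qq r (r * s) = cpow r%:C (al + be - 2) * qq 1 s.
Proof.
move=> r0; rewrite /qq -[X in X - r * s]mulr1 -mulrBr !qpow_scale//.
rewrite (_ : al + be - 2 = (al - 1) + (be - 1)); last by ring.
by rewrite (cpowD _ (al - 1)); ring.
Qed.

(** The product of two Gamma integrands, sheared. For fixed s = p.1 the second factor is merely
    translated; for fixed r = p.2 the whole is e^-r times the convolution integrand [qq r]. *)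
Let W (p : RT * RT) := gam al 1 p.1 * gam be 1 (p.2 - p.1).

Let WE p : W p = cexp (- p.2%:C) * qq p.2 p.1.
Proof.
rewrite /W /gam /qq !mulr1 (_ : - p.2%:C = - p.1%:C + - (p.2 - p.1)%:C); last first.
  by rewrite -opprD -rmorphD addrC subrK.
by rewrite cexpD; ring.
Qed.

Let mW : cmeasurable setT W.
Proof.
apply: cmeasurableM; first exact: (cmeasurable_comp (h := fst) (cmeasurable_gam al 1)).
apply: (cmeasurable_comp (h := fun p : RT * RT => p.2 - p.1 : RT) (cmeasurable_gam be 1)).
by apply: measurable_funB; [exact: measurable_snd|exact: measurable_fst].
Qed.

Let Ia : cintegrable mu setT (gam al 1). Proof. exact: cintegrable_gam. Qed.
Let Ib : cintegrable mu setT (gam be 1). Proof. exact: cintegrable_gam. Qed.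

Let IW : cintegrable (mu \x mu)%E setT W.
Proof.
apply: (cintegrable_tonelli1 mW).
have Na := cintegrable_normc measurableT Ia.
have Nb := cintegrable_normc measurableT Ib.
pose B := (\int[mu]_y (normc (gam be 1 y))%:E)%E.
have E x : (\int[mu]_y (normc (W (x, y)))%:E = (normc (gam al 1 x))%:E * B)%E.
  transitivity (\int[mu]_y ((normc (gam al 1 x))%:E * (normc (gam be 1 (1 * y + - x)))%:E))%E.
    by apply: eq_integral => y _; rewrite /W Normc.normcM EFinM mul1r.
  rewrite ge0_integralZl//; last 3 first.
  - apply/measurable_EFinP; apply: measurable_normc.
    exact: (cmeasurable_comp (h := fun y : RT => 1 * y + - x : RT) (cmeasurable_gam be 1) (measurable_affine _ _)).
  - by move=> y _; rewrite lee_fin normc_ge0.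
  - by rewrite lee_fin normc_ge0.
  congr (_ * _)%E; rewrite /B (@ge0_integral_affine _ 1 (- x))// ?normr1 ?mul1e ?oner_eq0//.
    by apply/measurable_EFinP; apply: measurable_normc; exact: cmeasurable_gam.
  by move=> y; rewrite lee_fin normc_ge0.
have B0 : (0 <= B)%E by apply: integral_ge0 => y _; rewrite lee_fin normc_ge0.
have Boo : (B < +oo)%E by have [_] := (cintegrableP _ _ measurableT).1 Ib.
have Bf : B \is a fin_num by rewrite ge0_fin_numE.
apply: (@le_lt_trans _ _ (\int[mu]_x ((normc (gam al 1 x))%:E * B))%E).
  by rewrite le_eqVlt; apply/orP; left; apply/eqP; apply: eq_integral => x _; exact: E.
rewrite -(fineK Bf) ge0_integralZr//; last 3 first.
- by apply/measurable_EFinP; apply: measurable_normc; exact: cmeasurable_gam.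
- by move=> y _; rewrite lee_fin normc_ge0.
- by rewrite lee_fin fine_ge0.
have [_ Aoo] := (cintegrableP _ _ measurableT).1 Ia.
have A0 : (0 <= \int[mu]_x (normc (gam al 1 x))%:E)%E.
  by apply: integral_ge0 => y _; rewrite lee_fin normc_ge0.
apply: lte_mul_pinfty => //; first by rewrite ge0_fin_numE.
exact: ltry.
Qed.

Let qq1_of r : 0 < r -> cintegrable mu setT (qq r) -> cintegrable mu setT (qq 1).
Proof.
move=> r0 /(cintegrable_affine 0 (lt0r_neq0 r0)) I1.
apply: eq_cintegrable (cintegrableZl (cpow r%:C (al + be - 2))^-1 measurableT I1) => // s _.
by rewrite addr0 qq_scale// mulKf// cpow_neq0.
Qed.

(** Fubini gives integrable sections only for almost every r. Since ]0, 1[ is not null, some r > 0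
    is good, and homogeneity carries integrability from that r to 1. *)
Let I1 : cintegrable mu setT (qq 1).
Proof.
suff [r r0 Ir] : exists2 r, 0 < r & cintegrable mu setT (fun s => W (s, r)).
  apply: (qq1_of r0).
  apply: eq_cintegrable (cintegrableZl (cexp (- r%:C))^-1 measurableT Ir) => // s _.
  by rewrite WE mulKf// cexp_neq0.
have [Wr Wi] := IW.
have [N1 [mN1 N10 sub1]] := ae_integrable2 Wr.
have [N2 [mN2 N20 sub2]] := ae_integrable2 Wi.
have N0 : mu (N1 `|` N2) = 0%E by apply: null_set_setU.
have [r [r0 rN]] : exists r, 0 < r /\ ~ (N1 `|` N2) r.
  apply: contrapT => H; have sub : `]0, 1[%classic `<=` N1 `|` N2.
    move=> r /=; rewrite in_itv/= => /andP[r0 _]; apply: contrapT => rN.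
    by apply: H; exists r.
  have : (mu `]0%R, 1%R[%classic <= mu (N1 `|` N2))%E.
    by apply: le_measure => //; rewrite inE; [exact: measurable_itv|exact: measurableU].
  by rewrite N0 lebesgue_measure_itv/= lte_fin ltr01 oppr0 adde0 lee_fin ler10.
exists r => //; split.
  by apply: contrapT => nI; apply: rN; left; exact: sub1.
by apply: contrapT => nI; apply: rN; right; exact: sub2.
Qed.

Let Iqq r : cintegrable mu setT (qq r).
Proof.
have [r0|r0] := ltP 0 r; last first.
  apply: (@eq_cintegrable _ _ _ mu setT (fun=> 0)) => //; last by split; exact: integrable0.
  move=> s _; rewrite /qq; have [s0|s0] := ltP 0 s; last by rewrite qpow_le0 ?mul0r.
  by rewrite (@qpow_le0 _ be) ?mulr0// subr_le0 (le_trans r0) ?ltW.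
have rV : r^-1 != 0 by rewrite invr_eq0 lt0r_neq0.
apply: eq_cintegrable (cintegrableZl (cpow r%:C (al + be - 2)) measurableT
  (cintegrable_affine 0 rV I1)) => // s _.
by rewrite addr0 -qq_scale// mulVKf// lt0r_neq0.
Qed.

Let qqE r : cintegral mu setT (qq r) = cintegral mu setT (qq 1) * qpow (al + be) r.
Proof.
have [r0|r0] := ltP 0 r; last first.
  rewrite (qpow_le0 _ r0) mulr0 (@eq_cintegral _ _ _ mu setT _ (fun=> 0)) ?cintegral0//.
  move=> s _; rewrite /qq; have [s0|s0] := ltP 0 s; last by rewrite qpow_le0 ?mul0r.
  by rewrite (@qpow_le0 _ be) ?mulr0// subr_le0 (le_trans r0) ?ltW.
rewrite (cintegral_affine 0 (lt0r_neq0 r0) (Iqq r)).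
rewrite (@eq_cintegral _ _ _ mu setT _ (fun s => cpow r%:C (al + be - 2) * qq 1 s)); last first.
  by move=> s _; rewrite addr0 qq_scale.
rewrite cintegralZl// mulrA mulrC; congr (_ * _); rewrite gtr0_norm// /qpow r0.
have c1 : cpow r%:C 1 = r%:C by rewrite -[1]/(1%:R) cpow_nat.
by rewrite -{1}c1 -cpowD; congr cpow; ring.
Qed.

(* By homogeneity the convolution is B * r^(al+be-1); integrating against e^-r gives
   Gamma(al) Gamma(be) = B Gamma(al+be). *)
Lemma qpow_convolution r :
  cintegrable mu setT (fun s => qpow al s * qpow be (r - s)) /\
  cintegral mu setT (fun s => qpow al s * qpow be (r - s)) =
  cGamma al * cGamma be / cGamma (al + be) * qpow (al + be) r.
Proof.
split; first exact: Iqq.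
rewrite [LHS]qqE; congr (_ * _).
have L : cintegral (mu \x mu)%E setT W = cGamma al * cGamma be.
  rewrite -(cintegral_fubini1 IW) !cGammaE /Gint mulrC -cintegralZl//.
  apply: eq_cintegral => s _; rewrite /W/= cintegralZl//; last first.
    by apply: eq_cintegrable (cintegrable_affine (- s) (oner_neq0 R) Ib) => // y _; rewrite mul1r.
  rewrite mulrC (cintegral_affine (- s) (oner_neq0 R) Ib) normr1 mul1r; congr (_ * _).
  by apply: eq_cintegral => y _; rewrite mul1r.
have H : cintegral (mu \x mu)%E setT W = cintegral mu setT (qq 1) * cGamma (al + be).
  rewrite -(cintegral_fubini2 IW) cGammaE /Gint -cintegralZl//; last exact: cintegrable_gam ab0 _.
  apply: eq_cintegral => r' _.
  transitivity (cintegral mu setT (fun s => cexp (- r'%:C) * qq r' s)).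
    by apply: eq_cintegral => s _; rewrite WE.
  by rewrite cintegralZl// qqE mulrCA /gam mulr1 (mulrC (qpow _ _)).
by rewrite -L H mulfK// cGamma_neq0.
Qed.

End convolution.

Section dirichlet_integral.
Context {R : realType}.
Local Notation mu := (@lebesgue_measure R).
Local Notation RT := (measurableTypeR R).

(** The Dirichlet density without its constant, on the simplex of size [r]. The size is a parameter
    because fixing one coordinate x leaves a kernel of the same kind of size r - x. *)
Definition dirk k (la : 'I_k -> R[i]) al r (s : k.-tuple R) : R[i] :=
  (\prod_j qpow (la j) (tnth s j)) * qpow al (r - \sum_j tnth s j).

Lemma cmeasurable_dirk k (la : 'I_k -> R[i]) al r :
  cmeasurable setT (dirk la al r : k.-tuple RT -> R[i]).
Proof.
apply: cmeasurableM.
  exact: (cmeasurable_tuple_prod (f := fun j => qpow (la j)) (fun j => cmeasurable_qpow (la j))).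
apply: (cmeasurable_comp (h := fun s : k.-tuple RT => r - \sum_j tnth s j : RT) (cmeasurable_qpow al)).
apply: measurable_funB => //; apply: measurable_sum => j; exact: measurable_tnth.
Qed.

(** Taking moduli replaces the parameters by their real parts, so an evaluation valid for all
    parameters also controls absolute convergence. *)
Lemma normc_dirk k (la : 'I_k -> R[i]) al r s :
  (normc (dirk la al r s))%:C = dirk (fun j => (Re (la j))%:C) (Re al)%:C r s.
Proof.
rewrite /dirk Normc.normcM normc_prod rmorphM rmorph_prod qpow_real -normc_qpow_Re.
by congr (_ * _); apply: eq_bigr => j _; rewrite [RHS]qpow_real -normc_qpow_Re.
Qed.

Lemma dirk_cons k (la : 'I_k.+1 -> R[i]) al r (p : RT * k.-tuple RT) :
  dirk la al r (tuple_cons p) =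
  qpow (la ord0) p.1 * dirk (fun j => la (lift ord0 j)) al (r - p.1) p.2.
Proof.
rewrite /dirk !big_ord_recl mulrA; congr (_ * _ * qpow _ _).
  by apply: eq_bigr => j _; rewrite tnthS.
by rewrite opprD addrA; congr (_ - _ - _); apply: eq_bigr => j _; rewrite tnthS.
Qed.

(** Induction on [k]: integrating out all coordinates but the first, x, leaves a constant times (r -
    x)^(S-1), and the last integration is one more convolution of powers. The intermediate Gamma(S)
    cancels. *)
Lemma dirichlet_integral k (la : 'I_k -> R[i]) al r :
  (forall j, 0 < Re (la j)) -> 0 < Re al ->
  cintegrable (lebesgue_tuple R k) setT (dirk la al r) /\
  cintegral (lebesgue_tuple R k) setT (dirk la al r) =
  (\prod_j cGamma (la j)) * cGamma al / cGamma (\sum_j la j + al)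
  * qpow (\sum_j la j + al) r.
Proof.
elim: k la al r => [|k IH] la al r la0 al0.
  have [I0 ->] := cintegral_tuple0 (cmeasurable_dirk la al r); split => //.
  by rewrite /dirk !big_ord0 subr0 !mul1r add0r divff ?mul1r// cGamma_neq0.
pose la' j := la (lift ord0 j).
have IHc r' := IH la' al r' (fun j => la0 _) al0.
have la'0 j : 0 < Re ((Re (la' j))%:C) by exact: la0.
have alr : 0 < Re ((Re al)%:C) by [].
have IHr r' := IH (fun j => (Re (la' j))%:C) (Re al)%:C r' la'0 alr.
have pos (la1 : 'I_k -> R[i]) al1 : (forall j, 0 < Re (la1 j)) -> 0 < Re al1 ->
    0 < Re (\sum_j la1 j + al1).
  by move=> h1 h2; rewrite ReD Re_sum ltr_wpDl// sumr_ge0// => j _; exact/ltW.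
have mf := cmeasurable_dirk la al r.
have mfc : cmeasurable setT (fun p : RT * k.-tuple RT => dirk la al r (tuple_cons p)).
  exact: (cmeasurable_comp mf (measurable_tuple_cons (k := k))).
have If : cintegrable (mu \x lebesgue_tuple R k)%E setT (fun p => dirk la al r (tuple_cons p)).
  apply: (cintegrable_tonelli1 mfc).
  (* The induction hypothesis at the real parts evaluates the inner integral of the modulus: it is
     again a power of r - x, and [qpow_convolution] makes the outer integral finite. *)
  set S := \sum_j (Re (la' j))%:C + (Re al)%:C in IHr.
  set K := (\prod_j cGamma (Re (la' j))%:C) * cGamma (Re al)%:C / cGamma S in IHr.
  have S0 : 0 < Re S by exact: pos.
  have [Iq _] := qpow_convolution (la0 ord0) S0 r.
  have [_] := (cintegrableP _ _ measurableT).1 (cintegrableZl K measurableT Iq).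
  apply: le_lt_trans; rewrite le_eqVlt; apply/orP; left; apply/eqP.
  apply: eq_integral => x _.
  have [Ix Ex] := IHr (r - x).
  have Nx := cintegrable_normc measurableT (IHc (r - x)).1.
  transitivity (\int[lebesgue_tuple R k]_y ((normc (qpow (la ord0) x))%:E * (normc (dirk la' al (r - x) y))%:E))%E.
    by apply: eq_integral => y _; rewrite dirk_cons/= Normc.normcM EFinM.
  rewrite integralZl// -(fineK (integrable_fin_num measurableT Nx)) -EFinM; congr EFin.
  rewrite (Normc.normcM K) (Normc.normcM (qpow (la ord0) x)) mulrCA; congr (_ * _).
  rewrite -Normc.normcM -Ex.
  rewrite (_ : cintegral _ _ _ = (\int[lebesgue_tuple R k]_y normc (dirk la' al (r - x) y))%:C).
    by rewrite normc_real_ge0// Rintegral_ge0// => y _; exact: normc_ge0.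
  by rewrite -cintegral_real; apply: eq_cintegral => y _; rewrite normc_dirk.
split; first exact: cintegrable_tupleS.
rewrite cintegral_tupleS// -(cintegral_fubini1 If).
set S := \sum_j la' j + al in IHc.
set K := (\prod_j cGamma (la' j)) * cGamma al / cGamma S in IHc.
have S0 : 0 < Re S by exact: pos.
have [Iq Eq] := qpow_convolution (la0 ord0) S0 r.
transitivity (cintegral mu setT (fun x => K * (qpow (la ord0) x * qpow S (r - x)))).
  apply: eq_cintegral => x _.
  rewrite mulrCA -(IHc (r - x)).2 -cintegralZl//; last exact: (IHc (r - x)).1.
  by apply: eq_cintegral => y _; rewrite dirk_cons.
rewrite cintegralZl// Eq !big_ord_recl -addrA -/S mulrA; congr (_ * _).
have GS : cGamma S != 0 by exact: cGamma_neq0.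
have GS0 : cGamma (la ord0 + S) != 0 by apply: cGamma_neq0; rewrite ReD addr_gt0.
by rewrite /K; field; rewrite GS GS0.
Qed.

End dirichlet_integral.

(** * Coordinate hyperplanes and the face of sum 1 are null *)

Section tuple_null.
Context {R : realType}.
Local Notation mu := (@lebesgue_measure R).
Local Notation RT := (measurableTypeR R).

Lemma tuple_null_head k (A : set (k.+1.-tuple RT)) : measurable A ->
  (forall t : k.-tuple RT, mu [set x | A (tuple_cons (x, t))] = 0%E) ->
  lebesgue_tuple R k.+1 A = 0%E.
Proof.
move=> mA A0; pose B := @tuple_cons R k @^-1` A.
have mB : measurable B by rewrite -[B]setTI; exact: (measurable_tuple_cons (k := k)).
change ((mu \x lebesgue_tuple R k)%E B = 0%E).
have := indic_fubini_tonelli mu (lebesgue_tuple R k) mB.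
rewrite indic_fubini_tonelli_FE// indic_fubini_tonelli_GE// => E.
rewrite [LHS]E integral0_eq// => t _ /=; rewrite -[RHS](A0 t); congr (mu _).
by apply/seteqP; split => x; rewrite /ysection/= inE.
Qed.

Lemma tuple_null_tail k (A : set (k.+1.-tuple RT)) : measurable A ->
  (forall x, lebesgue_tuple R k [set t | A (tuple_cons (x, t))] = 0%E) ->
  lebesgue_tuple R k.+1 A = 0%E.
Proof.
move=> mA A0; pose B := @tuple_cons R k @^-1` A.
change ((mu \x lebesgue_tuple R k)%E B = 0%E).
rewrite [LHS]integral0_eq// => x _ /=; rewrite -[RHS](A0 x); congr (lebesgue_tuple R k _).
by apply/seteqP; split => t; rewrite /xsection/= inE.
Qed.

Lemma measurable_fun_level d (T : measurableType d) (f : T -> R) (a : R) :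
  measurable_fun setT f -> measurable [set x | f x = a].
Proof.
move=> mf; rewrite (_ : [set x | _] = setT `&` f @^-1` [set a]); last by rewrite setTI.
by apply: mf => //; exact: measurable_set1.
Qed.

Lemma tuple_null_coord k (j : 'I_k) (a : R) :
  lebesgue_tuple R k [set s | tnth s j = a] = 0%E.
Proof.
elim: k j => [[]//|k IH j].
have mA : measurable [set s : k.+1.-tuple RT | tnth s j = a].
  by apply: measurable_fun_level; exact: measurable_tnth.
have [j' ->|->] := unliftP ord0 j.
  apply: tuple_null_tail => [|x]; first by apply: measurable_fun_level; exact: measurable_tnth.
  rewrite -[RHS](IH j'); congr (lebesgue_tuple R k _).
  by apply/seteqP; split => t /=; rewrite tnthS.
apply: tuple_null_head => [|t]; first by apply: measurable_fun_level; exact: measurable_tnth.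
rewrite (_ : [set x | _] = [set a]); first exact: lebesgue_measure_set1.
by apply/seteqP; split => x.
Qed.

Lemma tuple_null_sum k (a : R) : (0 < k)%N ->
  lebesgue_tuple R k [set s | \sum_j tnth s j = a] = 0%E.
Proof.
case: k => // k _.
apply: tuple_null_head => [|t].
  by apply: measurable_fun_level; apply: measurable_sum => j; exact: measurable_tnth.
rewrite (_ : [set x | _] = [set a - \sum_j tnth t j]); first exact: lebesgue_measure_set1.
have E x : \sum_(j < k.+1) tnth (tuple_cons (x, t)) j = x + \sum_j tnth t j.
  by rewrite big_ord_recl; congr (_ + _); apply: eq_bigr => j _; rewrite tnthS.
by apply/seteqP; split => x /=; rewrite E; [move=> <-; rewrite addrK|move=> ->; rewrite subrK].
Qed.

(** On the faces of the simplex [cpow] takes a dummy value at 0 whereas [qpow] vanishes; the two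
    descriptions of the Dirichlet density need only agree off these faces. *)
Lemma tuple_ae_off k (P : k.-tuple RT -> Prop) : (0 < k)%N ->
  (forall s, (forall j, tnth s j != 0) -> \sum_j tnth s j != 1 -> P s) ->
  {ae lebesgue_tuple R k, forall s, P s}.
Proof.
move=> k0 HP.
have H1 : {ae lebesgue_tuple R k, forall s, \sum_j tnth s j != 1}.
  exists [set s | \sum_j tnth s j = 1]; split.
  - by apply: measurable_fun_level; apply: measurable_sum => j; exact: measurable_tnth.
  - exact: tuple_null_sum.
  - by move=> s /= /negP; rewrite negbK => /eqP.
(* Indexed by all natural numbers, so that the countable intersection of almost-sure statements
   applies; indices beyond [k] are vacuous. *)
have H2 : {ae lebesgue_tuple R k, forall s, forall n, forall h : (n < k)%N, tnth s (Ordinal h) != 0}.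
  apply: ae_foralln => n; have [h|h] : (n < k)%N \/ ~~ (n < k)%N by apply/orP; rewrite orbN.
  2: by apply: aeW => s h'; exfalso; rewrite h' in h.
  exists [set s | tnth s (Ordinal h) = 0]; split.
  - by apply: measurable_fun_level; exact: measurable_tnth.
  - exact: tuple_null_coord.
  - move=> s /= H; apply: contrapT => s0; apply: H => h'.
    by rewrite (bool_irrelevance h' h); exact/eqP.
have [N1 [mN1 N10 sub1]] := H1; have [N2 [mN2 N20 sub2]] := H2.
exists (N1 `|` N2); split; [exact: measurableU|exact: null_set_setU|].
move=> s /= nPs; apply: contrapT => /not_orP[n1 n2]; apply: nPs; apply: HP.
  by move=> -[n h]; apply: contrapT => H; apply: n2; apply: sub2 => /= /(_ n h).
by apply: contrapT => H; apply: n1; exact: sub1.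
Qed.

End tuple_null.

Section real_powers.
Context {R : realType}.
Local Notation mu := (@lebesgue_measure R).
Local Notation RT := (measurableTypeR R).

(** On the real axis the argument is a step function: [acos 1], [acos (-1)], and [acos 0] at the
    origin, where 0 / 0 = 0. *)
Lemma cmeasurable_cpow_real d (T : measurableType d) (h : T -> R) w :
  measurable_fun setT h -> cmeasurable setT (fun x => cpow (h x)%:C w).
Proof.
move=> mh; apply: measurable_cexp; apply: cmeasurableM; first exact: cmeasurable_cst.
apply: (cmeasurable_comp (f := fun t : RT => clog t%:C) _ mh); split.
  rewrite (_ : (fun _ => _) = fun t : R => ln `|t|); last first.
    by apply/funext => t; rewrite /clog normc_real.
  apply: (measurableT_comp (f := @ln R)); first exact: measurable_ln.
  exact: (measurableT_comp (f := @Num.norm R R)).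
rewrite (_ : (fun _ => _) = fun t : R => if 0 < t then acos 1 else
    if t < 0 then acos (-1) else acos 0).
  apply: measurable_fun_ifT => //; first exact: measurable_fun_ltr.
  by apply: measurable_fun_ifT => //; exact: measurable_fun_ltr.
apply/funext => t; rewrite /clog/= /carg normc_real [Re _]/= [Im _]/= lexx.
have [t0|t0|<-] := ltgtP 0 t; last by rewrite mul0r.
- by rewrite gtr0_norm// divff// gt_eqF.
- by rewrite ltr0_norm// invrN mulrN divff// lt_eqF.
Qed.

End real_powers.

Section beta_moments.
Context {R : realType}.
Local Notation mu := (@lebesgue_measure R).
Local Notation RT := (measurableTypeR R).
Variables (g h : R[i]).
Hypotheses (h0 : 0 < Re h) (hg : Re h < Re g).

Definition beta_ext (t : R) : R[i] :=
  if 0 <= t <= 1 then beta_density h (g - h) t else 0.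

Let b0 : 0 < Re (g - h). Proof. by rewrite ReD ReN subr_gt0. Qed.
Let g0 : 0 < Re g. Proof. exact: lt_trans hg. Qed.

Lemma cmeasurable_beta_ext : cmeasurable setT (beta_ext : RT -> R[i]).
Proof.
apply: cmeasurable_if; last exact: cmeasurable_cst.
  by apply: measurable_and; exact: measurable_fun_ler.
apply: cmeasurableM.
  apply: cmeasurableM; first exact: cmeasurable_cst.
  exact: cmeasurable_cpow_real.
under eq_fun => t do rewrite -[1]/(1%:C) -rmorphB.
by apply: cmeasurable_cpow_real; exact: measurable_funB.
Qed.

Let K := cGamma g / (cGamma h * cGamma (g - h)).

(** The endpoints are excluded because [cpow] has a nonzero dummy value at 0, while [qpow] is 0
    there. *)
Let beta_extE t : t != 0 -> t != 1 ->
  beta_ext t = K * (qpow h t * qpow (g - h) (1 - t)).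
Proof.
move=> t0 t1; rewrite /beta_ext; case: ifPn => [/andP[ta tb]|].
  rewrite /beta_density addrC subrK /K /qpow lt_neqAle eq_sym t0 ta/= subr_gt0.
  by rewrite lt_neqAle t1 tb/= rmorphB mulrA.
rewrite negb_and -!ltNge => /orP[ta|ta].
  by rewrite qpow_le0 ?ltW// mul0r mulr0.
by rewrite (@qpow_le0 _ (g - h)) ?subr_le0 ?ltW// !mulr0.
Qed.

(** Multiplication by t^n shifts [h] to h + n, so the moment is a quotient of two Beta constants,
    read off from the convolution at r = 1. *)
Lemma beta_moment n :
  cintegrable mu setT (fun t => t%:C ^+ n * beta_ext t) /\
  cintegral mu setT (fun t => t%:C ^+ n * beta_ext t) = poch h n / poch g n.
Proof.
have hn0 : 0 < Re (h + n%:R) by rewrite ReD Re_nat ltr_wpDr.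
have [I0 E0] := qpow_convolution hn0 b0 1.
have mt : cmeasurable setT (fun t : RT => t%:C ^+ n * beta_ext t).
  by apply: cmeasurableM cmeasurable_beta_ext; apply: cmeasurableX; exact: cmeasurable_real.
pose F t := K * (qpow (h + n%:R) t * qpow (g - h) (1 - t)).
have IF : cintegrable mu setT F by exact: cintegrableZl.
have FE : {ae mu, forall t, setT t -> F t = t%:C ^+ n * beta_ext t}.
  have n01 : mu ([set 0] `|` [set 1]) = 0%E.
    have mz (a : R) : measurable ([set a] : set RT) by exact: measurable_set1.
    have m0 (a : R) : mu [set a] = 0%E by exact: lebesgue_measure_set1.
    exact: (null_set_setU (mz 0) (mz 1) (m0 0) (m0 1)).
  exists ([set 0] `|` [set 1]); split => //.
    by apply: measurableU; exact: measurable_set1.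
  move=> t /= /not_implyP[_ H]; apply: contrapT => /not_orP[/eqP t0 /eqP t1]; apply: H.
  by rewrite /F beta_extE// qpowDn; ring.
split; first exact: (ae_eq_cintegrable measurableT (cintegrable_cmeasurable IF) mt FE).
rewrite -(ae_eq_cintegral measurableT (cintegrable_cmeasurable IF) mt FE).
rewrite cintegralZl// E0 qpowE// ln1 mulr0 cexp0 mulr1.
rewrite (_ : h + n%:R + (g - h) = g + n%:R); last by ring.
rewrite !cGamma_poch// /K.
have Gg : cGamma g != 0 by exact: cGamma_neq0.
have Gh : cGamma h != 0 by exact: cGamma_neq0.
have Gb : cGamma (g - h) != 0 by exact: cGamma_neq0.
have Pg : poch g n != 0.
  by apply/prodf_neq0 => i _; rewrite Re_gt0_neq0// ReD Re_nat ltr_wpDr.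
by field; rewrite Gg Gh Gb Pg.
Qed.

End beta_moments.

Section dirichlet_moments.
Context {R : realType} (k : nat).
Local Notation RT := (measurableTypeR R).
Hypothesis k0 : (0 < k)%N.
Variables (g : R[i]) (h : 'rV[R[i]]_k).
Hypotheses (h0 : vRe_gt0 h) (hg : Re (vsum h) < Re g).

Definition dirichlet_ext (s : k.-tuple R) : R[i] :=
  if s \in simplex R k then dirichlet_density h (g - vsum h) s else 0.

Let b0 : 0 < Re (g - vsum h). Proof. by rewrite ReD ReN subr_gt0. Qed.
Let g0 : 0 < Re g.
Proof.
by apply: le_lt_trans hg; rewrite /vsum Re_sum sumr_ge0// => j _; exact/ltW/h0.
Qed.

Lemma measurable_simplex : measurable (simplex R k : set (k.-tuple RT)).
Proof.
rewrite (_ : simplex R k = (\bigcap_(j in [set: 'I_k]) [set s | 0 <= tnth s j]) `&`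
    [set s | \sum_j tnth s j <= 1]); last first.
  apply/seteqP; split => [s [s0 s1]|s [s0 s1]]; split => // j; [move=> _; exact: s0|exact: s0].
apply: measurableI.
  apply: fin_bigcap_measurable => // j _.
  have mj : measurable_fun setT (fun s : k.-tuple RT => 0 <= tnth s j).
    by apply: measurable_fun_ler => //; exact: measurable_tnth.
  rewrite (_ : [set s | _] = setT `&` (fun s : k.-tuple RT => 0 <= tnth s j) @^-1` [set true]).
    exact: mj.
  by rewrite setTI; apply/seteqP; split.
have ms : measurable_fun setT (fun s : k.-tuple RT => \sum_j tnth s j <= 1).
  by apply: measurable_fun_ler => //; apply: measurable_sum => j; exact: measurable_tnth.
rewrite (_ : [set s | _] = setT `&` (fun s : k.-tuple RT => \sum_j tnth s j <= 1) @^-1` [set true]).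
  exact: ms.
by rewrite setTI; apply/seteqP; split.
Qed.

Let vsum_vreal (s : k.-tuple R) : 1 - vsum (vreal s) = (1 - \sum_j tnth s j)%:C.
Proof.
rewrite rmorphB rmorph_sum; congr (_ - _); apply: eq_bigr => j _; by rewrite mxE.
Qed.

Lemma cmeasurable_dirichlet_ext : cmeasurable setT (dirichlet_ext : k.-tuple RT -> R[i]).
Proof.
apply: cmeasurable_if; last exact: cmeasurable_cst.
  apply: (measurable_fun_bool true); rewrite setTI.
  rewrite (_ : _ @^-1` _ = simplex R k); first exact: measurable_simplex.
  by apply/seteqP; split => s /=; [move/set_mem|move/mem_set].
apply: cmeasurableM.
  apply: cmeasurableM; first exact: cmeasurable_cst.
  apply: cmeasurable_prod => j; under eq_fun do rewrite mxE.
  by apply: cmeasurable_cpow_real; exact: measurable_tnth.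
under eq_fun do rewrite vsum_vreal.
apply: cmeasurable_cpow_real; apply: measurable_funB => //.
by apply: measurable_sum => j; exact: measurable_tnth.
Qed.

Let K := cGamma g / ((\prod_j cGamma (h 0 j)) * cGamma (g - vsum h)).

Let dirichlet_extE s : (forall j, tnth s j != 0) -> \sum_j tnth s j != 1 ->
  dirichlet_ext s = K * dirk (fun j => h 0 j) (g - vsum h) 1 s.
Proof.
move=> s0 s1; rewrite /dirichlet_ext /dirk; case: ifPn => [/set_mem[sa sb]|].
  rewrite /dirichlet_density addrC subrK -/K vsum_vreal -mulrA; congr (_ * (_ * _)).
    by apply: eq_bigr => j _; rewrite mxE /qpow lt_neqAle eq_sym s0 sa.
  by rewrite /qpow subr_gt0 lt_neqAle s1 sb.
move/negP => H; have [sa|] := boolP [forall j, 0 <= tnth s j]; last first.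
  rewrite negb_forall => /existsP[j]; rewrite -ltNge => sj.
  by rewrite (bigD1 j)//= qpow_le0 ?(ltW sj)// !mul0r mulr0.
rewrite (@qpow_le0 _ (g - vsum h)) ?mulr0// subr_le0 leNgt; apply/negP => sb.
by apply: H; apply/mem_set; split; [exact/forallP|exact: ltW].
Qed.

(** As for the Beta density: the monomial shifts each h_j to h_j + n_j, and the Dirichlet integral
    on the unit simplex is evaluated at the shifted parameters. *)
Lemma dirichlet_moment (n : 'I_k -> nat) :
  cintegrable (lebesgue_tuple R k) setT
    (fun s => (\prod_j (tnth s j)%:C ^+ n j) * dirichlet_ext s) /\
  cintegral (lebesgue_tuple R k) setT
    (fun s => (\prod_j (tnth s j)%:C ^+ n j) * dirichlet_ext s) =
  (\prod_j poch (h 0 j) (n j)) / poch g (\sum_j n j)%N.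
Proof.
have hn0 j : 0 < Re (h 0 j + (n j)%:R) by rewrite ReD Re_nat ltr_wpDr// h0.
have [I0 E0] := dirichlet_integral 1 hn0 b0.
have mt : cmeasurable setT (fun s : k.-tuple RT => (\prod_j (tnth s j)%:C ^+ n j) * dirichlet_ext s).
  apply: cmeasurableM cmeasurable_dirichlet_ext; apply: cmeasurable_prod => j.
  by apply: cmeasurableX; apply: cmeasurable_real; exact: measurable_tnth.
pose F s := K * dirk (fun j => h 0 j + (n j)%:R) (g - vsum h) 1 s.
have IF : cintegrable (lebesgue_tuple R k) setT F by exact: cintegrableZl.
have FE : {ae lebesgue_tuple R k, forall s, setT s -> F s = (\prod_j (tnth s j)%:C ^+ n j) * dirichlet_ext s}.
  apply: tuple_ae_off => // s s0 s1 _.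
  rewrite dirichlet_extE// /F /dirk; under eq_bigr do rewrite qpowDn.
  by rewrite big_split/=; ring.
split; first exact: (ae_eq_cintegrable measurableT (cintegrable_cmeasurable IF) mt FE).
rewrite -(ae_eq_cintegral measurableT (cintegrable_cmeasurable IF) mt FE).
rewrite cintegralZl// E0 qpowE// ln1 mulr0 cexp0 mulr1.
have -> : \sum_j (h 0 j + (n j)%:R) + (g - vsum h) = g + (\sum_j n j)%:R.
  by rewrite big_split/= -/(vsum h) natr_sum; ring.
have -> : \prod_j cGamma (h 0 j + (n j)%:R) =
    (\prod_j poch (h 0 j) (n j)) * \prod_j cGamma (h 0 j).
  by rewrite -big_split; apply: eq_bigr => j _; rewrite /= cGamma_poch// h0.
rewrite cGamma_poch// /K.
have Gg : cGamma g != 0 by exact: cGamma_neq0.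
have Gh : \prod_j cGamma (h 0 j) != 0 by apply/prodf_neq0 => j _; apply: cGamma_neq0; exact: h0.
have Gb : cGamma (g - vsum h) != 0 by exact: cGamma_neq0.
have Pg : poch g (\sum_j n j)%N != 0.
  by apply/prodf_neq0 => i _; rewrite Re_gt0_neq0// ReD Re_nat ltr_wpDr.
by field; rewrite Gg Gh Gb Pg.
Qed.

End dirichlet_moments.

(** * Unordered sums *)

Section esum_complements.
Context {R : realType}.
Local Open Scope ereal_scope.

(** Enumeration by [pickle_inv], with 0 at the numbers that code nothing, makes results on
    nonnegative series available for countable families. *)
Lemma esum_enum (I : countType) (a : I -> \bar R) : (forall i, 0 <= a i) ->
  \esum_(i in [set: I]) a i = \sum_(n <oo) oapp a 0 (pickle_inv n).
Proof.
move=> a0; pose a' (n : nat) := oapp a 0 (@pickle_inv I n).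
have a'0 n : 0 <= a' n by rewrite /a'; case: pickle_inv.
rewrite nneseries_esumT//.
transitivity (\esum_(n in range (@pickle I)) a' n).
  rewrite esum_image; last by move=> i j _ _; exact: (pcan_inj (@pickleK I)).
  by apply: eq_esum => i _; rewrite /a' pickleK_inv.
rewrite esum_mkcond; apply: eq_esum => n _; rewrite /a'; case: ifPn => // nI.
case E : (pickle_inv n) => [i|//]; exfalso; move/negP: nI; apply.
by rewrite inE; exists i => //; have := @pickle_invK I n; rewrite E.
Qed.

Lemma ge0_esumZl (I : countType) (a : I -> \bar R) (c : R) : (forall i, 0 <= a i) ->
  (0 <= c)%R -> \esum_(i in [set: I]) (c%:E * a i) = c%:E * \esum_(i in [set: I]) a i.
Proof.
move=> a0 c0; rewrite !esum_enum//; last by move=> i; rewrite mule_ge0.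
rewrite -nneseriesZl; last by move=> n _; case: pickle_inv.
by apply: eq_eseriesr => n _; case: pickle_inv => //=; rewrite mule0.
Qed.

Lemma ge0_esum_prod (I J : choiceType) (a : I * J -> \bar R) : (forall p, 0 <= a p) ->
  \esum_(i in [set: I]) \esum_(j in [set: J]) a (i, j) = \esum_(p in [set: I * J]) a p.
Proof.
move=> a0; rewrite (@esum_esum R I J setT (fun=> setT) (fun i j => a (i, j)))//.
rewrite (_ : _ `*`` _ = setT); last by apply/seteqP; split.
by apply: eq_esum => -[].
Qed.

Lemma ge0_esum_prod2 (I J : choiceType) (a : I * J -> \bar R) : (forall p, 0 <= a p) ->
  \esum_(j in [set: J]) \esum_(i in [set: I]) a (i, j) = \esum_(p in [set: I * J]) a p.
Proof.
move=> a0; rewrite (@ge0_esum_prod J I (fun q => a (q.2, q.1)))//.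
rewrite (@reindex_esum R (J * I)%type (I * J)%type setT setT (fun q => (q.2, q.1)))//.
by split => // [[i j] [i' j'] _ _ [-> ->]//|[i j] _]; exists (j, i).
Qed.

Lemma ge0_integral_esum d (T : measurableType d) (mu : {measure set T -> \bar R})
    (I : countType) (f : I -> T -> \bar R) :
  (forall i, measurable_fun setT (f i)) -> (forall i x, 0 <= f i x) ->
  measurable_fun setT (fun x => \esum_(i in [set: I]) f i x) /\
  \int[mu]_x (\esum_(i in [set: I]) f i x) = \esum_(i in [set: I]) \int[mu]_x f i x.
Proof.
move=> mf f0.
have E : (fun x => \esum_(i in [set: I]) f i x) =
    (fun x => \sum_(n <oo) (oapp f (fun=> 0) (pickle_inv n)) x).
  apply/funext => x; rewrite esum_enum//; apply: eq_eseriesr => n _.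
  by case: pickle_inv.
have mo n : measurable_fun setT (oapp f (fun=> 0) (@pickle_inv I n)).
  by case: pickle_inv => //=; exact: measurable_cst.
have o0 n x : 0 <= (oapp f (fun=> 0) (@pickle_inv I n)) x by case: pickle_inv => /=.
rewrite E; split; first by apply: ge0_emeasurable_sum.
rewrite integral_nneseries// esum_enum; last by move=> i; exact: integral_ge0.
by apply: eq_eseriesr => n _; case: pickle_inv => //=; rewrite integral0.
Qed.

End esum_complements.

Section real_unordered_sum.
Context {R : realType}.
Implicit Types I J : choiceType.

Definition rsummable I (f : I -> R) := (\esum_(i in [set: I]) (`|f i|)%:E < +oo)%E.

Let pos (x : R) := Num.max x 0.
Let neg (x : R) := Num.max (- x) 0.

Let pos_ge0 x : 0 <= pos x. Proof. by rewrite le_max lexx orbT. Qed.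
Let neg_ge0 x : 0 <= neg x. Proof. by rewrite le_max lexx orbT. Qed.
Let posneg x : x = pos x - neg x.
Proof. by rewrite /pos /neg; case: (leP x 0); case: (leP (- x) 0); lra. Qed.
Let pos_le x : pos x <= `|x|. Proof. by rewrite ge_max ler_norm normr_ge0. Qed.
Let neg_le x : neg x <= `|x|.
Proof. by rewrite ge_max normr_ge0 -normrN ler_norm. Qed.

Lemma esum_lty I (a b : I -> R) : (forall i, a i <= b i) ->
  (\esum_(i in [set: I]) (b i)%:E < +oo)%E -> (\esum_(i in [set: I]) (a i)%:E < +oo)%E.
Proof. by move=> ab; apply: le_lt_trans; apply: le_esum => i _; rewrite lee_fin. Qed.

Lemma esum_fin_num I (a : I -> R) : (forall i, 0 <= a i) ->
  (\esum_(i in [set: I]) (a i)%:E < +oo)%E -> (\esum_(i in [set: I]) (a i)%:E)%E \is a fin_num.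
Proof. by move=> a0 h; rewrite ge0_fin_numE// esum_ge0// => i _; rewrite lee_fin. Qed.

Lemma le_rsummable I (f g : I -> R) : (forall i, `|f i| <= g i) ->
  (\esum_(i in [set: I]) (g i)%:E < +oo)%E -> rsummable f.
Proof. by move=> fg; exact: esum_lty. Qed.

(** Any splitting into a difference of nonnegative summable families computes the sum, not only the
    one into positive and negative parts. Additivity rests on this, since the positive part of a sum
    is not the sum of the positive parts. *)
Lemma unordered_sumB I (a b : I -> R) : (forall i, 0 <= a i) -> (forall i, 0 <= b i) ->
  (\esum_(i in [set: I]) (a i)%:E < +oo)%E -> (\esum_(i in [set: I]) (b i)%:E < +oo)%E ->
  unordered_sum (fun i => a i - b i) =
  fine (\esum_(i in [set: I]) (a i)%:E) - fine (\esum_(i in [set: I]) (b i)%:E).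
Proof.
move=> a0 b0 ao bo.
have sa : summable [set: I] (EFin \o a).
  rewrite /summable (eq_esum (b := EFin \o a))// => i _.
  by rewrite /= ger0_norm.
have sb : summable [set: I] (EFin \o b).
  rewrite /summable (eq_esum (b := EFin \o b))// => i _.
  by rewrite /= ger0_norm.
have fa := esum_fin_num a0 ao; have fb := esum_fin_num b0 bo.
have E := esumB sa sb (fun i _ => a0 i) (fun i _ => b0 i).
rewrite -fineB// -[in RHS]E fineB//.
- rewrite ge0_fin_numE ?esum_ge0//; apply: le_lt_trans ao; apply: le_esum => i _.
  by rewrite funeposE /= -EFin_max lee_fin ge_max lerBlDr lerDl b0 a0.
- rewrite ge0_fin_numE ?esum_ge0//; apply: le_lt_trans bo; apply: le_esum => i _.
  by rewrite funenegE /= -EFin_max lee_fin ge_max opprB lerBlDr lerDl b0 a0.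
Qed.

Lemma unordered_sum_posneg I (f : I -> R) : rsummable f ->
  unordered_sum f = fine (\esum_(i in [set: I]) (pos (f i))%:E) -
                    fine (\esum_(i in [set: I]) (neg (f i))%:E).
Proof.
move=> sf; rewrite -unordered_sumB//; first by congr unordered_sum; apply/funext => i.
- exact: esum_lty sf.
- exact: esum_lty sf.
Qed.

Lemma unordered_sumD I (f g : I -> R) : rsummable f -> rsummable g ->
  unordered_sum (fun i => f i + g i) = unordered_sum f + unordered_sum g.
Proof.
move=> sf sg.
have pf := esum_lty (fun i => pos_le (f i)) sf.
have nf := esum_lty (fun i => neg_le (f i)) sf.
have pg := esum_lty (fun i => pos_le (g i)) sg.
have ng := esum_lty (fun i => neg_le (g i)) sg.
have D (a b : I -> R) : (forall i, 0 <= a i) -> (forall i, 0 <= b i) ->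
    (\esum_(i in [set: I]) (a i + b i)%:E =
     \esum_(i in [set: I]) (a i)%:E + \esum_(i in [set: I]) (b i)%:E)%E.
  by move=> a0 b0; rewrite -esumD// => i _; rewrite lee_fin.
transitivity (unordered_sum (fun i => (pos (f i) + pos (g i)) - (neg (f i) + neg (g i)))).
  congr unordered_sum; apply/funext => i.
  by rewrite [in LHS](posneg (f i)) [in LHS](posneg (g i)); ring.
rewrite unordered_sumB ?D ?lte_add_pinfty//; try by move=> i; exact: addr_ge0.
rewrite !fineD ?esum_fin_num// !unordered_sum_posneg//.
by ring.
Qed.

Lemma rsummableZ (I : countType) (f : I -> R) c : rsummable f -> rsummable (fun i => c * f i).
Proof.
move=> sf; rewrite /rsummable; under eq_esum do rewrite normrM EFinM.
by rewrite ge0_esumZl// lte_mul_pinfty.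
Qed.

Lemma unordered_sumZ (I : countType) (f : I -> R) c : rsummable f ->
  unordered_sum (fun i => c * f i) = c * unordered_sum f.
Proof.
move=> sf.
have pf := esum_lty (fun i => pos_le (f i)) sf.
have nf := esum_lty (fun i => neg_le (f i)) sf.
have Z (a : I -> R) r : (forall i, 0 <= a i) -> 0 <= r ->
    (\esum_(i in [set: I]) (a i)%:E < +oo)%E ->
    (\esum_(i in [set: I]) (r * a i)%:E < +oo)%E /\
    fine (\esum_(i in [set: I]) (r * a i)%:E) = r * fine (\esum_(i in [set: I]) (a i)%:E).
  move=> a0 r0 ao; have fa := esum_fin_num a0 ao.
  under eq_esum do rewrite EFinM; rewrite ge0_esumZl//; split.
    by rewrite lte_mul_pinfty// lee_fin.
  by rewrite -(fineK fa).
have [c0|c0] := leP 0 c.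
  have [p1 p2] := Z _ c (fun i => pos_ge0 (f i)) c0 pf.
  have [n1 n2] := Z _ c (fun i => neg_ge0 (f i)) c0 nf.
  rewrite (unordered_sum_posneg sf) mulrBr -p2 -n2 -unordered_sumB//.
  - by congr unordered_sum; apply/funext => i; rewrite -mulrBr -posneg.
  - by move=> i; rewrite mulr_ge0.
  - by move=> i; rewrite mulr_ge0.
have cN : 0 <= - c by rewrite oppr_ge0 ltW.
have [p1 p2] := Z _ (- c) (fun i => pos_ge0 (f i)) cN pf.
have [n1 n2] := Z _ (- c) (fun i => neg_ge0 (f i)) cN nf.
rewrite (unordered_sum_posneg sf) -[RHS]mulrNN opprB mulrBr -p2 -n2 -unordered_sumB//.
- by congr unordered_sum; apply/funext => i; rewrite {1}(posneg (f i)); ring.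
- by move=> i; rewrite mulr_ge0.
- by move=> i; rewrite mulr_ge0.
Qed.

(** Fubini for sums: the nonnegative case applied to the positive and the negative part, which |u|
    dominates. *)
Lemma rsummable_prodP I J (u : I * J -> R) : rsummable u ->
  (forall i, rsummable (fun j => u (i, j))) /\
  rsummable (fun i => unordered_sum (fun j => u (i, j))) /\
  unordered_sum (fun i => unordered_sum (fun j => u (i, j))) = unordered_sum u.
Proof.
move=> su.
have su' := su; rewrite /rsummable -ge0_esum_prod// in su'.
have S i : rsummable (fun j => u (i, j)).
  rewrite /rsummable.
  have H : (\esum_(j in [set: J]) (`|u (i, j)|)%:E <=
      \esum_(i in [set: I]) \esum_(j in [set: J]) (`|u (i, j)|)%:E)%E.
    apply: le_trans (esum_ge _); last first.
      exists [set i]; first by split.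
      exact: lexx.
    by rewrite fsbig_set1.
  exact: le_lt_trans H su'.
have P (a : R -> R) : (forall x, 0 <= a x) -> (forall x, a x <= `|x|) ->
   let A i := fine (\esum_(j in [set: J]) (a (u (i, j)))%:E) in
   [/\ forall i, 0 <= A i, (\esum_(i in [set: I]) (A i)%:E < +oo)%E &
     (\esum_(i in [set: I]) (A i)%:E = \esum_(p in [set: I * J]) (a (u p))%:E)%E].
  move=> a0 ale A.
  have E : (\esum_(i in [set: I]) (A i)%:E = \esum_(p in [set: I * J]) (a (u p))%:E)%E.
    rewrite -ge0_esum_prod//; last by move=> p; rewrite lee_fin.
    apply: eq_esum => i _; rewrite /A fineK// esum_fin_num//.
    exact: esum_lty (S i).
  split => //.
  - by move=> i; rewrite fine_ge0// esum_ge0// => j _; rewrite lee_fin.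
  - by rewrite E; exact: esum_lty su.
have [p0 po pE] := P pos pos_ge0 pos_le.
have [n0 no nE] := P neg neg_ge0 neg_le.
have E i := unordered_sum_posneg (S i).
split => //; split.
  under [X in rsummable X]eq_fun do rewrite E.
  apply: (@le_rsummable _ _ (fun i => fine (\esum_(j in [set: J]) (pos (u (i, j)))%:E) +
     fine (\esum_(j in [set: J]) (neg (u (i, j)))%:E))).
    by move=> i; rewrite (le_trans (ler_normB _ _))// !ger0_norm.
  under eq_esum do rewrite EFinD; rewrite esumD ?lte_add_pinfty// => i _; rewrite lee_fin.
    exact: p0.
  exact: n0.
under [X in unordered_sum X = _]eq_fun do rewrite E.
by rewrite unordered_sumB// pE nE -unordered_sum_posneg.
Qed.

Lemma rsummable_bij I J (e : I -> J) (f : J -> R) : bijective e ->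
  (\esum_(i in [set: I]) (`|f (e i)|)%:E = \esum_(j in [set: J]) (`|f j|)%:E)%E /\
  unordered_sum (fun i => f (e i)) = unordered_sum f.
Proof.
move=> eb; have B : set_bij [set: I] [set: J] e.
  split => // [i i' _ _ /(bij_inj eb)//|j _].
  by have [e' K K'] := eb; exists (e' j).
split; first by rewrite (@reindex_esum R I J setT setT e _ B).
rewrite /unordered_sum; congr (fine _ - fine _).
  by rewrite (@reindex_esum R I J setT setT e _ B); apply: eq_esum => i _; rewrite !funeposE.
by rewrite (@reindex_esum R I J setT setT e _ B); apply: eq_esum => i _; rewrite !funenegE.
Qed.

End real_unordered_sum.

Section finite_support.
Context {R : realType}.

Lemma esum_finite_support (X : finType) (J : choiceType) (e : X -> J) (a : J -> R) :
  injective e -> (forall j, 0 <= a j) -> (forall j, (forall x, e x != j) -> a j = 0) ->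
  (\esum_(j in [set: J]) (a j)%:E)%E = (\sum_x a (e x))%:E.
Proof.
move=> einj a0 aout.
transitivity (\esum_(j in range e) (a j)%:E)%E.
  rewrite [RHS]esum_mkcond; apply: eq_esum => j _; case: ifPn => // jI.
  rewrite aout// => x; apply: contra jI => /eqP <-.
  by rewrite inE; exists x.
rewrite esum_image; last by move=> x y _ _; exact: einj.
have S : [set` index_enum X] = [set: X].
  by apply/seteqP; split => // x _ /=; rewrite mem_index_enum.
rewrite esum_fset//; [|exact: finite_finset|by move=> x _; rewrite lee_fin].
by rewrite -S -fsbig_seq ?index_enum_uniq// sumEFin.
Qed.

(** The support is covered by an injection of a finite type, so that a sum over multi-indices of
    given size becomes a finite sum over bounded ones. *)
Lemma unordered_sum_finite_support (X : finType) (J : choiceType) (e : X -> J) (f : J -> R) :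
  injective e -> (forall j, (forall x, e x != j) -> f j = 0) ->
  rsummable f /\ unordered_sum f = \sum_x f (e x).
Proof.
move=> einj fout.
have E (h : R -> R) : (forall x, 0 <= h x) -> h 0 = 0 ->
    (\esum_(j in [set: J]) (h (f j))%:E)%E = (\sum_x h (f (e x)))%:E.
  move=> hp h0; apply: (esum_finite_support (a := fun j => h (f j))) => // j jo.
  by rewrite fout.
split; first by rewrite /rsummable (E Num.norm)// ?normr0// ltry.
rewrite /unordered_sum.
transitivity (fine (\esum_(j in [set: J]) (Num.max (f j) 0)%:E) -
    fine (\esum_(j in [set: J]) (Num.max (- f j) 0)%:E)).
  congr (fine _ - fine _); apply: eq_esum => j _.
    by rewrite funeposE /= -EFin_max.
  by rewrite funenegE /= -EFin_max.
rewrite (E (fun x => Num.max x 0)) ?maxxx//; last by move=> x; rewrite le_max lexx orbT.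
rewrite (E (fun x => Num.max (- x) 0)) ?oppr0 ?maxxx//; last first.
  by move=> x; rewrite le_max lexx orbT.
rewrite /= -sumrB; apply: eq_bigr => x _.
by case: (leP (f (e x)) 0); case: (leP (- f (e x)) 0); lra.
Qed.

End finite_support.

Section complex_unordered_sum.
Context {R : realType}.
Implicit Types I J : choiceType.

Definition csummable I (f : I -> R[i]) :=
  (\esum_(i in [set: I]) (normc (f i))%:E < +oo)%E.

Lemma csummable_Re I (f : I -> R[i]) : csummable f -> rsummable (fun i => Re (f i)).
Proof. by apply: le_rsummable => i; exact: le_Re_normc. Qed.

Lemma csummable_Im I (f : I -> R[i]) : csummable f -> rsummable (fun i => Im (f i)).
Proof. by apply: le_rsummable => i; exact: le_Im_normc. Qed.

Lemma csummableP I (f : I -> R[i]) :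
  rsummable (fun i => Re (f i)) -> rsummable (fun i => Im (f i)) -> csummable f.
Proof.
move=> sr si; apply: (@esum_lty _ _ _ (fun i => `|Re (f i)| + `|Im (f i)|)).
  by move=> i; exact: normc_le_ReIm.
by under eq_esum do rewrite EFinD; rewrite esumD ?lte_add_pinfty.
Qed.

Lemma le_csummable I (f : I -> R[i]) (g : I -> R) : (forall i, normc (f i) <= g i) ->
  (\esum_(i in [set: I]) (g i)%:E < +oo)%E -> csummable f.
Proof. by move=> fg; exact: esum_lty. Qed.

Lemma eq_csum I (f g : I -> R[i]) : f =1 g -> cunordered_sum f = cunordered_sum g.
Proof. by move=> /funext ->. Qed.

Lemma csumZ (I : countType) (c : R[i]) (f : I -> R[i]) : csummable f ->
  cunordered_sum (fun i => c * f i) = c * cunordered_sum f.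
Proof.
move=> sf; have sr := csummable_Re sf; have si := csummable_Im sf.
apply: complex_eqP; rewrite ?ReM ?ImM/= -!unordered_sumZ//.
  rewrite -[X in _ = X - _]addr0 -mulN1r -unordered_sumZ ?addr0//; last exact: rsummableZ.
  rewrite -unordered_sumD; [|exact: rsummableZ|by apply: rsummableZ; exact: rsummableZ].
  by congr unordered_sum; apply/funext => i; rewrite ReM mulN1r.
rewrite -unordered_sumD; [|exact: rsummableZ|exact: rsummableZ].
by congr unordered_sum; apply/funext => i; rewrite ImM.
Qed.

Lemma csummable_prodP I J (u : I * J -> R[i]) : csummable u ->
  [/\ forall i, csummable (fun j => u (i, j)),
    csummable (fun i => cunordered_sum (fun j => u (i, j))) &
    cunordered_sum (fun i => cunordered_sum (fun j => u (i, j))) = cunordered_sum u].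
Proof.
move=> su; have [r1 [r2 r3]] := rsummable_prodP (csummable_Re su).
have [i1 [i2 i3]] := rsummable_prodP (csummable_Im su).
split; [by move=> i; exact: csummableP|exact: csummableP|].
exact: complex_eqP.
Qed.

Lemma csum_bij I J (e : I -> J) (f : J -> R[i]) : bijective e ->
  csummable f -> csummable (fun i => f (e i)) /\
  cunordered_sum (fun i => f (e i)) = cunordered_sum f.
Proof.
move=> eb sf; have [r1 r2] := rsummable_bij (fun j => Re (f j)) eb.
have [i1 i2] := rsummable_bij (fun j => Im (f j)) eb; split; last exact: complex_eqP.
by apply: csummableP; rewrite /rsummable ?r1 ?i1; [exact: csummable_Re|exact: csummable_Im].
Qed.

Lemma csum_finite_support (X : finType) J (e : X -> J) (f : J -> R[i]) :
  injective e -> (forall j, (forall x, e x != j) -> f j = 0) ->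
  csummable f /\ cunordered_sum f = \sum_x f (e x).
Proof.
move=> einj fout.
have [r1 r2] := unordered_sum_finite_support einj (f := fun j => Re (f j)) (fun j jo => congr1 Re (fout j jo)).
have [i1 i2] := unordered_sum_finite_support einj (f := fun j => Im (f j)) (fun j jo => congr1 Im (fout j jo)).
split; first exact: csummableP.
by apply: complex_eqP; rewrite ?Re_sum ?Im_sum.
Qed.

(** Summation along the fibres of [q]. The array with entry f j where q j = i and 0 elsewhere is
    summed in both orders; for fixed j it has at most one nonzero entry. *)
Lemma csum_regroup I J (q : J -> I) (f : J -> R[i]) : csummable f ->
  csummable (fun i => cunordered_sum (fun j => if q j == i then f j else 0)) /\
  cunordered_sum (fun i => cunordered_sum (fun j => if q j == i then f j else 0)) =
  cunordered_sum f.
Proof.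
move=> sf; pose u (p : J * I) := if q p.1 == p.2 then f p.1 else 0.
pose pt (j : J) (x : 'I_1) := q j.
have S1 (h : J -> R[i]) j : cunordered_sum (fun i => if q j == i then h j else 0) = h j /\
    csummable (fun i => if q j == i then h j else 0).
  have inj : injective (pt j) by move=> a b _; rewrite (ord1 a) (ord1 b).
  have [|s ->] := csum_finite_support inj (f := fun i => if q j == i then h j else 0).
    by move=> i /(_ ord0); rewrite /pt => /negbTE ->.
  by rewrite big_ord1 /pt eqxx.
have su : csummable u.
  rewrite /csummable -ge0_esum_prod; last by move=> p; rewrite lee_fin normc_ge0.
  rewrite (eq_esum (b := fun j => (normc (f j))%:E)) ?sf// => j _.
  have inj : injective (pt j) by move=> a b _; rewrite (ord1 a) (ord1 b).
  rewrite (esum_finite_support (a := fun i => normc (u (j, i))) inj) ?big_ord1 /u /pt/= ?eqxx//.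
    by move=> i; exact: normc_ge0.
  by move=> i /(_ ord0) /negbTE ->; rewrite Normc.normc0.
have sb : bijective (fun p : I * J => (p.2, p.1)) by exists (fun p => (p.2, p.1)) => -[].
have [su' E'] := csum_bij sb su.
have [_ s1 E1] := csummable_prodP su'.
have [_ s2 E2] := csummable_prodP su.
split; first exact: s1.
rewrite [LHS]E1 E' -E2; apply: eq_csum => j.
by have [] := S1 f j.
Qed.

Lemma csum_mul (I J : countType) (f : I -> R[i]) (g : J -> R[i]) :
  csummable f -> csummable g ->
  csummable (fun p : I * J => f p.1 * g p.2) /\
  cunordered_sum (fun p : I * J => f p.1 * g p.2) = cunordered_sum f * cunordered_sum g.
Proof.
move=> sf sg.
have s : csummable (fun p : I * J => f p.1 * g p.2).
  rewrite /csummable -ge0_esum_prod; last by move=> p; rewrite lee_fin normc_ge0.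
  rewrite (eq_esum (b := fun i => (fine (\esum_(j in [set: J]) (normc (g j))%:E))%:E * (normc (f i))%:E)%E).
    rewrite ge0_esumZl; last 2 first.
    - by move=> i; rewrite lee_fin normc_ge0.
    - by rewrite fine_ge0// esum_ge0// => j _; rewrite lee_fin normc_ge0.
    rewrite lte_mul_pinfty// lee_fin fine_ge0// esum_ge0// => j _.
    by rewrite lee_fin normc_ge0.
  move=> i _; rewrite fineK; last by apply: esum_fin_num => // j; exact: normc_ge0.
  transitivity (\esum_(j in [set: J]) ((normc (f i))%:E * (normc (g j))%:E))%E.
    by apply: eq_esum => j _; rewrite -EFinM -Normc.normcM.
  rewrite ge0_esumZl ?normc_ge0 1?muleC// => j; by rewrite lee_fin normc_ge0.
split => //; have [_ _ <-] := csummable_prodP s.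
rewrite (eq_csum (g := fun i => cunordered_sum g * f i)); first by rewrite csumZ// mulrC.
by move=> i /=; rewrite csumZ// mulrC.
Qed.

(** Bridges the two summation conventions: [hyp1F1] is a limit of partial sums, [Psi2] an unordered
    sum. *)
Lemma csum_nat (f : nat -> R[i]) : csummable f -> cseries_sum f = cunordered_sum f.
Proof.
move=> sf.
have key (u : nat -> R) : rsummable u -> limn (series u) = unordered_sum u.
  move=> su; have su' : summable xpredT (EFin \o u).
    by rewrite /summable fun_true; exact: su.
  have cn : cvgn [normed series u].
    have := @summable_cvg R xpredT (abse \o (EFin \o u)) (fun i _ => abse_ge0 _).
    apply; rewrite /summable fun_true.
    by rewrite (eq_esum (b := fun i => (`|u i|)%:E))// => i _ /=; rewrite normr_id.
  have cu := normed_cvg cn.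
  have := summable_eseries_esum su'.
  rewrite (_ : \sum_(i <oo) (EFin \o u) i = (limn (series u))%:E)%E; last first.
    rewrite -EFin_lim//; apply/congr_lim/funext => n /=.
    by rewrite /series/= sumEFin.
  rewrite fun_true => E; rewrite /unordered_sum -fineB; last 2 first.
  - have := summable_funepos su'; rewrite summableE fun_true => H.
    by rewrite (eq_esum (b := fun i => `|(EFin \o u)^\+ i|)%E)// => i _; rewrite gee0_abs.
  - have := summable_funeneg su'; rewrite summableE fun_true => H.
    by rewrite (eq_esum (b := fun i => `|(EFin \o u)^\- i|)%E)// => i _; rewrite gee0_abs.
  by rewrite -[LHS]/(fine (limn (series u))%:E) E.
by rewrite /cseries_sum key ?key//; [exact: csummable_Im|exact: csummable_Re].
Qed.

End complex_unordered_sum.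

Section termwise.
Context d (T : measurableType d) {R : realType}.
Variable mu : {measure set T -> \bar R}.

(** Monotone convergence for the positive and the negative parts separately; each total is finite
    because it is dominated by the sum of the integrals of |f i|. *)
Lemma Rintegral_unordered_sum (I : countType) (f : I -> T -> R) :
  (forall i, measurable_fun setT (f i)) -> (forall x, rsummable (fun i => f i x)) ->
  (\esum_(i in [set: I]) \int[mu]_x (`|f i x|)%:E < +oo)%E ->
  mu.-integrable setT (EFin \o (fun x => unordered_sum (fun i => f i x))) /\
  \int[mu]_x unordered_sum (fun i => f i x) = unordered_sum (fun i => \int[mu]_x f i x).
Proof.
move=> mf sf foo.
have Ii i : mu.-integrable setT (EFin \o f i).
  apply/integrableP; split; first exact/measurable_EFinP.
  apply: le_lt_trans foo.
  apply: le_trans (esum_ge _); last by exists [set i]; [split|exact: lexx].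
  by rewrite fsbig_set1.
have P (a : R -> R) : measurable_fun setT (a : measurableTypeR R -> measurableTypeR R) ->
  (forall x, 0 <= a x) -> (forall x, a x <= `|x|) ->
   let A x := fine (\esum_(i in [set: I]) (a (f i x))%:E) in
   [/\ mu.-integrable setT (EFin \o A), forall i, 0 <= \int[mu]_x a (f i x),
     (\esum_(i in [set: I]) (\int[mu]_x a (f i x))%:E < +oo)%E,
     (forall i, mu.-integrable setT (EFin \o (fun x => a (f i x)))) &
     \int[mu]_x A x = fine (\esum_(i in [set: I]) (\int[mu]_x a (f i x))%:E)].
  move=> ma a0 ale A.
  have maf i : measurable_fun setT (fun x => a (f i x)).
    exact: (measurableT_comp ma (mf i)).
  have [mS ES] := @ge0_integral_esum R d T mu I (fun i x => (a (f i x))%:E)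
    (fun i => (measurable_EFinP _ _ ).2 (maf i)) (fun i x => a0 _).
  have Ia i : mu.-integrable setT (EFin \o (fun x => a (f i x))).
    apply: (le_integrable measurableT _ _ (Ii i)); first exact/measurable_EFinP.
    by move=> x _; rewrite lee_fin/= ger0_norm.
  have AE x : ((A x)%:E = \esum_(i in [set: I]) (a (f i x))%:E)%E.
    by rewrite fineK// esum_fin_num//; exact: esum_lty (sf x).
  have oo : (\esum_(i in [set: I]) \int[mu]_x (a (f i x))%:E < +oo)%E.
    apply: le_lt_trans foo; apply: le_esum => i _; apply: ge0_le_integral => //.
    - by move=> x _; rewrite lee_fin.
    - exact/measurable_EFinP.
    - by apply/measurable_EFinP; exact: (measurableT_comp (f := @Num.norm R R)).
    - by move=> x _; rewrite lee_fin.
  have FE i : ((\int[mu]_x a (f i x))%R%:E = \int[mu]_x (a (f i x))%:E)%E.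
    by rewrite /Rintegral fineK//; exact: integrable_fin_num (Ia i).
  have EA : (EFin \o A) = (fun x => \esum_(i in [set: I]) (a (f i x))%:E)%E.
    by apply/funext.
  split => //.
  - rewrite EA; apply/integrableP; split => //.
    rewrite (eq_integral (fun x => \esum_(i in [set: I]) (a (f i x))%:E)%E) ?ES//.
    by move=> x _; rewrite gee0_abs// esum_ge0// => i _; rewrite lee_fin.
  - by move=> i; apply: Rintegral_ge0.
  - by under eq_esum do rewrite FE.
  - rewrite /Rintegral -[X in fine X]/(\int[mu]_x (EFin \o A) x)%E EA ES; congr fine.
    by apply: eq_esum => i _; rewrite -FE.
have [|||Ip p0 po pI pE] := P (fun x => Num.max x 0).
- by apply: measurable_maxr.
- by move=> x; rewrite le_max lexx orbT.
- by move=> x; rewrite ge_max ler_norm normr_ge0.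
have [|||In n0 no nI nE] := P (fun x => Num.max (- x) 0).
- by apply: measurable_maxr => //; exact: measurable_funN.
- by move=> x; rewrite le_max lexx orbT.
- by move=> x; rewrite ge_max normr_ge0 -normrN ler_norm.
have E x : unordered_sum (fun i => f i x) =
    fine (\esum_(i in [set: I]) (Num.max (f i x) 0)%:E) -
    fine (\esum_(i in [set: I]) (Num.max (- f i x) 0)%:E).
  exact: unordered_sum_posneg.
rewrite (_ : (fun x => unordered_sum (fun i => f i x)) = fun x =>
    fine (\esum_(i in [set: I]) (Num.max (f i x) 0)%:E) -
    fine (\esum_(i in [set: I]) (Num.max (- f i x) 0)%:E)); last by apply/funext.
split.
  exact: (integrableB measurableT Ip In).
rewrite RintegralB// pE nE -unordered_sumB//; congr unordered_sum.
apply/funext => i; rewrite -RintegralB//; apply: eq_Rintegral => x _.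
by case: (leP (f i x) 0); case: (leP (- f i x) 0); lra.
Qed.

Lemma cintegral_csum (I : countType) (f : I -> T -> R[i]) :
  (forall i, cmeasurable setT (f i)) -> (forall x, csummable (fun i => f i x)) ->
  (\esum_(i in [set: I]) \int[mu]_x (normc (f i x))%:E < +oo)%E ->
  cintegrable mu setT (fun x => cunordered_sum (fun i => f i x)) /\
  cintegral mu setT (fun x => cunordered_sum (fun i => f i x)) =
  cunordered_sum (fun i => cintegral mu setT (f i)).
Proof.
move=> mf sf foo.
have key (h : R[i] -> R) : (forall z, `|h z| <= normc z) ->
    (forall i, measurable_fun setT (fun x => h (f i x))) ->
    (\esum_(i in [set: I]) \int[mu]_x (`|h (f i x)|)%:E < +oo)%E.
  move=> hle mh; apply: le_lt_trans foo; apply: le_esum => i _.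
  apply: ge0_le_integral => //.
  - by apply/measurable_EFinP; exact: (measurableT_comp (f := @Num.norm R R)).
  - exact/measurable_EFinP/measurable_normc.
  - by move=> x _; rewrite lee_fin.
have [Ir Er] := Rintegral_unordered_sum (fun i => (mf i).1) (fun x => csummable_Re (sf x))
  (key _ (@le_Re_normc R) (fun i => (mf i).1)).
have [Ii Ei] := Rintegral_unordered_sum (fun i => (mf i).2) (fun x => csummable_Im (sf x))
  (key _ (@le_Im_normc R) (fun i => (mf i).2)).
by split; [split|apply: complex_eqP].
Qed.

End termwise.

(** * Power series expansions of the kernels *)

Section multinomial.
Variable F : numFieldType.

Lemma fact_neq0 n : (n`!%:R : F) != 0.
Proof. by rewrite pnatr_eq0 -lt0n fact_gt0. Qed.

Lemma binomial_fact (x y : F) n :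
  \sum_(i < n.+1) (x ^+ i / i`!%:R) * (y ^+ (n - i) / (n - i)`!%:R) =
  (x + y) ^+ n / n`!%:R.
Proof.
rewrite addrC exprDn mulr_suml; apply: eq_bigr => i _.
have := bin_fact (leq_ord i) => /(congr1 (fun m => m%:R : F)); rewrite !natrM => E.
rewrite -mulr_natr -E; have := fact_neq0 n; rewrite -E.
have := fact_neq0 i; have := fact_neq0 (n - i) => h1 h2; rewrite !mulf_eq0 !negb_or => /andP[h3 _].
by field; rewrite h1 h2 h3.
Qed.

(* Truncated exponential series: the multinomial theorem is the multiplicativity of exp. *)
Let expo (x : F) n : {poly F} := \poly_(i < n.+1) (x ^+ i / i`!%:R).

Let coef_expo_prod (T : finType) (x : T -> F) n (s : seq T) l : (l <= n)%N ->
  (\prod_(t <- s) expo (x t) n)`_l = (\sum_(t <- s) x t) ^+ l / l`!%:R.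
Proof.
elim: s l => [|t s IH] l ln.
  rewrite !big_nil coef1 expr0n; case: l ln => [|l] _; first by rewrite fact0 divr1.
  by rewrite mul0r.
rewrite !big_cons coefM -binomial_fact; apply: eq_bigr => i _.
rewrite IH ?(leq_trans (leq_subr _ _))// coef_poly ifT// ltnS.
by rewrite (leq_trans (leq_ord i)).
Qed.

(** The coefficient of X^n in the product of truncated exponentials. Multi-indices with entries at
    most [n] exhaust those of size [n], so a finite index type suffices. *)
Lemma multinomial_fact (T : finType) (x : T -> F) n :
  \sum_(h : {ffun T -> 'I_n.+1}) (if (\sum_t h t)%N == n then
     \prod_t (x t ^+ h t / (h t)`!%:R) else 0) = (\sum_t x t) ^+ n / n`!%:R.
Proof.
rewrite -(@coef_expo_prod T x n (index_enum T) n)//.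
have E t : expo (x t) n = \sum_(i < n.+1) (x t ^+ i / i`!%:R) *: 'X^i.
  by rewrite /expo poly_def.
under [in RHS]eq_bigr do rewrite E.
rewrite bigA_distr_bigA coef_sum; apply: eq_bigr => h _.
have -> : \prod_t ((x t ^+ h t / (h t)`!%:R) *: 'X^(h t)) =
    (\prod_t (x t ^+ h t / (h t)`!%:R)) *: 'X^(\sum_t h t) :> {poly F}.
  rewrite scaler_prod; congr (_ *: _).
  by rewrite -(big_morph (fun n => 'X^n : {poly F}) (exprD _) (expr0 _)).
rewrite coefZ coefXn eq_sym; case: ifP => _; by rewrite ?mulr1 ?mulr0.
Qed.

End multinomial.

Section monomials.
Context {R : realType} (k : nat).
Local Notation V := 'rV[R[i]]_k.
Local Notation M := {ffun 'I_k -> nat}.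
Implicit Types (x y z w : V) (m : M).

Definition msize m := (\sum_j m j)%N.

Lemma monoE m x : mono m x = \prod_j (x 0 j ^+ m j / (m j)`!%:R).
Proof. by rewrite /mono natr_prod prodf_div. Qed.

Lemma mono_vmul m x y : mono m (vmul x y) = mono m x * \prod_j y 0 j ^+ m j.
Proof.
rewrite !monoE -big_split/=; apply: eq_bigr => j _.
by rewrite mxE exprMn; ring.
Qed.

Lemma mono_scale (r : R) m x : mono m (r%:C *: x) = r%:C ^+ msize m * mono m x.
Proof.
rewrite !monoE -prodrXr -big_split/=; apply: eq_bigr => j _.
by rewrite mxE exprMn mulrA.
Qed.

Lemma le_mono m x y : (forall j, normc (x 0 j) <= normc (y 0 j)) ->
  normc (mono m x) <= normc (mono m y).
Proof.
move=> xy; rewrite !monoE !normc_prod; apply: ler_prod => j _.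
rewrite normc_ge0/= !Normc.normcM ler_wpM2r ?normc_ge0// !normcX.
by rewrite lerXn2r ?nnegrE ?normc_ge0.
Qed.

Definition ffun_nat n (h : {ffun 'I_k -> 'I_n.+1}) : M := [ffun j => nat_of_ord (h j)].

Lemma ffun_nat_inj n : injective (@ffun_nat n).
Proof.
move=> h h' /ffunP E; apply/ffunP => j; apply: val_inj.
by have := E j; rewrite !ffunE.
Qed.

Lemma ffun_nat_out n m : (forall h : {ffun 'I_k -> 'I_n.+1}, ffun_nat h != m) -> msize m != n.
Proof.
move=> H; apply/eqP => mn.
have mj j : (m j < n.+1)%N by rewrite ltnS -mn /msize (bigD1 j)//= leq_addr.
have /eqP := H [ffun j => Ordinal (mj j)]; apply.
by apply/ffunP => j; rewrite !ffunE.
Qed.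

(** Grouped by size, the moduli of degree n add up to r^n / n! with r the sum of the |x_j|, which
    leaves the exponential series of r. *)
Lemma csummable_mono x : csummable (fun m => mono m x).
Proof.
pose a m := normc (mono m x).
pose r := \sum_j normc (x 0 j).
have r0 : 0 <= r by apply: sumr_ge0 => j _; exact: normc_ge0.
pose u (p : M * nat) : R := if msize p.1 == p.2 then a p.1 else 0.
have u0 p : (0 <= (u p)%:E)%E by rewrite lee_fin /u; case: ifP => // _; exact: normc_ge0.
have E1 : (\esum_(m in [set: M]) (a m)%:E = \esum_(p in [set: M * nat]) (u p)%:E)%E.
  rewrite -ge0_esum_prod//; apply: eq_esum => m _.
  have inj : injective (fun _ : 'I_1 => msize m) by move=> i j _; rewrite (ord1 i) (ord1 j).
  rewrite (esum_finite_support (a := fun n => u (m, n)) inj).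
  - by rewrite big_ord1 /u/= eqxx.
  - by move=> n; rewrite -lee_fin.
  - by move=> n /(_ ord0); rewrite /u/= => /negbTE ->.
have E2 : (\esum_(p in [set: M * nat]) (u p)%:E = \esum_(n in [set: nat]) (r ^+ n / n`!%:R)%:E)%E.
  rewrite -ge0_esum_prod2//; apply: eq_esum => n _.
  rewrite (esum_finite_support (a := fun m => u (m, n)) (@ffun_nat_inj n)).
  - rewrite /r -multinomial_fact; congr EFin; apply: eq_bigr => h _.
    rewrite /u/= (_ : msize (ffun_nat h) = (\sum_t h t)%N); last first.
      by apply: eq_bigr => j _; rewrite ffunE.
    case: ifP => // _; rewrite /a monoE normc_prod; apply: eq_bigr => j _.
    by rewrite ffunE Normc.normcM Normc.normcV normcX normc_nat.
  - by move=> m; rewrite -lee_fin.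
  - by move=> m /ffun_nat_out; rewrite /u/= => /negbTE ->.
rewrite /csummable -/(a _) E1 E2 -nneseries_esumT; last first.
  by move=> n; rewrite lee_fin divr_ge0 ?exprn_ge0.
have cv : cvgn (series (exp_coeff r)) by exact: is_cvg_series_exp_coeff.
rewrite [X in (X < _)%E](_ : _ = (limn (series (exp_coeff r)))%:E) ?ltry// -EFin_lim//.
by apply/congr_lim/funext => n; rewrite /series/= sumEFin.
Qed.

End monomials.

(** * Geometric bounds for quotients of Pochhammer symbols *)

Section pochhammer_bounds.
Context {R : realType}.
Implicit Types g h : R[i].

Lemma Re_le_normcD h n : 0 < Re h -> Re h + n%:R <= normc (h + n%:R).
Proof.
move=> h0; rewrite (le_trans _ (le_Re_normc _))// ReD Re_nat.
exact: ler_norm.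
Qed.

Lemma poch_neq0 h n : 0 < Re h -> poch h n != 0.
Proof.
move=> h0; apply/prodf_neq0 => j _; apply: Re_gt0_neq0.
by rewrite ReD Re_nat ltr_wpDr.
Qed.

(** Each factor (g+j)/(h+j) equals 1 + (g-h)/(h+j), and |h+j| >= Re h. *)
Lemma normc_poch_ratio g h n : 0 < Re h ->
  normc (poch g n / poch h n) <= (1 + normc (g - h) / Re h) ^+ n.
Proof.
move=> h0; rewrite /poch -prodf_div normc_prod -[n in leRHS]card_ord -prodr_const.
apply: ler_prod => j _; rewrite normc_ge0/=.
have hj := Re_le_normcD j h0.
have hj0 : 0 < normc (h + j%:R) by apply: lt_le_trans hj; rewrite ltr_wpDr.
have hjn : h + j%:R != 0.
  by apply: contraTN hj0 => /eqP ->; rewrite Normc.normc0 ltxx.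
have -> : (g + j%:R) / (h + j%:R) = 1 + (g - h) / (h + j%:R) by field.
rewrite (le_trans (le_normcD _ _))// Normc.normc1 lerD2l Normc.normcM Normc.normcV.
rewrite ler_wpM2l ?normc_ge0// lef_pV2 ?posrE// (le_trans _ hj)//.
by rewrite lerDl.
Qed.

(** Factor by factor, |g+j| <= (1 + |g|)(j+1). *)
Lemma normc_poch_le g n : normc (poch g n) <= (1 + normc g) ^+ n * n`!%:R.
Proof.
rewrite /poch normc_prod fact_prod natr_prod -[n in _ ^+ n]card_ord -prodr_const.
rewrite big_add1 big_mkord -big_split/=; apply: ler_prod => j _; rewrite normc_ge0/=.
rewrite (le_trans (le_normcD _ _))// normc_nat -natr1.
have := normc_ge0 g; have : (0 : R) <= j%:R by []; nra.
Qed.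

(** Factor by factor, j+1 <= (1 + 1/Re h)(Re h + j). The constant [D] is left free so that one value
    can serve all coordinates. *)
Lemma fact_le_poch h (D : R) n : 0 < Re h -> 1 + (Re h)^-1 <= D ->
  n`!%:R <= D ^+ n * normc (poch h n).
Proof.
move=> h0 hD; rewrite /poch normc_prod fact_prod natr_prod -[n in _ ^+ n]card_ord.
rewrite -prodr_const big_add1 big_mkord -big_split/=; apply: ler_prod => j _.
rewrite ler0n/=.
have hj := Re_le_normcD j h0.
have D0 : 0 <= D by apply: le_trans hD; rewrite addr_ge0// invr_ge0 ltW.
apply: le_trans (ler_wpM2l D0 hj); apply: le_trans (ler_wpM2r _ hD); last first.
  by rewrite addr_ge0// ltW.
rewrite mulrDr !mulrDl mul1r mulVf ?gt_eqF// -natr1.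
have : 0 <= (Re h)^-1 * j%:R by rewrite mulr_ge0// invr_ge0 ltW.
by have := ltW h0; lra.
Qed.

Variable k : nat.
Local Notation V := 'rV[R[i]]_k.
Local Notation M := {ffun 'I_k -> nat}.

(** One term of the multinomial expansion of (1 + ... + 1)^N with k summands and N the size of [m];
    the other terms are nonnegative. *)
Lemma multinomial_le (m : M) :
  (msize m)`!%:R / \prod_j (m j)`!%:R <= k%:R ^+ msize m :> R.
Proof.
have mj j : (m j < (msize m).+1)%N by rewrite ltnS /msize (bigD1 j)//= leq_addr.
pose h := [ffun j => Ordinal (mj j)].
have := multinomial_fact (fun _ : 'I_k => 1 : R) (msize m).
rewrite sumr_const card_ord => E.
have f0 : (0 : R) < (msize m)`!%:R by rewrite ltr0n fact_gt0.
rewrite mulrC -ler_pdivlMr// -E (bigD1 h)//=.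
have -> : (\sum_t h t = msize m)%N by apply: eq_bigr => j _; rewrite ffunE.
rewrite eqxx -[leLHS]addr0; apply: lerD.
  by rewrite -prodfV le_eqVlt; apply/orP; left; apply/eqP/eq_bigr => j _; rewrite ffunE expr1n mul1r.
apply: sumr_ge0 => l _; case: ifP => // _; apply: prodr_ge0 => j _.
by rewrite expr1n mul1r invr_ge0.
Qed.

(** With N the size of [m], the numerator is at most (1+|g|)^N N!, the denominator at least D^-N
    times the product of the m_j!, and N! over that product is at most k^N. *)
Lemma normc_multi_poch_ratio g (h : V) : vRe_gt0 h ->
  exists2 K : R, 0 <= K & forall m : M,
    normc (poch g (msize m) / \prod_j poch (h 0 j) (m j)) <= K ^+ msize m.
Proof.
move=> h0; pose D := 1 + \sum_j (Re (h 0 j))^-1.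
have iv j : 0 <= (Re (h 0 j))^-1 by rewrite invr_ge0 ltW// h0.
have D0 : 0 <= D by rewrite addr_ge0// sumr_ge0.
have g0 := normc_ge0 g.
exists ((1 + normc g) * D * k%:R) => [|m].
  by rewrite !mulr_ge0// addr_ge0.
have hD j : 1 + (Re (h 0 j))^-1 <= D.
  by rewrite lerD2l (bigD1 j)//= lerDl sumr_ge0.
have P0 : 0 < \prod_j normc (poch (h 0 j) (m j)).
  by apply: prodr_gt0 => j _; rewrite normc_gt0 poch_neq0// h0.
have F0 : (0 : R) < \prod_j (m j)`!%:R.
  by apply: prodr_gt0 => j _; rewrite ltr0n fact_gt0.
have E : \prod_j (m j)`!%:R <= D ^+ msize m * \prod_j normc (poch (h 0 j) (m j)).
  rewrite /msize -prodrXr -big_split/=; apply: ler_prod => j _.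
  by rewrite ler0n/=; apply: fact_le_poch.
rewrite Normc.normcM Normc.normcV normc_prod.
apply: (@le_trans _ _ ((1 + normc g) ^+ msize m * (msize m)`!%:R *
  (D ^+ msize m / \prod_j (m j)`!%:R))).
  apply: ler_pM => //; [exact: normc_ge0|by rewrite invr_ge0 ltW|exact: normc_poch_le|].
  by rewrite ler_pdivlMr// mulrC ler_pdivrMr.
rewrite !exprMn mulrACA ler_wpM2l ?mulr_ge0 ?exprn_ge0 ?addr_ge0//.
  by rewrite sumr_ge0.
exact: multinomial_le.
Qed.

End pochhammer_bounds.

Section expansions.
Context {R : realType} (k : nat).
Local Notation V := 'rV[R[i]]_k.
Local Notation M := {ffun 'I_k -> nat}.
Implicit Types (z w t : V).

Lemma Psi2E a (c x : V) : Psi2 a c x =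
  cunordered_sum (fun m : M =>
    poch a (msize m) / (\prod_j poch (c 0 j) (m j)) * mono m x).
Proof. by []. Qed.

(** A geometric bound K^N on the coefficients is absorbed by replacing x with K x, since the divided
    powers are summable at every point. *)
Lemma csummable_Psi2 a (c x : V) : vRe_gt0 c -> csummable (fun m : M =>
  poch a (msize m) / (\prod_j poch (c 0 j) (m j)) * mono m x).
Proof.
move=> c0; have [K K0 HK] := normc_multi_poch_ratio a c0.
apply: (@le_csummable _ _ _ (fun m => normc (mono m (K%:C *: x)))).
  move=> m; rewrite mono_scale Normc.normcM [leRHS]Normc.normcM ler_wpM2r ?normc_ge0//.
  by rewrite normcX normc_real_ge0.
exact: csummable_mono.
Qed.

Definition msize2 (p : M * M) := (msize p.1 + msize p.2)%N.
Definition mono2 (p : M * M) z w := mono p.1 z * mono p.2 w.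

Lemma mono2_scale (r : R) p z w :
  mono2 p (r%:C *: z) (r%:C *: w) = r%:C ^+ msize2 p * mono2 p z w.
Proof. by rewrite /mono2 !mono_scale exprD mulrACA. Qed.

Lemma csummable_mono2 z w : csummable (fun p => mono2 p z w).
Proof. by case: (csum_mul (csummable_mono z) (csummable_mono w)). Qed.

Lemma csummable_le_mono2 (K : R) (u : M * M -> R[i]) z w : 0 <= K ->
  (forall p, normc (u p) <= K ^+ msize2 p) -> csummable (fun p => u p * mono2 p z w).
Proof.
move=> K0 uK; apply: (@le_csummable _ _ _ (fun p => normc (mono2 p (K%:C *: z) (K%:C *: w)))).
  move=> p; rewrite mono2_scale Normc.normcM [leRHS]Normc.normcM ler_wpM2r ?normc_ge0//.
  by rewrite normcX normc_real_ge0.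
exact: csummable_mono2.
Qed.

(** A pair of multi-indices is one multi-index on the disjoint union of the two coordinate sets, so
    the pairs of total size n are governed by the multinomial theorem in 2k variables. *)
Let split_ffun n (h : {ffun 'I_k + 'I_k -> 'I_n.+1}) : M * M :=
  ([ffun j => nat_of_ord (h (inl j))], [ffun j => nat_of_ord (h (inr j))]).

Let split_ffun_inj n : injective (@split_ffun n).
Proof.
move=> h h' [/ffunP E /ffunP E']; apply/ffunP => -[j|j]; apply: val_inj.
  by have := E j; rewrite !ffunE.
by have := E' j; rewrite !ffunE.
Qed.

Let split_ffun_out n p : (forall h : {ffun 'I_k + 'I_k -> 'I_n.+1}, split_ffun h != p) ->
  msize2 p != n.
Proof.
move=> H; apply/eqP => pn.
have p1 j : (p.1 j < n.+1)%N.
  by rewrite ltnS -pn /msize2 /msize (bigD1 j)//= -!addnA leq_addr.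
have p2 j : (p.2 j < n.+1)%N.
  by rewrite ltnS -pn /msize2 addnC /msize (bigD1 j)//= -!addnA leq_addr.
have /eqP := H [ffun s => match s with inl j => Ordinal (p1 j) | inr j => Ordinal (p2 j) end].
by apply; rewrite [RHS]surjective_pairing; congr pair; apply/ffunP => j; rewrite !ffunE.
Qed.

Lemma sum_mono2 n (A : nat -> R[i]) z w :
  cunordered_sum (fun p => if msize2 p == n then A (msize2 p) * mono2 p z w else 0) =
  A n * (vsum (z + w) ^+ n / n`!%:R).
Proof.
have [|_ ->] := csum_finite_support (@split_ffun_inj n)
  (f := fun p => if msize2 p == n then A (msize2 p) * mono2 p z w else 0).
  by move=> p /split_ffun_out/negbTE ->.
pose x (s : 'I_k + 'I_k) := match s with inl j => z 0 j | inr j => w 0 j end.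
have -> : vsum (z + w) = \sum_s x s.
  by rewrite big_sumType/= -big_split/=; apply: eq_bigr => j _; rewrite mxE.
rewrite -multinomial_fact mulr_sumr; apply: eq_bigr => h _.
have -> : msize2 (split_ffun h) = (\sum_t h t)%N.
  rewrite big_sumType/= /msize2 /msize; congr addn; apply: eq_bigr => j _;
  by rewrite ffunE.
case: eqP => [->|_]; last by rewrite mulr0.
congr (_ * _); rewrite big_sumType/= /mono2 !monoE.
by congr (_ * _); apply: eq_bigr => j _; rewrite ffunE.
Qed.

(** The double family is regrouped by total size; the part of size n is the n-th term of the series,
    by [sum_mono2]. *)
Lemma hyp1F1_expansion (g h t : R[i]) z w : 0 < Re h ->
  let u (p : M * M) := poch g (msize2 p) / poch h (msize2 p) * t ^+ msize2 p in
  csummable (fun p => u p * mono2 p z w) /\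
  hyp1F1 g h (t * vsum (z + w)) = cunordered_sum (fun p => u p * mono2 p z w).
Proof.
move=> h0 u; pose K := 1 + normc (g - h) / Re h.
have K0 : 0 <= K by rewrite addr_ge0// divr_ge0 ?normc_ge0// ltW.
have su : csummable (fun p => u p * mono2 p z w).
  apply: (@csummable_le_mono2 (K * normc t)) => [|p].
    by rewrite mulr_ge0 ?normc_ge0.
  rewrite Normc.normcM normcX exprMn ler_wpM2r ?exprn_ge0 ?normc_ge0//.
  exact: normc_poch_ratio.
split => //; have [s <-] := csum_regroup msize2 su.
rewrite -csum_nat//; congr cseries_sum; apply/funext => n.
rewrite (sum_mono2 n (fun N => poch g N / poch h N * t ^+ N)).
by rewrite exprMn; ring.
Qed.

Let madd (p : M * M) : M := [ffun j => p.1 j + p.2 j]%N.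

Lemma msize_add (m n : M) : msize [ffun j => m j + n j]%N = (msize m + msize n)%N.
Proof. by rewrite /msize -big_split/=; apply: eq_bigr => j _; rewrite ffunE. Qed.

(** The candidates (h, n - h) for pairs with sum [n], under a bound common to all coordinates.
    Subtraction truncates, so those with h_j > n_j for some j do not add up to [n] and contribute
    0. *)
Let sub_ffun (n : M) (h : {ffun 'I_k -> 'I_(msize n).+1}) : M * M :=
  ([ffun j => nat_of_ord (h j)], [ffun j => n j - h j]%N).

Let sub_ffun_inj n : injective (@sub_ffun n).
Proof.
move=> h h' [/ffunP E _]; apply/ffunP => j; apply: val_inj.
by have := E j; rewrite !ffunE.
Qed.

Let sub_ffun_out n p : (forall h, @sub_ffun n h != p) -> madd p != n.
Proof.
move=> H; apply/eqP => pn.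
have p1 j : (p.1 j < (msize n).+1)%N.
  rewrite ltnS /msize (bigD1 j)//= -pn ffunE -addnA -{1}(addn0 (p.1 j)).
  by rewrite leq_add2l.
have /eqP := H [ffun j => Ordinal (p1 j)]; apply.
rewrite [RHS]surjective_pairing; congr pair; apply/ffunP => j; rewrite !ffunE//=.
by rewrite -pn ffunE addKn.
Qed.

Lemma madd_sub n h : (madd (@sub_ffun n h) == n) = [forall j, (h j <= n j)%N].
Proof.
apply/eqP/forallP => [/ffunP E j|H].
  by have := E j; rewrite !ffunE/= => <-; rewrite leq_addr.
by apply/ffunP => j; rewrite !ffunE subnKC.
Qed.

(** The binomial theorem in each coordinate, every sum being padded with zeros up to the common
    length [N.+1] before the product is distributed. *)
Lemma sum_mono2_add n (A : M -> R[i]) z w :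
  cunordered_sum (fun p => if madd p == n then A (madd p) * mono2 p z w else 0) =
  A n * mono n (z + w).
Proof.
have [|_ ->] := csum_finite_support (@sub_ffun_inj n)
  (f := fun p => if madd p == n then A (madd p) * mono2 p z w else 0).
  by move=> p /sub_ffun_out/negbTE ->.
pose N := msize n.
pose F j (i : 'I_N.+1) := if (i <= n j)%N then
  (z 0 j ^+ i / i`!%:R) * (w 0 j ^+ (n j - i) / (n j - i)`!%:R) else 0.
have -> : mono n (z + w) = \prod_j \sum_(i < N.+1) F j i.
  rewrite monoE; apply: eq_bigr => j _; rewrite mxE -binomial_fact -big_mkcond.
  have nj : ((n j).+1 <= N.+1)%N by rewrite ltnS /N /msize (bigD1 j)//= leq_addr.
  rewrite (big_ord_widen N.+1 (fun i => (z 0 j ^+ i / i`!%:R) *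
    (w 0 j ^+ (n j - i) / (n j - i)`!%:R)) nj).
  by apply: eq_bigl => i; rewrite ltnS.
rewrite bigA_distr_bigA mulr_sumr; apply: eq_bigr => h _.
rewrite madd_sub; case: ifPn => [/forallP H|].
  have /eqP -> : madd (sub_ffun h) == n by rewrite madd_sub; apply/forallP.
  congr (_ * _); rewrite /mono2 !monoE -big_split/=; apply: eq_bigr => j _.
  by rewrite !ffunE/= /F H.
rewrite negb_forall => /existsP[j /negbTE nj].
by rewrite (bigD1 j)//= /F nj mul0r mulr0.
Qed.

(** The coefficient depends on the pair only through its sum, so the family is regrouped along
    addition of multi-indices. *)
Lemma Psi2_expansion g (h t z w : V) : vRe_gt0 h ->
  let u (p : M * M) := poch g (msize2 p) / (\prod_j poch (h 0 j) (p.1 j + p.2 j))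
    * \prod_j t 0 j ^+ (p.1 j + p.2 j) in
  csummable (fun p => u p * mono2 p z w) /\
  Psi2 g h (vmul z t + vmul w t) = cunordered_sum (fun p => u p * mono2 p z w).
Proof.
move=> h0 u; have [K K0 HK] := normc_multi_poch_ratio g h0.
pose A (m : M) := poch g (msize m) / (\prod_j poch (h 0 j) (m j)) * \prod_j t 0 j ^+ m j.
have uE p : u p = A (madd p).
  rewrite /u /A /madd msize_add; congr (_ / _ * _);
  by apply: eq_bigr => j _; rewrite ffunE.
pose T := \sum_j normc (t 0 j).
have T0 : 0 <= T by apply: sumr_ge0 => j _; exact: normc_ge0.
have su : csummable (fun p => u p * mono2 p z w).
  apply: (@csummable_le_mono2 (K * T)) => [|p]; first by rewrite mulr_ge0.
  rewrite uE Normc.normcM exprMn /msize2 -msize_add.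
  apply: ler_pM => //; [exact: normc_ge0|exact: normc_ge0|].
  rewrite normc_prod /msize -prodrXr; apply: ler_prod => j _; rewrite normc_ge0/=.
  rewrite normcX lerXn2r ?nnegrE ?normc_ge0// /T (bigD1 j)//= lerDl.
  by apply: sumr_ge0 => l _; exact: normc_ge0.
split => //; have [s <-] := csum_regroup madd su.
rewrite Psi2E; apply: eq_csum => n.
rewrite (_ : vmul z t + vmul w t = vmul (z + w) t); last first.
  by apply/rowP => j; rewrite !mxE mulrDl.
rewrite mono_vmul mulrA mulrAC -/(A n) -sum_mono2_add; apply: eq_csum => p.
by rewrite uE.
Qed.

End expansions.

(** * Integral representations of the product *)

Section product_sigma_finite.
Context d1 d2 (T1 : measurableType d1) (T2 : measurableType d2) {R : realType}.
Variable m1 : {sigma_finite_measure set T1 -> \bar R}.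
Variable m2 : {sigma_finite_measure set T2 -> \bar R}.

Let mx : {measure set (T1 * T2) -> \bar R} := (m1 \x m2)%E.

Let mx_sigma_finite : sigma_finite setT mx.
Proof.
have /sigma_finiteP[F [FT ndF Foo]] := sigma_finiteT m1.
have /sigma_finiteP[G [GT ndG Goo]] := sigma_finiteT m2.
exists (fun n => F n `*` G n).
  apply/esym; rewrite -subTset => -[u t] _.
  have [i _ Fi] : (\bigcup_i F i) u by rewrite -FT.
  have [j _ Gj] : (\bigcup_i G i) t by rewrite -GT.
  exists (maxn i j) => //; split.
  - by move: u Fi; exact/subsetPset/ndF/leq_maxl.
  - by move: t Gj; exact/subsetPset/ndG/leq_maxr.
move=> n; have [mF Fn] := Foo n; have [mG Gn] := Goo n.
split; first exact: measurableX.
by rewrite /mx/= product_measure1E// lte_mul_pinfty// ge0_fin_numE.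
Qed.

(* The library puts no sigma-finite structure on m1 \x m2; iterated products need one. *)
Definition sigma_finite_product : set (T1 * T2) -> \bar R := mx.
HB.instance Definition _ := Measure.on sigma_finite_product.
HB.instance Definition _ := Measure_isSigmaFinite.Build _ _ _
  sigma_finite_product mx_sigma_finite.

End product_sigma_finite.

Section product_representation.
Context {R : realType} (k : nat).
Local Notation RT := (measurableTypeR R).
Local Notation RTk := (k.-tuple RT).
Local Notation V := 'rV[R[i]]_k.
Local Notation M := {ffun 'I_k -> nat}.
Variables (x y c d : V) (a b : R[i]).
Hypothesis hc : vRe_gt0 (c - const_mx 1).
Hypothesis ha : Re (vsum c) < Re a + k%:R.
Hypothesis hd : vRe_gt0 (d - const_mx 1).
Hypothesis hb : Re (vsum d) < Re b + k%:R.
Let mu := line_density (c - const_mx 1) (a + k%:R - vsum c).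
Let nu := line_density (d - const_mx 1) (b + k%:R - vsum d).
Let lk := lebesgue_tuple R k.

Lemma normc_vdiv_line (z : V) (s : RTk) j :
  normc ((vdiv z (line_pt s)) 0 j) <= normc ((k.+1%:R%:C *: z) 0 j).
Proof.
rewrite !mxE Normc.normcM Normc.normcV [leRHS]Normc.normcM mulrC.
rewrite ler_wpM2r ?normc_ge0// normc_real_ge0//.
have k0 : 0 < (k.+1%:R : R)^-1 by rewrite invr_gt0 ltr0n.
rewrite -[leRHS]invrK lef_pV2 ?posrE//; last first.
  by rewrite (lt_le_trans k0)// -[leLHS]ger0_norm ?(ltW k0)// (le_Re_normc (_ +i* _)).
by rewrite -[leLHS]ger0_norm ?(ltW k0)// (le_Re_normc (_ +i* _)).
Qed.

(** The moment of order zero, whose monomial is 1. *)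
Lemma cintegrable_line_density (e : V) f : vRe_gt0 (e - const_mx 1) ->
  Re (vsum e) < Re f + k%:R ->
  cintegrable lk setT (line_density (e - const_mx 1) (f + k%:R - vsum e)).
Proof.
move=> he hf; have [I _] := line_moment 0 [ffun=> 0%N] he hf.
apply: eq_cintegrable I => // s _; rewrite monoE big1 ?mul1r// => j _.
by rewrite ffunE expr0 fact0 divr1.
Qed.

Context dT (T : measurableType dT) (mT : {sigma_finite_measure set T -> \bar R}).
Variables (rho : T -> R[i]) (kappa : M * M -> T -> R[i]) (Phi : V -> V -> T -> R[i]).
Variable K : R.
Hypothesis K0 : 0 <= K.
Hypothesis rhoI : cintegrable mT setT rho.
Hypothesis kappaI : forall p, cintegrable mT setT (fun t => kappa p t * rho t).
Hypothesis kappa1 : forall p, cintegral mT setT (fun t => kappa p t * rho t) = 1.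
Hypothesis kappa_le : forall p t,
  normc (kappa p t * rho t) <= K ^+ msize2 p * normc (rho t).
Hypothesis PhiE : forall z w t,
  Phi z w t * rho t = cunordered_sum (fun p => kappa p t * rho t * mono2 p z w).

(** The common core of both formulas: [Phi] is the kernel, [rho] the density in t, and [kappa p] the
    coefficient of the monomial [mono2 p] in the expansion of [Phi]. That its integral against [rho]
    is 1 is the cancellation which decouples the factors. The bound [kappa_le] carries the factor
    [rho] on both sides, so it has content only where the density is nonzero. *)
Lemma product_representation :
  let F (q : (RTk * RTk) * T) : R[i] :=
    Phi (vdiv x (line_pt q.1.1)) (vdiv y (line_pt q.1.2)) q.2
    * mu q.1.1 * nu q.1.2 * rho q.2 in
  let mM : {measure set ((RTk * RTk) * T)%type -> \bar R} := ((lk \x lk) \x mT)%E in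
  cintegrable mM setT F /\ cintegral mM setT F = Psi2 a c x * Psi2 b d y.
Proof.
move=> F mM.
pose fu m s := mono m (vdiv x (line_pt s)) * mu s.
pose fw m s := mono m (vdiv y (line_pt s)) * nu s.
pose f p (q : (RTk * RTk) * T) := fu p.1 q.1.1 * fw p.2 q.1.2 * (kappa p q.2 * rho q.2).
have Iu m : cintegrable lk setT (fu m) := (line_moment x m hc ha).1.
have Iw m : cintegrable lk setT (fw m) := (line_moment y m hd hb).1.
have Iuw p := cintegrable_prodM (Iu p.1) (Iw p.2).
pose m12 : {sigma_finite_measure set (RTk * RTk)%type -> \bar R} :=
  sigma_finite_product lk lk.
have If p : cintegrable mM setT (f p) :=
  cintegrable_prodM (m1 := m12) (Iuw p) (kappaI p).
have Ef p : cintegral mM setT (f p) = cintegral lk setT (fu p.1) * cintegral lk setT (fw p.2).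
  by rewrite [LHS](cintegral_prodM (m1 := m12) (Iuw p) (kappaI p)) kappa1 mulr1 cintegral_prodM.
(* The terms are bounded by B p * G q, with [B] summable over the indices and [G] integrable over
   the space. This separation yields both pointwise summability and termwise integration. *)
pose G (q : (RTk * RTk) * T) := normc (mu q.1.1 * nu q.1.2 * rho q.2).
have IG : mM.-integrable setT (EFin \o G).
  apply: cintegrable_normc => //.
  have Imn : cintegrable m12 setT (fun p : RTk * RTk => mu p.1 * nu p.2) :=
    cintegrable_prodM (cintegrable_line_density hc ha) (cintegrable_line_density hd hb).
  exact: (cintegrable_prodM (m1 := m12) Imn rhoI).
(* [K] accounts for the coefficients and k+1 for 1/|u_j| and 1/|w_j| on the lines. *)
pose r := K * k.+1%:R.
have r0 : 0 <= r by rewrite mulr_ge0.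
pose B p := normc (mono2 p (r%:C *: x) (r%:C *: y)).
have fB p q : normc (f p q) <= B p * G q.
  pose kr := kappa p q.2 * rho q.2.
  have -> : f p q = mono2 p (vdiv x (line_pt q.1.1)) (vdiv y (line_pt q.1.2)) *
      kr * (mu q.1.1 * nu q.1.2) by rewrite /f /fu /fw /mono2 /kr; ring.
  rewrite /G /B /r rmorphM -!scalerA mono2_scale /mono2.
  have : normc kr <= K ^+ msize2 p * normc (rho q.2) by exact: kappa_le.
  have := le_mono p.1 (normc_vdiv_line x q.1.1); have := le_mono p.2 (normc_vdiv_line y q.1.2).
  move: (mono p.1 (vdiv _ _)) (mono p.2 (vdiv _ _)) (mono p.1 (_ *: _)) (mono p.2 (_ *: _)).
  move: kr (mu q.1.1) (nu q.1.2) (rho q.2) => kr m n v w1 w2 w3 w4 h2 h1 h3.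
  rewrite !Normc.normcM normcX normc_real_ge0//.
  have h4 := ler_pM (mulr_ge0 (normc_ge0 w1) (normc_ge0 w2)) (normc_ge0 kr)
    (ler_pM (normc_ge0 _) (normc_ge0 _) h1 h2) h3.
  apply: le_trans (ler_wpM2r _ h4) _; first by rewrite mulr_ge0 ?normc_ge0.
  by rewrite le_eqVlt; apply/orP; left; apply/eqP; ring.
have sB : (\esum_(p in [set: M * M]) (B p)%:E < +oo)%E := csummable_mono2 _ _.
have G0 q : 0 <= G q := normc_ge0 _.
have sf q : csummable (fun p => f p q).
  apply: (@le_csummable _ _ _ (fun p => G q * B p)) => [p|]; first by rewrite mulrC.
  under eq_esum do rewrite EFinM.
  rewrite ge0_esumZl//; last by move=> p; rewrite lee_fin normc_ge0.
  by rewrite lte_mul_pinfty ?lee_fin.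
have iGoo : (\int[mM]_q (G q)%:E < +oo)%E.
  have /integrableP[_] := IG; congr (_ < _)%E; apply: eq_integral => q _ /=.
  by rewrite ger0_norm.
have iG0 : (0 <= \int[mM]_q (G q)%:E)%E.
  by apply: integral_ge0 => q _; rewrite lee_fin.
have [|I E] := cintegral_csum (mu := mM) (fun p => cintegrable_cmeasurable (If p)) sf.
  apply: (@le_lt_trans _ _
    (\esum_(p in [set: M * M]) ((fine (\int[mM]_q (G q)%:E))%:E * (B p)%:E))%E).
    apply: le_esum => p _; rewrite fineK ?ge0_fin_numE// muleC.
    rewrite -ge0_integralZl//; last 3 first.
    - exact: (measurable_int mM IG).
    - by move=> q _; rewrite lee_fin.
    - by rewrite lee_fin normc_ge0.
    apply: ge0_le_integral => //.
    - by move=> q _; rewrite lee_fin normc_ge0.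
    - exact/measurable_EFinP/measurable_normc/cintegrable_cmeasurable/If.
    - by apply: measurable_funeM; exact: (measurable_int mM IG).
    - by move=> q _; rewrite -EFinM lee_fin.
  rewrite ge0_esumZl ?lte_mul_pinfty ?lee_fin ?fine_ge0// => p.
  by rewrite lee_fin normc_ge0.
have FE : F = fun q => cunordered_sum (fun p => f p q).
  apply/funext => -[[s t] v]; rewrite /F/=.
  set z := vdiv x _; set w := vdiv y _.
  transitivity (mu s * nu t * (Phi z w v * rho v)); first by ring.
  rewrite PhiE -csumZ; first by apply: eq_csum => p; rewrite /f /fu /fw /mono2/= -/z -/w; ring.
  apply: (@le_csummable _ _ _
    (fun p => normc (rho v) * normc (mono2 p (K%:C *: z) (K%:C *: w)))) => [p|].
    rewrite mono2_scale (Normc.normcM (kappa p v * rho v)).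
    rewrite (Normc.normcM (K%:C ^+ _)) normcX normc_real_ge0// mulrA.
    by rewrite ler_wpM2r ?normc_ge0// [leRHS]mulrC; exact: kappa_le.
  under eq_esum do rewrite EFinM.
  rewrite ge0_esumZl ?normc_ge0//; last by move=> p; rewrite lee_fin normc_ge0.
  by rewrite lte_mul_pinfty ?lee_fin ?normc_ge0//; exact: csummable_mono2.
have c1 (e : V) : vRe_gt0 (e - const_mx 1) -> vRe_gt0 e.
  by move=> he j; have := he j; rewrite !mxE ReD ReN subr_gt0; apply: lt_trans.
rewrite FE; split => //; rewrite E.
have [_] := csum_mul (csummable_Psi2 a x (c1 _ hc)) (csummable_Psi2 b y (c1 _ hd)).
rewrite -!Psi2E => <-; apply: eq_csum => p.
by rewrite Ef (line_moment x p.1 hc ha).2 (line_moment y p.2 hd hb).2.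
Qed.

End product_representation.

(** Returns from densities extended by zero on the whole space to integrals over the original
    domains. *)
Lemma cintegral_supported d (T : measurableType d) {R : realType}
    (mu : {measure set T -> \bar R}) (D : set T) (f g : T -> R[i]) (v : R[i]) :
  measurable D -> (forall q, g q = if q \in D then f q else 0) ->
  cintegrable mu setT g /\ cintegral mu setT g = v ->
  cintegrable mu D f /\ v = cintegral mu D f.
Proof.
move=> mD gE [Ig <-]; have {}gE : g = fun q => if q \in D then f q else 0 by apply/funext.
by rewrite (cintegral_mkcond mu D) -gE; split => //; apply/cintegrable_mkcond; rewrite -?gE.
Qed.

Section concrete_representations.
Context {R : realType} (k : nat).
Local Notation RT := (measurableTypeR R).
Local Notation RTk := (k.-tuple RT).
Local Notation V := 'rV[R[i]]_k.
Local Notation M := {ffun 'I_k -> nat}.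
Variables (x y c d : V) (a b : R[i]).
Hypothesis hc : vRe_gt0 (c - const_mx 1).
Hypothesis ha : Re (vsum c) < Re a + k%:R.
Hypothesis hd : vRe_gt0 (d - const_mx 1).
Hypothesis hb : Re (vsum d) < Re b + k%:R.
Let mu := line_density (c - const_mx 1) (a + k%:R - vsum c).
Let nu := line_density (d - const_mx 1) (b + k%:R - vsum d).

(** With N the total size of the pair, the coefficient is (g)_N / (h)_N t^N, and the Beta moment of
    order N is the inverse quotient. On [0, 1] the power of t is at most 1, so the growth constant
    is that of [normc_poch_ratio]. *)
Lemma beta_representation (g h : R[i]) : 0 < Re h -> Re h < Re g ->
  let F (q : (RTk * RTk) * RT) : R[i] :=
    hyp1F1 g h (q.2%:C * vsum (vdiv x (line_pt q.1.1) + vdiv y (line_pt q.1.2)))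
    * mu q.1.1 * nu q.1.2 * beta_ext g h q.2 in
  let mM : {measure set ((RTk * RTk) * RT)%type -> \bar R} :=
    ((lebesgue_tuple R k \x lebesgue_tuple R k) \x lebesgue_measure)%E in
  cintegrable mM setT F /\ cintegral mM setT F = Psi2 a c x * Psi2 b d y.
Proof.
move=> h0 hg; have g0 : 0 < Re g := lt_trans h0 hg.
pose r (p : M * M) := poch g (msize2 p) / poch h (msize2 p).
pose kappa p (t : RT) := r p * t%:C ^+ msize2 p.
have rhoI : cintegrable lebesgue_measure setT (beta_ext g h : RT -> R[i]).
  by apply: eq_cintegrable (beta_moment h0 hg 0).1 => // t _; rewrite expr0 mul1r.
have kE p (t : RT) : r p * (t%:C ^+ msize2 p * beta_ext g h t) = kappa p t * beta_ext g h t.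
  by rewrite mulrA.
apply: (@product_representation R k x y c d a b hc ha hd hb _ RT lebesgue_measure
  (beta_ext g h) kappa (fun z w t => hyp1F1 g h (t%:C * vsum (z + w)))
  (1 + normc (g - h) / Re h)) => //.
- by rewrite addr_ge0// divr_ge0 ?normc_ge0// ltW.
- move=> p; have I := cintegrableZl (r p) measurableT (beta_moment h0 hg (msize2 p)).1.
  by apply: eq_cintegrable I => // t _; exact: kE.
- move=> p; have [I E] := beta_moment h0 hg (msize2 p).
  transitivity (cintegral lebesgue_measure setT
      (fun t : RT => r p * (t%:C ^+ msize2 p * beta_ext g h t))).
    by apply: eq_cintegral => t _; rewrite kE.
  rewrite cintegralZl// E /r; have := poch_neq0 (msize2 p) h0; have := poch_neq0 (msize2 p) g0.
  by move=> n1 n2; field; rewrite n1 n2.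
- move=> p t; rewrite (Normc.normcM (kappa p t)).
  have [/andP[t0 t1]|tn] := boolP (0 <= t <= 1); last first.
    by rewrite /beta_ext (negbTE tn) Normc.normc0 !mulr0.
  rewrite ler_wpM2r ?normc_ge0// /kappa (Normc.normcM (r p)) normcX normc_real_ge0//.
  rewrite -[leRHS]mulr1; apply: ler_pM; rewrite ?normc_ge0 ?exprn_ge0//.
    exact: normc_poch_ratio.
  exact: exprn_ile1.
- move=> z w t; have [s ->] := hyp1F1_expansion g t%:C z w h0.
  by rewrite mulrC -csumZ//; apply: eq_csum => p; rewrite /kappa /r; ring.
Qed.

(** The coefficient of the pair (m, p) is that of [Psi2] at m + p times t^(m+p), and the Dirichlet
    moment of order m + p is its inverse. On the simplex all coordinates are at most 1, so the
    monomial in t does not affect the geometric bound. *)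
Lemma dirichlet_representation (g : R[i]) (h : V) : (0 < k)%N -> vRe_gt0 h ->
  Re (vsum h) < Re g ->
  let F (q : (RTk * RTk) * RTk) : R[i] :=
    Psi2 g h (vmul (vdiv x (line_pt q.1.1)) (vreal q.2)
              + vmul (vdiv y (line_pt q.1.2)) (vreal q.2))
    * mu q.1.1 * nu q.1.2 * dirichlet_ext g h q.2 in
  let mM : {measure set ((RTk * RTk) * RTk)%type -> \bar R} :=
    ((lebesgue_tuple R k \x lebesgue_tuple R k) \x lebesgue_tuple R k)%E in
  cintegrable mM setT F /\ cintegral mM setT F = Psi2 a c x * Psi2 b d y.
Proof.
move=> k0 h0 hg.
have g0 : 0 < Re g.
  apply: le_lt_trans hg; rewrite /vsum Re_sum; apply: sumr_ge0 => j _; exact/ltW/h0.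
pose r (p : M * M) := poch g (msize2 p) / \prod_j poch (h 0 j) (p.1 j + p.2 j).
pose mon (p : M * M) (t : RTk) : R[i] := \prod_j (tnth t j)%:C ^+ (p.1 j + p.2 j)%N.
pose kappa p (t : RTk) := r p * mon p t.
have moment (p : M * M) := dirichlet_moment k0 h0 hg (fun j => (p.1 j + p.2 j)%N).
have rhoI : cintegrable (lebesgue_tuple R k) setT (dirichlet_ext g h : RTk -> R[i]).
  apply: eq_cintegrable (dirichlet_moment k0 h0 hg (fun=> 0%N)).1 => // t _.
  by rewrite big1 ?mul1r// => j _; rewrite expr0.
have kE (p : M * M) (t : RTk) : r p * (mon p t * dirichlet_ext g h t) = kappa p t * dirichlet_ext g h t.
  by rewrite mulrA.
have size2E (p : M * M) : (\sum_j (p.1 j + p.2 j) = msize2 p)%N by rewrite big_split.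
have [K K0 HK] := normc_multi_poch_ratio g h0.
apply: (@product_representation R k x y c d a b hc ha hd hb _ RTk (lebesgue_tuple R k)
  (dirichlet_ext g h) kappa
  (fun z w t => Psi2 g h (vmul z (vreal t) + vmul w (vreal t))) K) => //.
- move=> p; have I := cintegrableZl (r p) measurableT (moment p).1.
  by apply: eq_cintegrable I => // t _; exact: kE.
- move=> p; have [I E] := moment p.
  transitivity (cintegral (lebesgue_tuple R k) setT
      (fun t : RTk => r p * (mon p t * dirichlet_ext g h t))).
    by apply: eq_cintegral => t _; rewrite kE.
  rewrite cintegralZl// E size2E /r; have n1 := poch_neq0 (msize2 p) g0.
  have n2 : \prod_j poch (h 0 j) (p.1 j + p.2 j) != 0.
    by apply/prodf_neq0 => j _; apply: poch_neq0; exact: h0.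
  by field; rewrite n1 n2.
- move=> p t; rewrite (Normc.normcM (kappa p t)).
  have [tS|tn] := boolP (t \in simplex R k); last first.
    by rewrite /dirichlet_ext (negbTE tn) Normc.normc0 !mulr0.
  have [ta tb] := set_mem tS.
  rewrite ler_wpM2r ?normc_ge0// /kappa (Normc.normcM (r p)).
  rewrite -[leRHS]mulr1; apply: ler_pM; rewrite ?normc_ge0//.
    have := HK [ffun j => p.1 j + p.2 j]%N; rewrite msize_add /r.
    by under eq_bigr do rewrite ffunE.
  rewrite /mon normc_prod; apply: prodr_ile1 => j _; rewrite normcX.
  rewrite normc_real_ge0// exprn_ge0//= exprn_ile1// (le_trans _ tb)// (bigD1 j)//= lerDl.
  by apply: sumr_ge0.
- move=> z w t; have [s ->] := Psi2_expansion g (vreal t) z w h0.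
  rewrite mulrC -csumZ//; apply: eq_csum => p; rewrite /kappa /r.
  have -> : mon p t = \prod_j vreal t 0 j ^+ (p.1 j + p.2 j).
    by apply: eq_bigr => j _; rewrite mxE.
  by ring.
Qed.

End concrete_representations.

Theorem proposition3p4 (R : realType) (k : nat) (hk : (1 <= k)%N)
    (x y c d : 'rV[R[i]]_k) (a b : R[i])
    (hc : vRe_gt0 (c - const_mx 1))
    (ha : complex.Re (vsum c) < complex.Re a + k%:R)
    (hd : vRe_gt0 (d - const_mx 1))
    (hb : complex.Re (vsum d) < complex.Re b + k%:R) :
  let R1 := measurableTypeR R in
  let Rk := (k.-tuple R1)%type in
  let mu := line_density (c - const_mx 1) (a + k%:R - vsum c) in
  let nu := line_density (d - const_mx 1) (b + k%:R - vsum d) in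
  (forall g h : R[i], 0 < complex.Re h -> complex.Re h < complex.Re g ->
    let F (p : (Rk * Rk) * R1) : R[i] :=
      let u := line_pt p.1.1 in let w := line_pt p.1.2 in let t := p.2 in
      hyp1F1 g h (t%:C * vsum (vdiv x u + vdiv y w))
      * mu p.1.1 * nu p.1.2 * beta_density h (g - h) t in
    let M : {measure set ((Rk * Rk) * R1)%type -> \bar R} :=
      ((lebesgue_tuple R k \x lebesgue_tuple R k) \x lebesgue_measure)%E in
    let D := [set: (Rk * Rk)%type] `*` `[0, 1]%classic in
    cintegrable M D F /\ Psi2 a c x * Psi2 b d y = cintegral M D F) /\
  (forall (g : R[i]) (h : 'rV[R[i]]_k), vRe_gt0 h ->
    complex.Re (vsum h) < complex.Re g ->
    let F (p : (Rk * Rk) * Rk) : R[i] :=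
      let u := line_pt p.1.1 in let w := line_pt p.1.2 in let t := vreal p.2 in
      Psi2 g h (vmul (vdiv x u) t + vmul (vdiv y w) t)
      * mu p.1.1 * nu p.1.2 * dirichlet_density h (g - vsum h) p.2 in
    let M : {measure set ((Rk * Rk) * Rk)%type -> \bar R} :=
      ((lebesgue_tuple R k \x lebesgue_tuple R k) \x lebesgue_tuple R k)%E in
    let D := [set: (Rk * Rk)%type] `*` simplex R k in
    cintegrable M D F /\ Psi2 a c x * Psi2 b d y = cintegral M D F).
Proof.
move=> R1 Rk mu nu; split => g h h0 hg F M D.
  apply: cintegral_supported (beta_representation x y hc ha hd hb h0 hg).
    exact: measurableX.
  move=> [[s t] v]; rewrite in_setX in_setT/= /beta_ext; case: ifPn => v01.
    by rewrite mem_set//= in_itv.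
  by rewrite memNset ?mulr0//= in_itv/= => v01'; rewrite v01' in v01.
apply: cintegral_supported (dirichlet_representation x y hc ha hd hb hk h0 hg).
  by apply: measurableX => //; exact: measurable_simplex.
move=> [[s t] v]; rewrite in_setX in_setT/= /dirichlet_ext; case: ifPn => // _.
by rewrite mulr0.
Qed.
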